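(* Let $u,q\in(0,1)$ and let $\lambda=(z_1,\dots,z_6,d_1,d_2)$ be generic complex parameters. Let $M_\lambda$ be the moduli space of $\mathcal{E}_u$-connections of type $\lambda$, with coordinates $(f,g)$, as defined in the context. Put $\overline\lambda=(z_1,qz_2,z_3,qz_4,z_5,z_6,q^{-1}d_1,q^{-1}d_2)$, and consider the modification that sends a connection of type $\lambda$ to its unique modification of type $\overline\lambda$, i.e. that shifts $$z_2\to qz_2,\quad z_4\to qz_4,\quad d_1\to q^{-1}d_1,\quad d_2\to q^{-1}d_2 .$$ Then this modification defines a regular morphism between the two moduli spaces $M_\lambda$ and $M_{\overline\lambda}$. Moreover, the coordinates $(\overline f,\overline g)$ on $M_{\overline\lambda}$ are related to $(f,g)$ by the $q$-P$(E_7^{(1)}/A_1^{(1)})$ discrete Painlev\'e equation $$\frac{\left(fg-\frac{\kappa_1}{\kappa_2}\right)\left(\overline f g-\frac{\kappa_1}{q\kappa_2}\right)}{(fg-1)(\overline f g-1)}=\frac{\left(g-\frac{\nu_5}{\kappa_2}\right)\left(g-\frac{\nu_6}{\kappa_2}\right)\left(g-\frac{\nu_7}{\kappa_2}\right)\left(g-\frac{\nu_8}{\kappa_2}\right)}{\left(g-\frac1{\nu_1}\right)\left(g-\frac1{\nu_2}\right)\left(g-\frac1{\nu_3}\right)\left(g-\frac1{\nu_4}\right)},$$ $$\frac{\left(fg-\frac{\kappa_1}{\kappa_2}\right)\left(f\underline g-\frac{q\kappa_1}{\kappa_2}\right)}{(fg-1)(f\underline g-1)}=\frac{\left(f-\frac{\kappa_1}{\nu_5}\right)\left(f-\frac{\kappa_1}{\nu_6}\right)\left(f-\frac{\kappa_1}{\nu_7}\right)\left(f-\frac{\kappa_1}{\nu_8}\right)}{(f-\nu_1)(f-\nu_2)(f-\nu_3)(f-\nu_4)},$$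 with the matching of parameters $$\nu_1=\frac1{z_6},\ \nu_2=\frac1{z_1},\ \nu_3=\frac1{z_3},\ \nu_4=\frac1{z_5},\ \nu_5=\frac{uz_4}{z_2},\ \nu_6=u,\ \nu_7=\frac{d_1z_4z_6}{u},\ \nu_8=\frac{d_2z_4z_6}{u},\ \kappa_1=\frac u{z_2},\ \kappa_2=\frac{z_4}u .$$
   Context: Notation: $\sigma(z)=z+\frac{u^2}{qz}$, so $\sigma(z/q)=\frac zq+\frac{u^2}{z}$ and $\sigma(u^2/z)=\sigma(z/q)$. Connections of type $\lambda$. An $\mathcal{E}_u$-connection of type $\lambda=(z_1,\dots,z_6,d_1,d_2)$ (on the bundle $\mathcal{O}\oplus\mathcal{O}(-1)$ over $\mathbb{P}^1$, after trivialization over the affine chart) is given by a rational $2\times2$ matrix $$A(z)=\frac1{P(z)}\begin{bmatrix}b_{11}(z)&b_{12}(z)/z\\ b_{21}(z)&b_{22}(z)\end{bmatrix},\qquad b_{21}(0)=0,$$ with polynomials $b_{ij}$ satisfying $\deg b_{11}\le6$, $\deg b_{12}\le8$, $\deg b_{21}\le5$, $\deg b_{22}\le6$, and such that: (1) $\det A(z)=Q(z)/P(z)$, where $P(z)=(z-z_1)(z-\frac{u^2}{z_2})(z-z_3)(z-\frac{u^2}{z_4})(z-z_5)(z-\frac{u^2}{z_6})$ and $Q(z)=\frac{z_1z_3z_5}{z_2z_4z_6}(z-\frac{u^2}{z_1})(z-z_2)(z-\frac{u^2}{z_3})(z-z_4)(z-\frac{u^2}{z_5})(z-z_6)$; (2)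 (asymptotic condition) with $S(x)=\begin{bmatrix}1&0\\0&x\end{bmatrix}$, as $z\to\infty$, $$S(\sigma(z/q))\,A(z)\,S^{-1}(\sigma(z))\sim\begin{bmatrix}d_1&0\\0&d_2\end{bmatrix}$$ (comparing determinants, $d_1d_2=\frac{z_1z_3z_5}{q\,z_2z_4z_6}$); (3) (involution condition) $A(u^2/z)=A^{-1}(z)$, and $A(u)$ is the identity matrix. Gauge equivalence. $A$ and $\hat A(z)=R(\sigma(z/q))A(z)R^{-1}(\sigma(z))$ are identified for all $R(x)=\begin{bmatrix}r_{11}&r_{12}(x)\\0&r_{22}\end{bmatrix}$ with $r_{11},r_{22}$ nonzero constants and $r_{12}$ a polynomial of degree $\le1$. $M_\lambda$ is the moduli space of matrices $A(z)$ of type $\lambda$ modulo this equivalence; it is two-dimensional. Modification. A modification of a connection is the connection induced on another vector bundle by a rational isomorphism of bundles that is regular, together with its inverse, outside a finite set; in matrix form $\overline A(z)=R(\sigma(z/q))A(z)R^{-1}(\sigma(z))$ with $R$ an invertible matrix of rational functions. Under non-degeneracy conditions on $\lambda$, a connection of type $\lambda$ has a unique modification of type $\overline\lambda$. Coordinates. Using gauge transformations, $b_{21}$ is reduced to $b_{21}(z)=z(z^2-u^2)(z-t)(z-\frac{u^2}t)$; put $p=b_{11}(t)/P(t)$. The involution condition induces the involution $(t,p)\leftrightarrow(u^2/t,1/p)$; the involution-invariant coordinates are $x=t+\frac{u^2}t$ and $y=\frac{pt-u}{pu-t}$. With $\sigma_1=z_2+z_4+z_6$, $\sigma_2=z_2z_4+z_4z_6+z_6z_2$,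 $\sigma_3=z_2z_4z_6$, the coordinates $(f,g)$ on $M_\lambda$ are $$f=\frac{\sigma_3(xy+u(y-1))-u^2(x^2-\sigma_1x+\sigma_2(y+1))+u^3(1-y)(\sigma_1-x)+u^4(1+y)}{\sigma_3x(xy+u(y-1))-u^2(\sigma_2xy+\sigma_3(y+1))+u^3\sigma_2(1-y)+u^4(\sigma_1(1+y)-x)+u^5(y-1)},$$ $$g=\frac{xyz_6+uz_6(y-1)-u^2(1+y)}{z_6(1+y)-x-u(1-y)} .$$ $(\overline f,\overline g)$ are the same expressions for the modified connection with parameters $\overline\lambda$. The underline denotes the value at the preceding step: the equation is given as two maps $(f,g)\mapsto(\overline f,g)$ and $(f,\underline g)\mapsto(f,g)$; shifting the second one by one step (so $\overline\kappa_1=\kappa_1/q$, $\overline\kappa_2=q\kappa_2$, $\overline\nu_i=\nu_i$) gives $(\overline f,g)\mapsto(\overline f,\overline g)$.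
   Formalization: The Painlevé equations are stated only for connections with A(-u) = identity; the involution condition also allows A(-u) = -identity, where they fail. The condition ''~ diag(d1,d2)'' is read as: the limit is similar to this matrix, as the normal form of b21 forces. *)

(* Defs.v *)
(* The definitions are over any numFieldType C; the intended one is C = R[i]
   for R : realType. *)
From mathcomp Require Import all_boot all_order all_algebra.
From mathcomp Require Import complex mpoly.
From mathcomp Require Import classical_sets reals.

Set Implicit Arguments.
Unset Strict Implicit.
Unset Printing Implicit Defensive.

Import Order.TTheory GRing.Theory Num.Theory.

Local Open Scope classical_set_scope.
Local Open Scope ring_scope.

Record param (C : Type) := Param {
  z1 : C; z2 : C; z3 : C; z4 : C; z5 : C; z6 : C; d1 : C; d2 : C }.

Section Connections.
Variable C : numFieldType.
Variables u q : C.

Implicit Types (lam : param C) (x y z t p : C).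

Definition mx2 (K : Type) (a b c d : K) : 'M[K]_2 :=
  \matrix_(i < 2, j < 2)
    if i == 0 then (if j == 0 then a else b) else (if j == 0 then c else d).

Definition param_coords lam : 'I_8 -> C :=
  tnth [tuple z1 lam; z2 lam; z3 lam; z4 lam; z5 lam; z6 lam; d1 lam; d2 lam].

(* The relation between d1 d2 and the z_i is forced by comparing determinants
   at infinity: off this hypersurface there is no connection of type lam, so
   the parameters range over it and not over all of C^8. *)
Definition parameter_space lam : Prop :=
  (forall k, param_coords lam k != 0) /\
  d1 lam * d2 lam = (z1 lam * z3 lam * z5 lam) / (q * z2 lam * z4 lam * z6 lam).

(* G holds outside a countable union of proper hypersurfaces of the (irreducible)
   parameter space.  Countably many are needed: a connection has a unique
   modification of the shifted type only if there is no resonance such as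
   z1 = q^k z3 or d1 = q^k d2, k ranging over the integers. *)
Definition generic (G : param C -> Prop) : Prop :=
  exists Phi : nat -> {mpoly C[8]},
    (forall n, exists2 lam, parameter_space lam
                          & (Phi n).@[param_coords lam] != 0) /\
    (forall lam, parameter_space lam ->
       (forall n, (Phi n).@[param_coords lam] != 0) -> G lam).

Definition sigma z : C := z + u ^+ 2 / (q * z).

Definition Ppol lam : {poly C} :=
  ('X - (z1 lam)%:P) * ('X - (u ^+ 2 / z2 lam)%:P) *
  ('X - (z3 lam)%:P) * ('X - (u ^+ 2 / z4 lam)%:P) *
  ('X - (z5 lam)%:P) * ('X - (u ^+ 2 / z6 lam)%:P).

Definition Qpol lam : {poly C} :=
  ((z1 lam * z3 lam * z5 lam) / (z2 lam * z4 lam * z6 lam)) *: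
  (('X - (u ^+ 2 / z1 lam)%:P) * ('X - (z2 lam)%:P) *
   ('X - (u ^+ 2 / z3 lam)%:P) * ('X - (z4 lam)%:P) *
   ('X - (u ^+ 2 / z5 lam)%:P) * ('X - (z6 lam)%:P)).

(* The value at z of the matrix A(z) with polynomial data b = (b_ij);
   meaningful for z != 0 and P(z) != 0. *)
Definition conn lam (b : 'M[{poly C}]_2) z : 'M[C]_2 :=
  ((Ppol lam).[z])^-1 *:
    mx2 (b 0 0).[z] ((b 0 1).[z] / z) (b 1 0).[z] (b 1 1).[z].

(* Asking for 0 < M (hence M real) matters: for a non-real M the condition
   M < `|z| never holds. *)
Definition tends_at_infinity (F : C -> C) (l : C) : Prop :=
  forall eps, 0 < eps ->
    exists2 M, 0 < M & forall z, M < `|z| -> `|F z - l| < eps.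

Definition Smx x : 'M[C]_2 := mx2 1 0 0 x.

(* In the asymptotic condition, "~ diag(d1, d2)" means that the limit, i.e. the
   matrix of the connection in the fibre at infinity, is similar to
   diag(d1, d2).  It is not an entrywise limit: b_21 of degree exactly 5, as in
   the normal form used for the coordinates, gives the limit a nonzero entry
   off the diagonal. *)
Record has_type lam (b : 'M[{poly C}]_2) : Prop := HasType {
  type_degrees : [/\ (size (b 0%R 0%R) <= 7)%N, (size (b 0%R 1%R) <= 9)%N,
                     (size (b 1%R 0%R) <= 6)%N & (size (b 1%R 1%R) <= 7)%N];
  type_b21 : (b 1 0).[0] = 0;
  type_det : forall z, z != 0 -> (Ppol lam).[z] != 0 ->
    \det (conn lam b z) = (Qpol lam).[z] / (Ppol lam).[z];
  type_asymptotic : exists2 L : 'M[C]_2,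
    (forall i j, tends_at_infinity
       (fun z => (Smx (sigma (z / q)) *m conn lam b z
                    *m invmx (Smx (sigma z))) i j) (L i j)) &
    exists2 V : 'M[C]_2, V \in unitmx &
      V *m L *m invmx V = mx2 (d1 lam) 0 0 (d2 lam);
  type_involution : forall z,
    z != 0 -> (Ppol lam).[z] != 0 -> (Qpol lam).[z] != 0 ->
    conn lam b (u ^+ 2 / z) = invmx (conn lam b z);
  type_identity : conn lam b u = 1%:M }.

Definition gauge_equiv lam (b b' : 'M[{poly C}]_2) : Prop :=
  exists r11 r22 : C, exists r12 : {poly C},
    [/\ r11 != 0, r22 != 0, (size r12 <= 2)%N &
        let R x := mx2 r11 r12.[x] 0 r22 in
        forall z, z != 0 -> (Ppol lam).[z] != 0 ->
          conn lam b' z =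
          R (sigma (z / q)) *m conn lam b z *m invmx (R (sigma z))].

(* The invertible rational matrix is written R = N / d with a common
   denominator d; the identity of rational functions in z is required off a
   finite set, where poles may occur. *)
Definition modification lam lam' (b b' : 'M[{poly C}]_2) : Prop :=
  exists (N : 'M[{poly C}]_2) (d : {poly C}),
    [/\ \det N != 0, d != 0 &
        let R x := (d.[x])^-1 *: map_mx (fun r : {poly C} => r.[x]) N in
        exists s : seq C, forall z, z \notin s ->
          conn lam' b' z =
          R (sigma (z / q)) *m conn lam b z *m invmx (R (sigma z))].

Definition gauge_class lam b : set 'M[{poly C}]_2 :=
  [set b' | has_type lam b' /\ gauge_equiv lam b b'].

Definition moduli lam :=
  {m : set 'M[{poly C}]_2 | exists2 b, has_type lam b & m = gauge_class lam b}.

(* M_lam is the quotient, as a space with functions, of the affine variety of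
   matrices of type lam (in the affine space of coefficients of the b_ij) by
   the gauge group: it carries the quotient of the Zariski topology, and the
   regular functions on an open set are the gauge invariant functions that are
   locally fractions of polynomials in these coefficients.  By the degree
   bounds the coefficients of index < 9 determine b. *)
Definition coef_index := ('I_2 * 'I_2 * 'I_9)%type.

Definition coef_poly := {mpoly C[#|{: coef_index}|]}.

Definition coefs (b : 'M[{poly C}]_2) : 'I_#|{: coef_index}| -> C :=
  fun k => let: (i, j, l) := (enum_val k : coef_index) in (b i j)`_l.

Definition zariski_open lam (V : set (moduli lam)) : Prop :=
  exists I : set coef_poly, forall m b, sval m b ->
    (V m <-> exists2 h, I h & h.@[coefs b] != 0).

Definition regular_on lam (V : set (moduli lam)) (F : moduli lam -> C) : Prop :=
  forall m b, V m -> sval m b ->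
    exists num den : coef_poly, den.@[coefs b] != 0 /\
      forall m' b', V m' -> sval m' b' -> den.@[coefs b'] != 0 ->
        F m' = num.@[coefs b'] / den.@[coefs b'].

Definition regular_morphism lam lam' (phi : moduli lam -> moduli lam') : Prop :=
  forall V : set (moduli lam'), zariski_open V ->
    zariski_open (phi @^-1` V) /\
    (forall F, regular_on V F -> regular_on (phi @^-1` V) (F \o phi)).

(* The equivalence says both that each connection in m has a modification of
   type lam', unique up to gauge equivalence, and that phi m is its class. *)
Definition modification_map lam lam' (phi : moduli lam -> moduli lam') : Prop :=
  forall m b b', sval m b -> has_type lam' b' ->
    (modification lam lam' b b' <-> sval (phi m) b').

Definition sigma1 lam : C := z2 lam + z4 lam + z6 lam.
Definition sigma2 lam : C :=
  z2 lam * z4 lam + z4 lam * z6 lam + z6 lam * z2 lam.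
Definition sigma3 lam : C := z2 lam * z4 lam * z6 lam.

Definition f_num lam x y : C :=
  sigma3 lam * (x * y + u * (y - 1))
  - u ^+ 2 * (x ^+ 2 - sigma1 lam * x + sigma2 lam * (y + 1))
  + u ^+ 3 * (1 - y) * (sigma1 lam - x) + u ^+ 4 * (1 + y).

Definition f_den lam x y : C :=
  sigma3 lam * x * (x * y + u * (y - 1))
  - u ^+ 2 * (sigma2 lam * x * y + sigma3 lam * (y + 1))
  + u ^+ 3 * sigma2 lam * (1 - y)
  + u ^+ 4 * (sigma1 lam * (1 + y) - x) + u ^+ 5 * (y - 1).

Definition g_num lam x y : C :=
  x * y * z6 lam + u * z6 lam * (y - 1) - u ^+ 2 * (1 + y).

Definition g_den lam x y : C :=
  z6 lam * (1 + y) - x - u * (1 - y).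

(* (f, g) are defined at m and have the given values. *)
Definition coordinates lam (m : moduli lam) (f g : C) : Prop :=
  exists (b : 'M[{poly C}]_2) (t p : C),
    [/\ sval m b,
        t != 0 /\
        b 1 0 = 'X * ('X^2 - (u ^+ 2)%:P) * ('X - t%:P)
                   * ('X - (u ^+ 2 / t)%:P),
        (Ppol lam).[t] != 0 /\ p = (b 0 0).[t] / (Ppol lam).[t],
        p * u - t != 0 &
        let x := t + u ^+ 2 / t in
        let y := (p * t - u) / (p * u - t) in
        [/\ f_den lam x y != 0, g_den lam x y != 0,
            f = f_num lam x y / f_den lam x y &
            g = g_num lam x y / g_den lam x y]].

(* The involution and determinant conditions force A(-u) = 1 or A(-u) = -1.
   Both signs occur, on two disjoint open parts of M_lam; the coordinates
   (f, g) satisfy the Painleve equation on the first part and not on the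
   second. *)
Definition identity_at_minus_u lam (m : moduli lam) : Prop :=
  forall b, sval m b -> conn lam b (- u) = 1%:M.

Definition lambda_bar lam : param C :=
  Param (z1 lam) (q * z2 lam) (z3 lam) (q * z4 lam) (z5 lam) (z6 lam)
        (q^-1 * d1 lam) (q^-1 * d2 lam).

Definition nu1 lam : C := (z6 lam)^-1.
Definition nu2 lam : C := (z1 lam)^-1.
Definition nu3 lam : C := (z3 lam)^-1.
Definition nu4 lam : C := (z5 lam)^-1.
Definition nu5 lam : C := u * z4 lam / z2 lam.
Definition nu6 lam : C := u.
Definition nu7 lam : C := d1 lam * z4 lam * z6 lam / u.
Definition nu8 lam : C := d2 lam * z4 lam * z6 lam / u.
Definition kappa1 lam : C := u / z2 lam.
Definition kappa2 lam : C := z4 lam / u.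

(* The first equation, with its denominators assumed nonzero; fb is f at the
   next step. *)
Definition qPE7_first lam (f fb g : C) : Prop :=
  let k1 := kappa1 lam in let k2 := kappa2 lam in
  let dl := (f * g - 1) * (fb * g - 1) in
  let dr := (g - 1 / nu1 lam) * (g - 1 / nu2 lam)
            * (g - 1 / nu3 lam) * (g - 1 / nu4 lam) in
  dl != 0 -> dr != 0 ->
  (f * g - k1 / k2) * (fb * g - k1 / (q * k2)) / dl
  = (g - nu5 lam / k2) * (g - nu6 lam / k2)
    * (g - nu7 lam / k2) * (g - nu8 lam / k2) / dr.

(* The second equation, with its denominators assumed nonzero; gu is g at the
   preceding step. *)
Definition qPE7_second lam (f g gu : C) : Prop :=
  let k1 := kappa1 lam in let k2 := kappa2 lam in
  let dl := (f * g - 1) * (f * gu - 1) in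
  let dr := (f - nu1 lam) * (f - nu2 lam) * (f - nu3 lam) * (f - nu4 lam) in
  dl != 0 -> dr != 0 ->
  (f * g - k1 / k2) * (f * gu - q * k1 / k2) / dl
  = (f - k1 / nu5 lam) * (f - k1 / nu6 lam)
    * (f - k1 / nu7 lam) * (f - k1 / nu8 lam) / dr.

End Connections.

(* Main.v *)
(* Let B = P A.  Off resonances, a modification between two connections of the
   same type is a gauge transformation: a root of its denominator would propagate
   along q^Z to infinitely many roots, and d1 / d2 outside q^Z excludes growth at
   infinity.  The modification shifting z2, z4 is written explicitly: R vanishes on
   the kernels of B at z2 and z4, which are rational in the coefficients of b, and
   R B adj(R) is divisible by (z - z2)(z - z4)(z - u^2/z2)(z - u^2/z4).

   For the equation, f and g are characterized by rows (phi, W / z), with phi = f z - 1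
   or phi = g - z, that A exchanges under z -> u^2 / z up to a scalar.  The
   determinant of the two rows has four roots z1, z3, z5, z6, and R carries the row
   of g to the row of f of the modified connection; evaluating at z = g, at
   infinity and at z = 1 / f gives the relations whose product is the equation. *)
Require Import Defs.
From mathcomp Require Import all_boot all_order all_algebra.
From mathcomp Require Import complex mpoly classical_sets boolp reals.
From mathcomp Require Import ring zify.

Set Implicit Arguments.
Unset Strict Implicit.
Unset Printing Implicit Defensive.

Import Order.TTheory GRing.Theory Num.Theory.
Local Open Scope ring_scope.

(** * Matrices of size two and Laurent polynomials *)

Section Mx2.

(** After multiplication by P the entries are Laurent polynomials in z, so an identity checked off a
    finite set holds at all z != 0, in particular at the zeros of P and Q, where the kernels are
    taken and where A has poles or is singular. The map sigma has degree two, so a zero sigma(z2) of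
    det R shows up, through sigma(z/q), at the two points q z2 and u^2/z2. The points u^2/z2 and
    u^2/z4 are divided out, while q z2 and q z4 enter the new twisting factor; this is why a row of
    index g becomes one of index f for the shifted parameters. The obstacle is that a modification
    is only a relation, with an unspecified rational matrix. By uniqueness up to gauge, two
    connections so related are also related by the explicit matrix times a gauge factor, and the
    equations are derived for any such product, so that both connections may be in normal form. The
    condition A(-u) = 1 enters where a row is solved for: the first column of its equation must
    vanish at -u as well as at u for the division by b_21/z to be exact. *)

Lemma mx2E (K : Type) (a b c d : K) :
  (mx2 a b c d 0 0 = a) * (mx2 a b c d 0 1 = b) *
  (mx2 a b c d 1 0 = c) * (mx2 a b c d 1 1 = d).
Proof. by rewrite !mxE. Qed.

Lemma ord2P (P : 'I_2 -> Prop) : P 0 -> P 1 -> forall i, P i.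
Proof.
move=> P0 P1 [[|[|i]] Hi] //.
- by have -> : Ordinal Hi = 0 by exact: val_inj.
- by have -> : Ordinal Hi = 1 by exact: val_inj.
Qed.

Lemma mx2_ext (K : Type) (A B : 'M[K]_2) :
  A 0 0 = B 0 0 -> A 0 1 = B 0 1 -> A 1 0 = B 1 0 -> A 1 1 = B 1 1 -> A = B.
Proof. by move=> *; apply/matrixP; apply: ord2P; apply: ord2P. Qed.

Lemma mx2_eta (K : Type) (A : 'M[K]_2) : A = mx2 (A 0 0) (A 0 1) (A 1 0) (A 1 1).
Proof. by apply: mx2_ext; rewrite !mxE. Qed.

Lemma mul_mx2E (K : pzSemiRingType) (A B : 'M[K]_2) i j :
  (A *m B) i j = A i 0 * B 0 j + A i 1 * B 1 j.
Proof.
rewrite mxE !big_ord_recl big_ord0 addr0.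
by congr (A i _ * B _ j + A i _ * B _ j); apply: val_inj.
Qed.

Lemma mul_mx2 (K : pzSemiRingType) (a b c d a' b' c' d' : K) :
  mx2 a b c d *m mx2 a' b' c' d' =
  mx2 (a * a' + b * c') (a * b' + b * d') (c * a' + d * c') (c * b' + d * d').
Proof. by apply: mx2_ext; rewrite mul_mx2E !mx2E. Qed.

Lemma scale_mx2 (K : pzRingType) (k a b c d : K) :
  k *: mx2 a b c d = mx2 (k * a) (k * b) (k * c) (k * d).
Proof. by apply: mx2_ext; rewrite mxE !mx2E. Qed.

Lemma scalar_mx2 (K : pzRingType) (k : K) : k%:M = mx2 k 0 0 k.
Proof. by apply: mx2_ext; rewrite !mxE. Qed.

Lemma det2E (K : comPzRingType) (A : 'M[K]_2) :
  \det A = A 0 0 * A 1 1 - A 0 1 * A 1 0.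
Proof.
rewrite (expand_det_row _ 0) !big_ord_recl big_ord0 /cofactor !det_mx11 !mxE.
rewrite addr0 /= expr0 expr1 mul1r mulN1r mulrN.
by congr (A _ _ * A _ _ - A _ _ * A _ _); exact: val_inj.
Qed.

Lemma det_mx2 (K : comPzRingType) (a b c d : K) :
  \det (mx2 a b c d) = a * d - b * c.
Proof. by rewrite det2E !mx2E. Qed.

Lemma invmx_mx2 (K : fieldType) (a b c d : K) : a * d - b * c != 0 ->
  invmx (mx2 a b c d) = (a * d - b * c)^-1 *: mx2 d (- b) (- c) a.
Proof.
move=> D0; have U : mx2 a b c d \in unitmx by rewrite unitmxE unitfE det_mx2.
apply: (can_inj (mulKmx U)); rewrite mulmxV // -scalemxAr mul_mx2 scale_mx2.
by rewrite scalar_mx2; apply: mx2_ext; rewrite !mx2E; field.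
Qed.

Definition adj2 (K : comPzRingType) (A : 'M[K]_2) : 'M[K]_2 :=
  mx2 (A 1 1) (- A 0 1) (- A 1 0) (A 0 0).

Lemma mul_adj2 (K : comPzRingType) (A : 'M[K]_2) : A *m adj2 A = (\det A)%:M.
Proof.
by rewrite {1}(mx2_eta A) /adj2 mul_mx2 det2E scalar_mx2;
  apply: mx2_ext; rewrite !mx2E; ring.
Qed.

Lemma adj2_mul (K : comPzRingType) (A : 'M[K]_2) : adj2 A *m A = (\det A)%:M.
Proof.
by rewrite {2}(mx2_eta A) /adj2 mul_mx2 det2E scalar_mx2;
  apply: mx2_ext; rewrite !mx2E; ring.
Qed.

Lemma det_adj2 (K : comPzRingType) (A : 'M[K]_2) : \det (adj2 A) = \det A.
Proof. by rewrite det_mx2 det2E; ring. Qed.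

End Mx2.

Lemma coefM_top (K : nzRingType) (m n : nat) (p r : {poly K}) :
  (size p <= m.+1)%N -> (size r <= n.+1)%N -> (p * r)`_(m + n) = p`_m * r`_n.
Proof.
move=> sp sr; rewrite coefM (bigD1 (inord m)) //= inordK ?ltnS ?leq_addr // addKn.
rewrite big1 ?addr0 // => i ne.
have [im|im|im] := ltngtP i m.
- rewrite [r`__]nth_default ?mulr0 //; apply: leq_trans sr _.
  by rewrite ltn_subRL ltn_add2r.
- by rewrite nth_default ?mul0r //; apply: leq_trans sp _.
- by case/eqP: ne; apply: val_inj; rewrite /= inordK ?ltnS ?leq_addr // im.
Qed.

Lemma size_polyM_top (K : nzRingType) (m n : nat) (p r : {poly K}) :
  (size p <= m.+1)%N -> (size r <= n.+1)%N -> (size (p * r)%R <= (m + n).+1)%N.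
Proof.
move=> sp sr; apply: leq_trans (size_polyMleq _ _) _.
by rewrite -subn1 leq_subLR add1n -addSn -addnS leq_add.
Qed.

Ltac horner_simp :=
  rewrite ?(hornerXn, hornerX, hornerC, horner0, hornerM, hornerD, hornerN, hornerZ).

(** * Laurent polynomial functions and identities off a finite set *)

Section Laurent.
Variable C : numClosedFieldType.
Implicit Types (F G : C -> C) (p : {poly C}) (z : C).

Lemma poly_cofinite p (s : seq C) : (forall z, z \notin s -> p.[z] = 0) -> p = 0.
Proof.
move=> H; apply/eqP; apply/negPn/negP => p0.
have /closed_nonrootP [z] : p * \prod_(x <- s) ('X - x%:P) != 0.
  by rewrite mulf_neq0 // monic_neq0 // monic_prod_XsubC.
rewrite rootM root_prod_XsubC negb_or => /andP[/negP + zs].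
by apply; apply/rootP/H.
Qed.

Lemma poly_cofinite_eq p (r : {poly C}) (s : seq C) :
  (forall z, z \notin s -> p.[z] = r.[z]) -> p = r.
Proof.
move=> H; apply/eqP; rewrite -subr_eq0; apply/eqP.
by apply: (@poly_cofinite _ s) => z /H; rewrite !hornerE => ->; rewrite subrr.
Qed.

(** Closed under sums, products and substitution into polynomials, and containing sigma(z),
    sigma(z/q) and u^2/z, this class covers every matrix entry compared below; its members are
    determined by their values off a finite set. *)
Definition laurent F :=
  exists (p : {poly C}) (n : nat), forall z, z != 0 -> F z = p.[z] / z ^+ n.

Lemma laurent_ext F G : (forall z, z != 0 -> F z = G z) -> laurent F -> laurent G.
Proof. by move=> E [p [n H]]; exists p, n => z z0; rewrite -E // H. Qed.

Lemma laurent_poly p : laurent (fun z => p.[z]).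
Proof. by exists p, 0 => z _; rewrite expr0 divr1. Qed.

Lemma laurent_cst a : laurent (fun=> a).
Proof. by apply: (laurent_ext _ (laurent_poly a%:P)) => z _; rewrite hornerC. Qed.

Lemma laurent_id : laurent id.
Proof. by apply: (laurent_ext _ (laurent_poly 'X)) => z _; rewrite hornerX. Qed.

Lemma laurent_inv : laurent (fun z => z^-1).
Proof. by exists 1, 1 => z _; rewrite hornerC expr1 div1r. Qed.

Lemma laurent_add F G : laurent F -> laurent G -> laurent (fun z => F z + G z).
Proof.
move=> [p [n Hp]] [r [m Hr]]; exists (p * 'X^m + r * 'X^n), (n + m) => z z0.
rewrite Hp // Hr // hornerD !hornerM !hornerXn exprD.
by field; rewrite !expf_neq0.
Qed.

Lemma laurent_mul F G : laurent F -> laurent G -> laurent (fun z => F z * G z).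
Proof.
move=> [p [n Hp]] [r [m Hr]]; exists (p * r), (n + m) => z z0.
rewrite Hp // Hr // hornerM exprD.
by field; rewrite !expf_neq0.
Qed.

Lemma laurent_opp F : laurent F -> laurent (fun z => - F z).
Proof.
move=> HF; apply: (laurent_ext _ (laurent_mul (laurent_cst (-1)) HF)) => z _.
by rewrite mulN1r.
Qed.

Lemma laurent_horner p F : laurent F -> laurent (fun z => p.[F z]).
Proof.
move=> HF; elim/poly_ind: p => [|p c IH].
  by apply: (laurent_ext _ (laurent_cst 0)) => z _; rewrite horner0.
apply: (laurent_ext _ (laurent_add (laurent_mul IH HF) (laurent_cst c))) => z _.
by rewrite !hornerE.
Qed.

Lemma laurent_zero F (s : seq C) : laurent F ->
  (forall z, z \notin s -> F z = 0) -> forall z, z != 0 -> F z = 0.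
Proof.
move=> [p [n H]] Hs z z0; suff -> : F z = p.[z] / z ^+ n.
  suff -> : p = 0 by rewrite horner0 mul0r.
  apply: (@poly_cofinite _ (0 :: s)) => x; rewrite inE negb_or => /andP[x0 xs].
  have := H _ x0; rewrite (Hs _ xs) => /esym/eqP.
  by rewrite mulf_eq0 invr_eq0 expf_eq0 (negbTE x0) andbF orbF => /eqP.
exact: H.
Qed.

Lemma laurent_finite F z0 : laurent F -> z0 != 0 -> F z0 != 0 ->
  exists s : seq C, forall z, z \notin s -> z != 0 /\ F z != 0.
Proof.
move=> [p [n H]] z00 Fz0.
have p0 : p != 0.
  by apply: contraNneq Fz0 => p0; rewrite H // p0 horner0 mul0r.
have [r Er] := closed_field_poly_normal p.
exists (0 :: r) => z; rewrite inE negb_or => /andP[zn0 zr]; split=> //.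
rewrite H // mulf_neq0 ?invr_neq0 ?expf_neq0 // Er hornerZ mulf_neq0 ?lead_coef_eq0 //.
by rewrite -rootE root_prod_XsubC.
Qed.

(** As c is not a root of unity, the points z0 c^k are pairwise distinct and give the numerator too
    many roots. This excludes an infinite q-orbit of zeros. *)
Lemma laurent_progression F (z0 c : C) : laurent F -> z0 != 0 -> c != 0 ->
  (forall k, (0 < k)%N -> c ^+ k != 1) ->
  (forall k, F (z0 * c ^+ k) = 0) -> forall z, z != 0 -> F z = 0.
Proof.
move=> LF z00 c0 Hc HF z zn0; apply/eqP/negPn/negP => Fz.
have [p [n H]] := LF.
have p0 : p != 0 by apply: contraNneq Fz => p0; rewrite H // p0 horner0 mul0r.
(* As many roots as [size p], one more than the degree allows. *)
pose rs := [seq z0 * c ^+ k | k <- iota 0 (size p)].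
have inj k l : (k < l)%N -> c ^+ k != c ^+ l.
  move=> kl; rewrite -(subnKC (ltnW kl)) exprD -subr_eq0 -{1}(mulr1 (c ^+ k)).
  rewrite -mulrBr mulf_neq0 ?expf_neq0 // subr_eq0 eq_sym.
  by apply: Hc; rewrite subn_gt0.
have U : uniq rs.
  rewrite map_inj_uniq ?iota_uniq // => k l /(mulfI z00).
  by case: (ltngtP k l) => // /inj /eqP Hkl E; case: Hkl.
have A : all (root p) rs.
  apply/allP => x /mapP[k _ ->]; apply/rootP.
  have w0 : z0 * c ^+ k != 0 by rewrite mulf_neq0 ?expf_neq0.
  have := H _ w0; rewrite HF => /esym/eqP.
  by rewrite mulf_eq0 invr_eq0 expf_eq0 (negbTE w0) andbF orbF => /eqP.
by have := max_poly_roots p0 A U; rewrite size_map size_iota ltnn.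
Qed.

End Laurent.

Lemma coefM_topn (K : nzRingType) (m n k : nat) (p r : {poly K}) : (m + n)%N = k ->
  (size p <= m.+1)%N -> (size r <= n.+1)%N -> (p * r)`_k = p`_m * r`_n.
Proof. by move=> <-; exact: coefM_top. Qed.

(** * Polynomial lifts of p(a z + c/z) *)

Section Lift.
Variable C : fieldType.
Implicit Types (p : {poly C}) (a c z : C).

(** Homogenization: this is z^n p(a z + c/z) for p of degree at most n. With (a, c) = (1, u^2/q) the
    argument is sigma(z), with (1/q, u^2) it is sigma(z/q). *)
Definition zlift (a c : C) (n : nat) (p : {poly C}) : {poly C} :=
  \sum_(i < n.+1) p`_i *: ((a *: 'X^2 + c%:P) ^+ i * 'X^(n - i)).

Lemma horner_zlift a c n p z : (size p <= n.+1)%N -> z != 0 ->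
  (zlift a c n p).[z] = z ^+ n * p.[a * z + c / z].
Proof.
move=> sp z0; rewrite (horner_coef_wide _ sp) /zlift horner_sum mulr_sumr.
apply: eq_bigr => i _; rewrite hornerZ hornerM horner_exp; horner_simp.
have -> : a * z ^+ 2 + c = z * (a * z + c / z) by field.
have -> : z ^+ n = z ^+ i * z ^+ (n - i) by rewrite -exprD subnKC ?leq_ord.
by rewrite exprMn; ring.
Qed.

Lemma size_quad a c i : (size ((a *: 'X^2 + c%:P : {poly C}) ^+ i)%R <= i.*2.+1)%N.
Proof.
elim: i => [|i IH]; first by rewrite expr0 size_poly1.
rewrite exprS doubleS -[i.*2.+2]/(2 + i.*2)%N; apply: size_polyM_top IH.
rewrite (leq_trans (size_polyD _ _)) // geq_max size_polyC.
rewrite (leq_trans (size_scale_leq _ _)) ?size_polyXn //.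
by case: (c != 0).
Qed.

Lemma coef_quad a c i : ((a *: 'X^2 + c%:P : {poly C}) ^+ i)`_(i.*2) = a ^+ i.
Proof.
elim: i => [|i IH]; first by rewrite expr0 coef1.
rewrite exprS (@coefM_topn _ 2 i.*2) ?doubleS ?size_quad //.
  by rewrite IH coefD coefZ coefXn coefC addr0 mulr1 -exprS.
by have := size_quad a c 1; rewrite expr1.
Qed.

Lemma size_zlift a c n p : (size (zlift a c n p) <= n.*2.+1)%N.
Proof.
apply: (leq_trans (size_sum _ _ _)); apply/bigmax_leqP => i _.
apply: (leq_trans (size_scale_leq _ _)).
have /leq_trans -> // := size_polyM_top (size_quad a c i) (eq_leq (size_polyXn _ (n - i))).
have -> : n.*2 = (i.*2 + (n - i).*2)%N by rewrite -doubleD subnKC ?leq_ord.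
by rewrite ltnS leq_add2l -addnn leq_addr.
Qed.

Lemma coef_zlift a c n p : (zlift a c n p)`_(n.*2) = p`_n * a ^+ n.
Proof.
rewrite /zlift coef_sum big_ord_recr /= subnn expr0 mulr1 coefZ coef_quad.
rewrite big1 ?add0r // => i _; rewrite coefZ [X in _ * X]nth_default ?mulr0 //.
have /leq_trans -> // := size_polyM_top (size_quad a c i) (eq_leq (size_polyXn _ (n - i))).
have lt := ltn_ord i.
have -> : n.*2 = (i.*2 + (n - i).*2)%N by rewrite -doubleD subnKC // ltnW.
by rewrite -addnS leq_add2l -addnn -addn1 leq_add2l subn_gt0.
Qed.

End Lift.

(** * Limits at infinity *)

Section Limits.
Variable C : numFieldType.
Implicit Types (F G : C -> C) (l m : C).

Lemma tends_eq F G l :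
  tends_at_infinity F l ->
  (exists2 M : C, 0 < M & forall z, M < `|z| -> F z = G z) ->
  tends_at_infinity G l.
Proof.
move=> H [M M0 E] eps /H [N N0 HN]; exists (M + N); first exact: addr_gt0.
move=> z Hz; rewrite -E; last by apply: le_lt_trans Hz; rewrite lerDl ltW.
by apply: HN; apply: le_lt_trans Hz; rewrite lerDr ltW.
Qed.

Lemma tends_cst l : tends_at_infinity (fun=> l) l.
Proof. by move=> eps e0; exists 1 => // z _; rewrite subrr normr0. Qed.

Lemma tends_add F G l m : tends_at_infinity F l -> tends_at_infinity G m ->
  tends_at_infinity (fun z => F z + G z) (l + m).
Proof.
move=> HF HG eps e0; have e2 : 0 < eps / 2 by rewrite divr_gt0 // ltr0n.
have [M M0 HM] := HF _ e2; have [N N0 HN] := HG _ e2.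
exists (M + N); first exact: addr_gt0.
move=> z Hz; have -> : F z + G z - (l + m) = (F z - l) + (G z - m) by ring.
apply: le_lt_trans (ler_normD _ _) _; rewrite [ltRHS]splitr ltrD //.
  by apply: HM; apply: le_lt_trans Hz; rewrite lerDl ltW.
by apply: HN; apply: le_lt_trans Hz; rewrite lerDr ltW.
Qed.

Lemma tends_mul F G l m : tends_at_infinity F l -> tends_at_infinity G m ->
  tends_at_infinity (fun z => F z * G z) (l * m).
Proof.
move=> HF HG eps e0.
(* With d = eps / D one has d < 1 and d D = eps, so the error d^2 + d (|l| + |m|) is below d (1 +
   |l| + |m|), which is at most eps. *)
set D := eps + `|l| + `|m| + 1.
have D0 : 0 < D by rewrite /D ltr_wpDl // !addr_ge0 // ltW.
pose d := eps / D.
have d0 : 0 < d by rewrite divr_gt0.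
have [M M0 HM] := HF _ d0; have [N N0 HN] := HG _ d0.
exists (M + N); first exact: addr_gt0.
move=> z Hz.
have H1 : `|F z - l| < d by apply: HM; apply: le_lt_trans Hz; rewrite lerDl ltW.
have H2 : `|G z - m| < d by apply: HN; apply: le_lt_trans Hz; rewrite lerDr ltW.
have -> : F z * G z - l * m =
  (F z - l) * (G z - m) + (l * (G z - m) + (F z - l) * m) by ring.
apply: le_lt_trans (ler_normD _ _) _.
have B1 : `|(F z - l) * (G z - m)| <= d * d.
  by rewrite normrM ler_pM // ltW.
have B2 : `|l * (G z - m) + (F z - l) * m| <= d * (`|l| + `|m|).
  apply: le_trans (ler_normD _ _) _; rewrite !normrM mulrDr lerD //.
    by rewrite mulrC ler_wpM2r // ltW.
  by rewrite ler_wpM2r // ltW.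
apply: le_lt_trans (lerD B1 B2) _; rewrite -mulrDr.
have d1 : d < 1.
  by rewrite /d ltr_pdivrMr // mul1r /D -!addrA ltrDl ltr_wpDl // ltr_wpDl.
have -> : eps = d * D by rewrite /d mulfVK // gt_eqF.
rewrite ltr_pM2l //.
apply: (@lt_le_trans _ _ (1 + (`|l| + `|m|))); first by rewrite ltrD2r.
by rewrite /D (addrC _ 1) lerD2l -addrA lerDr ltW.
Qed.

Lemma tends_inv F l : l != 0 -> tends_at_infinity F l ->
  tends_at_infinity (fun z => (F z)^-1) l^-1.
Proof.
move=> l0 HF eps e0; have nl : 0 < `|l| by rewrite normr_gt0.
set E := 1 + eps * `|l|.
have E0 : 0 < E by rewrite addr_gt0 // mulr_gt0.
(* This d solves d + |l| / E = |l|: being d-close to l forces |F z| > |l| / E, which is the lower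
   bound that turns d into eps. *)
pose d := eps * `|l| * `|l| / E.
have d0 : 0 < d by rewrite divr_gt0 // !mulr_gt0.
have [M M0 HM] := HF _ d0; exists M => // z /HM H.
have dl : d + `|l| / E = `|l|.
  by rewrite /d /E; field; rewrite gt_eqF.
have Fz : `|l| / E < `|F z|.
  rewrite -(ltrD2l d) dl; have -> : l = F z - (F z - l) by ring.
  apply: le_lt_trans (ler_normB _ _) _.
  by rewrite addrC ltrD2r.
have F0 : F z != 0.
  by rewrite -normr_gt0; apply: lt_trans Fz; rewrite divr_gt0.
have -> : (F z)^-1 - l^-1 = - ((F z - l) / (F z * l)) by field; rewrite l0 F0.
rewrite normrN normf_div normrM ltr_pdivrMr ?mulr_gt0 ?normr_gt0 //.
apply: lt_trans H _; rewrite /d -[ltLHS]mulrA.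
have -> : eps * (`|F z| * `|l|) = eps * `|l| * `|F z| by ring.
by rewrite ltr_pM2l // mulr_gt0.
Qed.

Lemma tends_Vz : tends_at_infinity (fun z : C => z^-1) 0.
Proof.
move=> eps e0; exists eps^-1; first by rewrite invr_gt0.
move=> z Hz; rewrite subr0 normfV invf_plt ?posrE //.
by apply: lt_trans Hz; rewrite invr_gt0.
Qed.

Lemma tends_unique F l m :
  tends_at_infinity F l -> tends_at_infinity F m -> l = m.
Proof.
move=> Hl Hm; apply/eqP/negPn/negP => lm.
have e0 : 0 < `|l - m| / 2 by rewrite divr_gt0 ?normr_gt0 ?subr_eq0 ?ltr0n.
have [M M0 HM] := Hl _ e0; have [N N0 HN] := Hm _ e0.
pose z := M + N + 1.
have z0 : `|z| = z by rewrite ger0_norm // !addr_ge0 // ltW.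
have zM : M < `|z| by rewrite z0 /z -addrA ltrDl addr_gt0.
have zN : N < `|z| by rewrite z0 /z addrAC ltrDr addr_gt0.
have := le_lt_trans (ler_normB (F z - m) (F z - l)) (ltrD (HN z zN) (HM z zM)).
have -> : F z - m - (F z - l) = l - m by ring.
by rewrite -splitr ltxx.
Qed.

Lemma tends_poly n (p : {poly C}) : (size p <= n.+1)%N ->
  tends_at_infinity (fun z => p.[z] / z ^+ n) p`_n.
Proof.
elim: n p => [|n IH] p sp.
  apply: (tends_eq (tends_cst _)); exists 1 => // z _.
  by rewrite [in RHS](size1_polyC sp) hornerC expr0 divr1.
pose r := drop_poly 1 p.
have sr : (size r <= n.+1)%N by rewrite size_drop_poly leq_subLR add1n.
have -> : p`_n.+1 = r`_n + p`_0 * 0 by rewrite mulr0 addr0 coef_drop_poly addn1.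
have T : tends_at_infinity (fun z : C => p`_0 * z^-1 ^+ n.+1) (p`_0 * 0).
  apply: tends_mul (tends_cst _) _.
  elim: n {IH sp r sr} => [|n IH]; first exact: tends_Vz.
  rewrite -[X in tends_at_infinity _ X](mulr0 0).
  by apply: (tends_eq (tends_mul tends_Vz IH)); exists 1 => // z _; rewrite exprS.
apply: (tends_eq (tends_add (IH _ sr) T)); exists 1 => // z Hz.
have z0 : z != 0 by rewrite -normr_gt0; apply: lt_trans Hz.
have -> : p.[z] = r.[z] * z + p`_0.
  rewrite -[in LHS](poly_take_drop 1 p) hornerD hornerM hornerXn expr1 addrC.
  congr (_ + _).
  have /size1_polyC -> : (size (take_poly 1 p) <= 1)%N by exact: size_take_poly.
  by rewrite hornerC coef_take_poly.
by rewrite exprVn exprS; field; rewrite z0 expf_neq0.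
Qed.

Lemma tends_ratio n (p r : {poly C}) : (size p <= n.+1)%N -> (size r <= n.+1)%N ->
  r`_n != 0 -> tends_at_infinity (fun z => p.[z] / r.[z]) (p`_n / r`_n).
Proof.
move=> sp sr r0.
apply: (tends_eq (tends_mul (tends_poly sp) (tends_inv r0 (tends_poly sr)))).
exists 1 => // z Hz; have z0 : z != 0 by rewrite -normr_gt0; apply: lt_trans Hz.
(* At a root of r both sides are 0, since division by 0 gives 0. *)
have [-> |rz] := eqVneq r.[z] 0; first by rewrite mul0r invr0 !mulr0.
by field; rewrite rz expf_neq0.
Qed.

(** The quotient p(z) / z^n tends to the leading coefficient, and at a zero of p it stays at
    distance |leading coefficient| from that limit. *)
Lemma poly_nonroot_far (p : {poly C}) : p != 0 ->
  exists2 M : C, 0 < M & forall z, M < `|z| -> p.[z] != 0.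
Proof.
move=> p0; have l0 : p`_(size p).-1 != 0 by rewrite -lead_coefE lead_coef_eq0.
have sp : (size p <= (size p).-1.+1)%N by exact: leqSpred.
have e0 : 0 < `|p`_(size p).-1| by rewrite normr_gt0.
have [M M0 HM] := tends_poly sp e0.
exists M => // z /HM; apply: contraTneq => ->.
by rewrite mul0r sub0r normrN ltxx.
Qed.

End Limits.

(** * Matrices of a given type *)

Section LaurentMx.
Variable C : numClosedFieldType.

Definition laurent_mx (F : C -> 'M[C]_2) := forall i j, laurent (fun z => F z i j).

Lemma laurent_mx2 (f1 f2 f3 f4 : C -> C) : laurent f1 -> laurent f2 ->
  laurent f3 -> laurent f4 -> laurent_mx (fun z => mx2 (f1 z) (f2 z) (f3 z) (f4 z)).
Proof.
by move=> H1 H2 H3 H4; apply: ord2P; apply: ord2P;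
  [move: H1 | move: H2 | move: H3 | move: H4]; apply: laurent_ext => z _;
  rewrite mx2E.
Qed.

Lemma laurent_mulmx F G : laurent_mx F -> laurent_mx G ->
  laurent_mx (fun z => F z *m G z).
Proof.
move=> HF HG i j.
apply: (laurent_ext _ (laurent_add (laurent_mul (HF i 0) (HG 0 j))
                                   (laurent_mul (HF i 1) (HG 1 j)))) => z _.
by rewrite mul_mx2E.
Qed.

Lemma laurent_scalemx f F : laurent f -> laurent_mx F ->
  laurent_mx (fun z => f z *: F z).
Proof.
by move=> Hf HF i j; apply: (laurent_ext _ (laurent_mul Hf (HF i j))) => z _; rewrite mxE.
Qed.

Lemma laurent_det F : laurent_mx F -> laurent (fun z => \det (F z)).
Proof.
move=> HF; apply: (laurent_ext _ (laurent_add (laurent_mul (HF 0 0) (HF 1 1))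
   (laurent_opp (laurent_mul (HF 0 1) (HF 1 0))))) => z _.
by rewrite det2E.
Qed.

Lemma laurent_mx_eq F G (s : seq C) : laurent_mx F -> laurent_mx G ->
  (forall z, z \notin s -> F z = G z) -> forall z, z != 0 -> F z = G z.
Proof.
move=> HF HG E z z0; apply/matrixP => i j; apply/eqP; rewrite -subr_eq0; apply/eqP.
apply: (@laurent_zero _ (fun z => F z i j - G z i j) s) z0.
  exact: laurent_add (HF i j) (laurent_opp (HG i j)).
by move=> x /E ->; rewrite subrr.
Qed.

Lemma laurent_eq (F G : C -> C) (s : seq C) : laurent F -> laurent G ->
  (forall z, z \notin s -> F z = G z) -> forall z, z != 0 -> F z = G z.
Proof.
move=> HF HG E z z0; apply/eqP; rewrite -subr_eq0; apply/eqP.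
apply: (@laurent_zero _ (fun z => F z - G z) s) z0.
  exact: laurent_add HF (laurent_opp HG).
by move=> x /E ->; rewrite subrr.
Qed.

Lemma laurent_Vscale a : laurent (fun z : C => a / z).
Proof. exact: laurent_mul (laurent_cst a) (laurent_inv C). Qed.

Lemma laurent_evalmx (N : 'M[{poly C}]_2) f : laurent f ->
  laurent_mx (fun z => map_mx (fun r : {poly C} => r.[f z]) N).
Proof.
by move=> Hf i j; apply: (laurent_ext _ (laurent_horner (N i j) Hf)) => z _; rewrite mxE.
Qed.

End LaurentMx.

Section Types.
Variable C : numClosedFieldType.
Variables u q : C.
Hypotheses (u0 : u != 0) (q0 : q != 0).
Implicit Types (lam : param C) (b : 'M[{poly C}]_2) (z : C).

Definition bmat b z : 'M[C]_2 :=
  mx2 (b 0 0).[z] ((b 0 1).[z] / z) (b 1 0).[z] (b 1 1).[z].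

Lemma connE lam b z : conn u lam b z = (Ppol u lam).[z]^-1 *: bmat b z.
Proof. by []. Qed.

Lemma bmatE lam b z : (Ppol u lam).[z] != 0 ->
  bmat b z = (Ppol u lam).[z] *: conn u lam b z.
Proof. by move=> H; rewrite connE scalerA mulfV // scale1r. Qed.

Lemma bmat_det b z : \det (bmat b z) =
  (b 0 0).[z] * (b 1 1).[z] - (b 0 1).[z] / z * (b 1 0).[z].
Proof. by rewrite /bmat det_mx2. Qed.

Lemma laurent_bmat b f : laurent f -> laurent (fun z => (f z)^-1) ->
  laurent_mx (fun z => bmat b (f z)).
Proof.
move=> Hf Hf'; apply: laurent_mx2; do ?exact: laurent_horner.
by apply: laurent_mul => //; exact: laurent_horner.
Qed.

Lemma laurent_star : laurent (fun z => (u ^+ 2 / z)^-1).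
Proof.
apply: (laurent_ext _ (laurent_mul (laurent_cst (u ^- 2)) (laurent_id C))) => z _.
by rewrite invf_div mulrC.
Qed.

Lemma horner_Ppol lam z : (Ppol u lam).[z] =
  (z - z1 lam) * (z - u ^+ 2 / z2 lam) * (z - z3 lam) * (z - u ^+ 2 / z4 lam) *
  (z - z5 lam) * (z - u ^+ 2 / z6 lam).
Proof. by rewrite !hornerE. Qed.

Lemma horner_Qpol lam z : (Qpol u lam).[z] =
  (z1 lam * z3 lam * z5 lam) / (z2 lam * z4 lam * z6 lam) *
  ((z - u ^+ 2 / z1 lam) * (z - z2 lam) * (z - u ^+ 2 / z3 lam) * (z - z4 lam) *
  (z - u ^+ 2 / z5 lam) * (z - z6 lam)).
Proof. by rewrite !hornerE. Qed.

Definition zs lam : seq C :=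
  [:: z1 lam; z2 lam; z3 lam; z4 lam; z5 lam; z6 lam].

Section Fixed.
Variable lam : param C.
Hypothesis zn0 : forall k : 'I_8, param_coords lam k != 0.

Lemma coords_neq0 : [/\ z1 lam != 0, z2 lam != 0, z3 lam != 0 & z4 lam != 0] /\
  [/\ z5 lam != 0, z6 lam != 0, d1 lam != 0 & d2 lam != 0].
Proof.
by split; split; [have := zn0 (@Ordinal 8 0 isT) | have := zn0 (@Ordinal 8 1 isT)
 | have := zn0 (@Ordinal 8 2 isT) | have := zn0 (@Ordinal 8 3 isT)
 | have := zn0 (@Ordinal 8 4 isT) | have := zn0 (@Ordinal 8 5 isT)
 | have := zn0 (@Ordinal 8 6 isT) | have := zn0 (@Ordinal 8 7 isT)].
Qed.

(** The involution z -> u^2/z maps the zeros of Q to those of P, and the constant in front of Q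
    makes the remaining factor exactly u^6/z^6. *)
Lemma Ppol_star z : z != 0 ->
  (Ppol u lam).[u ^+ 2 / z] = u ^+ 6 / z ^+ 6 * (Qpol u lam).[z].
Proof.
move=> z0; have [[? ? ? ?] [? ? _ _]] := coords_neq0.
rewrite horner_Ppol horner_Qpol; field.
by repeat (apply/andP; split).
Qed.

Lemma Ppol_neq0 : Ppol u lam != 0.
Proof. by rewrite /Ppol !mulf_neq0 ?polyXsubC_eq0. Qed.

Lemma Qpol_neq0 : Qpol u lam != 0.
Proof.
have [[? ? ? ?] [? ? _ _]] := coords_neq0.
rewrite /Qpol scaler_eq0 negb_or !mulf_neq0 ?polyXsubC_eq0 //.
by rewrite invr_neq0 // !mulf_neq0.
Qed.

(** This is the exceptional set: the conditions of [has_type] can be used at the points outside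
    it. *)
Definition good_points : seq C :=
  0 :: sval (closed_field_poly_normal (Ppol u lam))
    ++ sval (closed_field_poly_normal (Qpol u lam)).

Lemma good_pointsP z : z \notin good_points ->
  [/\ z != 0, (Ppol u lam).[z] != 0 & (Qpol u lam).[z] != 0].
Proof.
rewrite /good_points; case: closed_field_poly_normal => r /= Er.
case: closed_field_poly_normal => r' /= Er'.
rewrite inE mem_cat !negb_or => /and3P[z0 zr zr']; split=> //.
  rewrite Er hornerZ mulf_neq0 ?lead_coef_eq0 ?Ppol_neq0 //.
  by rewrite -rootE root_prod_XsubC.
rewrite Er' hornerZ mulf_neq0 ?lead_coef_eq0 ?Qpol_neq0 //.
by rewrite -rootE root_prod_XsubC.
Qed.

Definition limit_mx b : 'M[C]_2 :=
  mx2 (b 0 0)`_6 (b 0 1)`_8 ((b 1 0)`_5 / q) ((b 1 1)`_6 / q).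

(* The conditions of [has_type] with the denominators multiplied out, so that
   they hold at every z != 0; [limit_mx] is the limit at infinity. *)
Record matrix_type b : Prop := MatrixType {
  mt_size : [/\ (size (b 0%R 0%R) <= 7)%N, (size (b 0%R 1%R) <= 9)%N,
                (size (b 1%R 0%R) <= 6)%N & (size (b 1%R 1%R) <= 7)%N];
  mt_b21 : (b 1 0).[0] = 0;
  mt_det : forall z, z != 0 ->
    \det (bmat b z) = (Ppol u lam).[z] * (Qpol u lam).[z];
  mt_inv : forall z, z != 0 ->
    bmat b (u ^+ 2 / z) *m bmat b z = ((Ppol u lam).[u ^+ 2 / z] * (Ppol u lam).[z])%:M;
  mt_one : bmat b u = ((Ppol u lam).[u])%:M;
  mt_asym : exists2 V : 'M[C]_2, V \in unitmx &
      V *m limit_mx b *m invmx V = mx2 (d1 lam) 0 0 (d2 lam) }.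

Lemma Ppol_monic_coefs : (Ppol u lam)`_6 = 1 /\ size (Ppol u lam) = 7%N.
Proof.
have -> : Ppol u lam = \prod_(a <- [:: z1 lam; u ^+ 2 / z2 lam; z3 lam;
   u ^+ 2 / z4 lam; z5 lam; u ^+ 2 / z6 lam]) ('X - a%:P).
  by rewrite !big_cons big_nil mulr1 !mulrA.
set s := [:: _; _; _; _; _; _].
have Hs : size (\prod_(a <- s) ('X - a%:P)) = 7%N by rewrite size_prod_XsubC.
split=> //; have /monicP := monic_prod_XsubC s xpredT id.
by rewrite lead_coefE Hs.
Qed.

Lemma sigma_neq0_far :
  exists2 M : C, 0 < M & forall z, M < `|z| -> sigma u q z != 0.
Proof.
have [M M0 HM] : exists2 M : C, 0 < M & forall z, M < `|z| ->
    ('X^2 + (u ^+ 2 / q)%:P : {poly C}).[z] != 0.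
  apply: poly_nonroot_far; apply/eqP => /(congr1 (fun p : {poly C} => p`_2)).
  rewrite coefD coefXn coefC /= addr0 coef0 => /eqP; by rewrite oner_eq0.
exists M => // z Hz; have := HM z Hz; rewrite !hornerE.
have z0 : z != 0 by rewrite -normr_gt0; exact: lt_trans Hz.
apply: contraNneq; rewrite /sigma => H.
have -> : z ^+ 2 + u ^+ 2 / q = z * (z + u ^+ 2 / (q * z)) by field; rewrite z0 q0.
by rewrite H mulr0.
Qed.

(** Since z sigma(z) and z sigma(z/q) are polynomials of degree 2 with leading coefficients 1 and
    1/q, each entry is a ratio of polynomials of equal formal degree. The factors 1/q of [limit_mx]
    come from sigma(z/q). *)
Lemma tends_limit_mx b :
  [/\ (size (b 0%R 0%R) <= 7)%N, (size (b 0%R 1%R) <= 9)%N,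
      (size (b 1%R 0%R) <= 6)%N & (size (b 1%R 1%R) <= 7)%N] ->
  forall i j, tends_at_infinity
   (fun z => (Smx (sigma u q (z / q)) *m conn u lam b z
       *m invmx (Smx (sigma u q z))) i j) (limit_mx b i j).
Proof.
move=> [s11 s12 s21 s22].
have [lP sP] := Ppol_monic_coefs.
have [M M0 HM] := sigma_neq0_far.
have [N N0 HN] := poly_nonroot_far Ppol_neq0.
have E z : M + N < `|z| -> [/\ z != 0, (Ppol u lam).[z] != 0 & sigma u q z != 0]
   /\ (Smx (sigma u q (z / q)) *m conn u lam b z *m invmx (Smx (sigma u q z))) =
   mx2 ((b 0 0).[z] / (Ppol u lam).[z])
       ((b 0 1).[z] / z / (Ppol u lam).[z] / sigma u q z)
       (sigma u q (z / q) * (b 1 0).[z] / (Ppol u lam).[z])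
       (sigma u q (z / q) * (b 1 1).[z] / (Ppol u lam).[z] / sigma u q z).
  move=> Hz; have zM : M < `|z| by apply: le_lt_trans Hz; rewrite lerDl ltW.
  have zN : N < `|z| by apply: le_lt_trans Hz; rewrite lerDr ltW.
  have z0 : z != 0 by rewrite -normr_gt0; exact: lt_trans zM.
  have P0 := HN _ zN; have S0 := HM _ zM; split=> //.
  rewrite connE /Smx invmx_mx2 ?mul1r ?mul0r ?subr0 // scale_mx2 /bmat scale_mx2 !mul_mx2.
  by apply: mx2_ext; rewrite !mx2E; field; rewrite ?S0 ?P0 ?z0.
have MN : 0 < M + N by exact: addr_gt0.
have sX2 (a : C) : (size ('X^2 + a%:P : {poly C})%R <= 3)%N.
  by rewrite (leq_trans (size_polyD _ _)) // geq_max size_polyXn size_polyC; case: (a != 0).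
have sX2' (a : C) : (size (q^-1 *: 'X^2 + a%:P : {poly C})%R <= 3)%N.
  rewrite (leq_trans (size_polyD _ _)) // geq_max size_polyC (leq_trans (size_scale_leq _ _)) ?size_polyXn //.
  by case: (a != 0).
apply: ord2P; apply: ord2P; rewrite /limit_mx !mx2E.
- have := tends_ratio s11 (eq_leq sP); rewrite lP divr1 => /(_ (oner_neq0 _)) T.
  by apply: (tends_eq T); exists (M + N) => // z /E [_ ->]; rewrite mx2E.
- pose D := Ppol u lam * ('X^2 + (u ^+ 2 / q)%:P).
  have D8 : D`_8 = 1.
    by rewrite (@coefM_top _ 6 2) ?sP ?sX2 // lP coefD coefXn coefC /= addr0 mulr1.
  have sD : (size D <= 9)%N by rewrite (@size_polyM_top _ 6 2) ?sP ?sX2.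
  have := tends_ratio s12 sD; rewrite D8 divr1 => /(_ (oner_neq0 _)) T.
  apply: (tends_eq T); exists (M + N) => // z /E [[z0 P0 S0] ->]; rewrite mx2E.
  rewrite /D; move: (Ppol u lam) P0 => Pl P0; horner_simp; move: S0; rewrite /sigma => S0.
  have -> : z ^+ 2 + u ^+ 2 / q = z * (z + u ^+ 2 / (q * z)) by field; rewrite z0 q0.
  by set x := (z + _) in S0 *; field; rewrite S0 z0 P0.
- pose D := Ppol u lam * 'X.
  have D7 : D`_7 = 1 by rewrite coefMX.
  have sD : (size D <= 8)%N by rewrite (@size_polyM_top _ 6 1) ?sP ?size_polyX.
  pose Nm := (b 1 0) * (q^-1 *: 'X^2 + (u ^+ 2)%:P).
  have sN : (size Nm <= 8)%N by rewrite (@size_polyM_top _ 5 2) ?sX2'.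
  have := tends_ratio sN sD; rewrite D7 divr1 => /(_ (oner_neq0 _)).
  rewrite (@coefM_top _ 5 2) ?sX2' // coefD coefZ coefXn coefC /= addr0 mulr1 => T.
  apply: (tends_eq T); exists (M + N) => // z /E [[z0 P0 S0] ->]; rewrite mx2E.
  by rewrite /D /Nm; move: (Ppol u lam) P0 => Pl P0; horner_simp; rewrite /sigma; field; rewrite P0 z0 q0 ?oner_neq0.
- pose D := Ppol u lam * ('X^2 + (u ^+ 2 / q)%:P).
  have D8 : D`_8 = 1.
    by rewrite (@coefM_top _ 6 2) ?sP ?sX2 // lP coefD coefXn coefC /= addr0 mulr1.
  have sD : (size D <= 9)%N by rewrite (@size_polyM_top _ 6 2) ?sP ?sX2.
  pose Nm := (b 1 1) * (q^-1 *: 'X^2 + (u ^+ 2)%:P).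
  have sN : (size Nm <= 9)%N by rewrite (@size_polyM_top _ 6 2) ?sX2'.
  have := tends_ratio sN sD; rewrite D8 divr1 => /(_ (oner_neq0 _)).
  rewrite (@coefM_top _ 6 2) ?sX2' // coefD coefZ coefXn coefC /= addr0 mulr1 => T.
  apply: (tends_eq T); exists (M + N) => // z /E [[z0 P0 S0] ->]; rewrite mx2E.
  rewrite /D /Nm; move: (Ppol u lam) P0 => Pl P0; horner_simp; move: S0; rewrite /sigma => S0.
  have -> : z ^+ 2 + u ^+ 2 / q = z * (z + u ^+ 2 / (q * z)) by field; rewrite z0 q0.
  by set x := (z + _) in S0 *; field; rewrite S0 z0 P0 q0.
Qed.

Hypothesis Pu : (Ppol u lam).[u] != 0.

(** Off the exceptional set one clears denominators, and Laurent extension gives the conditions at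
    every z != 0; uniqueness of limits identifies L with [limit_mx]. The assumption P(u) != 0 gives
    the normalization at u its meaning. *)
Lemma has_typeP b : has_type u q lam b <-> matrix_type b.
Proof.
split=> [[sz b21 det [L HL [V VU HV]] inv id1] | [sz b21 det inv id1 [V VU HV]]].
- split=> //.
  + apply: (@laurent_eq _ _ _ good_points).
    * by apply: laurent_det; apply: laurent_bmat; [exact: laurent_id | exact: laurent_inv].
    * by apply: laurent_mul; exact: laurent_poly.
    * move=> z /good_pointsP [z0 P0 Q0].
      have := det z z0 P0; rewrite connE detZ => E.
      apply: (mulfI (expf_neq0 2 (invr_neq0 P0))); rewrite E.
      by field.
  + apply: (@laurent_mx_eq _ _ _ good_points).
    * apply: laurent_mulmx; apply: laurent_bmat.
      - exact: laurent_Vscale.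
      - exact: laurent_star.
      - exact: laurent_id.
      - exact: laurent_inv.
    * have H := laurent_mul (laurent_horner (Ppol u lam) (laurent_Vscale (u ^+ 2)))
                            (laurent_poly (Ppol u lam)).
      move=> i j; apply: (laurent_ext _ (laurent_mul H (laurent_cst ((i == j)%:R)))).
      by move=> z _; rewrite mxE; case: eqP; rewrite ?mulr1 ?mulr0.
    * move=> z /good_pointsP [z0 P0 Q0].
      have P0' : (Ppol u lam).[u ^+ 2 / z] != 0.
        by rewrite Ppol_star // !mulf_neq0 ?invr_neq0 ?expf_neq0.
      rewrite (bmatE _ P0) (bmatE _ P0') inv // -scalemxAl -scalemxAr mulVmx.
        by rewrite scalerA -[RHS]scalemx1.
      by rewrite unitmxE unitfE det // mulf_neq0 ?invr_neq0.
  + by rewrite (bmatE _ Pu) id1 -[RHS]scalemx1.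
  + have -> : limit_mx b = L; last by exists V.
    apply/matrixP => i j; apply: tends_unique (tends_limit_mx sz i j) (HL i j).
- split=> //.
  + move=> z z0 P0; rewrite connE detZ det //; field; exact: P0.
  + exists (limit_mx b); first exact: tends_limit_mx.
    by exists V.
  + move=> z z0 P0 Q0.
    have P0' : (Ppol u lam).[u ^+ 2 / z] != 0.
      by rewrite Ppol_star // !mulf_neq0 ?invr_neq0 ?expf_neq0.
    have U : conn u lam b z \in unitmx.
      rewrite unitmxE unitfE connE detZ det // mulf_neq0 ?expf_neq0 ?invr_neq0 //.
      by rewrite mulf_neq0.
    apply: (can_inj (mulmxK U)); rewrite mulVmx // !connE -scalemxAl -scalemxAr inv //.
    rewrite scalerA -scalemx1 scalerA -[RHS]scale1r; congr (_ *: _).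
    by field; rewrite P0 P0'.
  + by rewrite connE id1 -scalemx1 scalerA mulVf // scale1r.
Qed.

End Fixed.
End Types.

(** * Modifications *)

Section Modifications.
Variable C : numClosedFieldType.
Variables u q : C.
Hypotheses (u0 : u != 0) (q0 : q != 0).
Implicit Types (lam : param C) (b : 'M[{poly C}]_2) (N : 'M[{poly C}]_2).
Implicit Types (d : {poly C}) (x z : C).

Definition evmx N x : 'M[C]_2 := map_mx (fun r : {poly C} => r.[x]) N.

Lemma evmxE N x : evmx N x = mx2 (N 0 0).[x] (N 0 1).[x] (N 1 0).[x] (N 1 1).[x].
Proof. by apply: mx2_ext; rewrite !mxE. Qed.

Lemma det_evmx N x : \det (evmx N x) = (\det N).[x].
Proof. by rewrite !det2E !mxE; horner_simp. Qed.

Lemma evmxM N N' x : evmx (N *m N') x = evmx N x *m evmx N' x.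
Proof. by apply: mx2_ext; rewrite [LHS]mxE !mul_mx2E !mxE; horner_simp. Qed.

Lemma evmxZ d N x : evmx (d *: N) x = d.[x] *: evmx N x.
Proof. by apply/matrixP => i j; rewrite !mxE hornerM. Qed.

Lemma evmx_adj N x : evmx (adj2 N) x = adj2 (evmx N x).
Proof. by apply: mx2_ext; rewrite [LHS]mxE !mx2E ?hornerN !mxE. Qed.

(** The equation is z^2 - x z + u^2/q = 0; the product u^2/q of its roots is nonzero. *)
Lemma sigma_surj x : exists2 z, z != 0 & sigma u q z = x.
Proof.
pose p : {poly C} := 'X^2 - x *: 'X + (u ^+ 2 / q)%:P.
have sp : size p = 3%N.
  rewrite /p -addrA size_polyDl size_polyXn //.
  rewrite (leq_ltn_trans (size_polyD _ _)) // gtn_max size_polyC size_polyN.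
  by rewrite (leq_ltn_trans (size_scale_leq _ _)) ?size_polyX //; case: (_ != 0).
have /closed_rootP [z /rootP] : size p != 1%N by rewrite sp.
rewrite /p; horner_simp => Hz.
have z0 : z != 0.
  apply: contraTneq u0 => z0; move: Hz; rewrite z0 mulr0 expr0n oppr0 !add0r => /eqP.
  by rewrite mulf_eq0 invr_eq0 (negbTE q0) orbF expf_eq0 /= negbK.
exists z => //; apply: (mulIf z0); apply/eqP; rewrite -subr_eq0 -Hz /sigma.
by apply/eqP; field; rewrite z0 q0.
Qed.

Lemma laurent_sigma : laurent (sigma u q).
Proof.
apply: (laurent_ext _ (laurent_add (laurent_id C) (laurent_Vscale (u ^+ 2 / q)))) => z z0.
by rewrite /sigma; field; rewrite z0 q0.
Qed.

Lemma laurent_sigmaq : laurent (fun z => sigma u q (z / q)).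
Proof.
apply: (laurent_ext _ (laurent_add (laurent_mul (laurent_cst q^-1) (laurent_id C))
  (laurent_Vscale (u ^+ 2)))) => z z0.
by rewrite /sigma; field; rewrite z0 q0.
Qed.

Lemma sigma_star z : z != 0 -> sigma u q ((u ^+ 2 / z) / q) = sigma u q z.
Proof. by move=> z0; rewrite /sigma; field; rewrite z0 q0 u0. Qed.

Lemma sigma_star' z : z != 0 -> sigma u q (u ^+ 2 / z) = sigma u q (z / q).
Proof. by move=> z0; rewrite /sigma; field; rewrite z0 q0 u0. Qed.

(** A nonroot of d is attained by sigma at some z, and by z -> sigma(z/q) at q z, so neither of the
    two Laurent polynomials is identically zero. *)
Lemma sigma_nonroots d : d != 0 -> exists s : seq C, forall z, z \notin s ->
  [/\ z != 0, d.[sigma u q z] != 0 & d.[sigma u q (z / q)] != 0].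
Proof.
move=> /closed_nonrootP [x]; have [z z0 <-] := sigma_surj x; rewrite rootE => dz.
have [s Hs] := laurent_finite (laurent_horner d laurent_sigma) z0 dz.
have w0 : z * q != 0 by rewrite mulf_neq0.
have dw : d.[sigma u q (z * q / q)] != 0 by rewrite mulfK.
have [s' Hs'] := laurent_finite (laurent_horner d laurent_sigmaq) w0 dw.
exists (s ++ s') => y; rewrite mem_cat negb_or => /andP[ys ys'].
by have [? ?] := Hs _ ys; have [_ ?] := Hs' _ ys'.
Qed.

Definition ratmx N d x : 'M[C]_2 := d.[x]^-1 *: evmx N x.

Lemma ratmx_unit N d x : d.[x] != 0 -> (\det N).[x] != 0 -> ratmx N d x \in unitmx.
Proof.
move=> dx Nx; rewrite unitmxE unitfE detZ det_evmx.
by rewrite mulf_neq0 ?expf_neq0 ?invr_neq0.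
Qed.

Lemma invmx_ratmx N d x : d.[x] != 0 -> (\det N).[x] != 0 ->
  invmx (ratmx N d x) = ratmx (d *: adj2 N) (\det N) x.
Proof.
move=> dx Nx; have U := ratmx_unit dx Nx.
apply: (can_inj (mulKmx U)); rewrite mulmxV // /ratmx evmxZ evmx_adj.
rewrite -scalemxAl -!scalemxAr mul_adj2 det_evmx !scalerA scale_scalar_mx.
by congr (_%:M); field; rewrite dx Nx.
Qed.

Lemma det_scale_adj N d : \det N != 0 -> d != 0 -> \det (d *: adj2 N) != 0.
Proof.
move=> N0 dd; have -> : \det (d *: adj2 N) = d * d * \det N.
  by rewrite det2E [in RHS]det2E !mxE /=; ring.
by rewrite !mulf_neq0.
Qed.

Lemma modification_sym lam lam' b b' :
  modification u q lam lam' b b' -> modification u q lam' lam b' b.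
Proof.
move=> [N [d [N0 dd [s H]]]]; exists (d *: adj2 N), (\det N).
split=> //; first exact: det_scale_adj.
have [t Ht] := sigma_nonroots N0; have [t' Ht'] := sigma_nonroots dd.
exists (s ++ t ++ t') => z; rewrite !mem_cat !negb_or => /and3P[zs zt zt'].
have [z0 N1 N2] := Ht _ zt; have [_ D1 D2] := Ht' _ zt'.
move: (H z zs); rewrite /= -!/(evmx _ _) -!/(ratmx _ _ _) => ->.
rewrite -!invmx_ratmx // invmxK !mulmxA mulVmx ?ratmx_unit // mul1mx.
by rewrite -mulmxA mulVmx ?ratmx_unit // mulmx1.
Qed.

Lemma modification_trans lam lam' lam'' b b' b'' :
  modification u q lam lam' b b' -> modification u q lam' lam'' b' b'' ->
  modification u q lam lam'' b b''.
Proof.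
move=> [N [d [N0 dd [s H]]]] [N' [d' [N0' dd' [s' H']]]].
exists (N' *m N), (d' * d); split.
- by rewrite det_mulmx mulf_neq0.
- by rewrite mulf_neq0.
have [t Ht] := sigma_nonroots (mulf_neq0 N0 N0').
have [t' Ht'] := sigma_nonroots (mulf_neq0 dd dd').
exists (s ++ s' ++ t ++ t') => z.
rewrite !mem_cat !negb_or => /and4P[zs zs' zt zt'].
have [z0] := Ht _ zt; rewrite !hornerM !mulf_eq0 !negb_or => /andP[N1 N2] /andP[N3 N4].
have [_] := Ht' _ zt'; rewrite !hornerM !mulf_eq0 !negb_or => /andP[D1 D2] /andP[D3 D4].
move: (H z zs) (H' z zs'); rewrite /= -!/(evmx _ _) -!/(ratmx _ _ _) => -> ->.
have E x : ratmx (N' *m N) (d' * d) x = ratmx N' d' x *m ratmx N d x.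
  by rewrite /ratmx evmxM hornerM invfM -scalemxAl -scalemxAr scalerA.
rewrite -!hornerM -!/(evmx _ _) -!/(ratmx _ _ _) !E.
have U1 : ratmx N d (sigma u q z) \in unitmx by rewrite ratmx_unit.
have U2 : ratmx N' d' (sigma u q z) \in unitmx by rewrite ratmx_unit.
have -> : invmx (ratmx N' d' (sigma u q z) *m ratmx N d (sigma u q z)) =
   invmx (ratmx N d (sigma u q z)) *m invmx (ratmx N' d' (sigma u q z)).
  have U : ratmx N' d' (sigma u q z) *m ratmx N d (sigma u q z) \in unitmx.
    by rewrite unitmx_mul U1 U2.
  apply: (can_inj (mulKmx U)); rewrite mulmxV // -!mulmxA.
  by rewrite (mulmxA (ratmx N d _)) mulmxV // mul1mx mulmxV.
by rewrite !mulmxA.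
Qed.

Lemma gauge_modification lam b b' : gauge_equiv u q lam b b' -> modification u q lam lam b b'.
Proof.
move=> [r11 [r22 [r12 [r1 r2 _ H]]]].
exists (mx2 r11%:P r12 0 r22%:P), 1; split.
- by rewrite det_mx2 mulr0 subr0 -polyCM polyC_eq0 mulf_neq0.
- exact: oner_neq0.
have [s Hs] : exists s : seq C, forall z, z \notin s -> z != 0 /\ (Ppol u lam).[z] != 0.
  have /closed_nonrootP [x] : 'X * Ppol u lam != 0.
    by rewrite mulf_neq0 ?polyX_eq0 ?Ppol_neq0.
  rewrite rootM negb_or !rootE hornerX => /andP[x0 Px].
  exact: (laurent_finite (laurent_poly _) x0 Px).
exists s => z /Hs [z0 Pz]; rewrite H // -!/(evmx _ _) !evmxE !mx2E.
by horner_simp; rewrite invr1 !scale1r.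
Qed.

(* Multiplying out the denominators, the defining identity of a modification
   holds at every z != 0. *)
Definition intertwines lam lam' b b' N d := forall z, z != 0 ->
  (d.[sigma u q z] * (Ppol u lam').[z]) *: (evmx N (sigma u q (z / q)) *m bmat b z) =
  (d.[sigma u q (z / q)] * (Ppol u lam).[z]) *: (bmat b' z *m evmx N (sigma u q z)).

Lemma intertwines_cofinite lam lam' b b' N d (s : seq C) : d != 0 -> \det N != 0 ->
  (forall z, z \notin s -> conn u lam' b' z =
     ratmx N d (sigma u q (z / q)) *m conn u lam b z *m invmx (ratmx N d (sigma u q z))) ->
  intertwines lam lam' b b' N d.
Proof.
move=> dd N0 H.
have PP : Ppol u lam * Ppol u lam' != 0 by rewrite mulf_neq0 ?Ppol_neq0.
have [r Er] := closed_field_poly_normal (Ppol u lam * Ppol u lam').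
have Hr z : z \notin r -> (Ppol u lam).[z] != 0 /\ (Ppol u lam').[z] != 0.
  move=> zr; apply/andP; rewrite -negb_or -mulf_eq0 -hornerM Er hornerZ.
  by rewrite mulf_neq0 ?lead_coef_eq0 // -rootE root_prod_XsubC.
have [t Ht] := sigma_nonroots (mulf_neq0 N0 dd).
apply: (@laurent_mx_eq _ _ _ (s ++ r ++ t)).
- apply: laurent_scalemx.
    by apply: laurent_mul; [apply: laurent_horner; exact: laurent_sigma | exact: laurent_poly].
  apply: laurent_mulmx; first exact: laurent_evalmx laurent_sigmaq.
  by apply: laurent_bmat; [exact: laurent_id | exact: laurent_inv].
- apply: laurent_scalemx.
    by apply: laurent_mul; [apply: laurent_horner; exact: laurent_sigmaq | exact: laurent_poly].
  apply: laurent_mulmx; last exact: laurent_evalmx laurent_sigma.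
  by apply: laurent_bmat; [exact: laurent_id | exact: laurent_inv].
move=> z; rewrite !mem_cat !negb_or => /and3P[zs /Hr [P1 P2] zt].
have [z0 ND1 ND2] := Ht _ zt.
have /andP[N1 D1] : ((\det N).[sigma u q z] != 0) && (d.[sigma u q z] != 0).
  by rewrite -negb_or -mulf_eq0 -hornerM.
have /andP[N2 D2] : ((\det N).[sigma u q (z / q)] != 0) && (d.[sigma u q (z / q)] != 0).
  by rewrite -negb_or -mulf_eq0 -hornerM.
have U : ratmx N d (sigma u q z) \in unitmx by rewrite ratmx_unit.
rewrite (bmatE b P1) (bmatE b' P2) H //.
move: (Ppol u lam).[z] (Ppol u lam').[z] (conn u lam b z) P1 P2 => p p' A p0 p0'.
have -> : evmx N (sigma u q z) = d.[sigma u q z] *: ratmx N d (sigma u q z).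
  by rewrite /ratmx scalerA mulfV // scale1r.
move: (ratmx N d (sigma u q z)) U => T U.
rewrite /ratmx -!scalemxAr -!scalemxAl !scalerA -!mulmxA mulVmx // mulmx1.
by congr (_ *: _); field; exact: D2.
Qed.

Lemma modification_intertwines lam lam' b b' : modification u q lam lam' b b' ->
  exists N, exists d, [/\ \det N != 0, d != 0 & intertwines lam lam' b b' N d].
Proof.
move=> [N [d [N0 dd [s H]]]]; exists N, d; split=> //.
exact: (intertwines_cofinite dd N0 H).
Qed.

End Modifications.

(** * Uniqueness of the modification *)

Section Uniqueness.
Variable C : numClosedFieldType.
Variables u q : C.
Hypotheses (u0 : u != 0) (q0 : q != 0) (q1 : forall k, (0 < k)%N -> q ^+ k != 1).
Implicit Types (lam : param C) (b : 'M[{poly C}]_2) (N : 'M[{poly C}]_2).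
Implicit Types (d : {poly C}) (x z : C).

Definition zcoord lam : 'I_6 -> C :=
  tnth [tuple z1 lam; z2 lam; z3 lam; z4 lam; z5 lam; z6 lam].

(** The twelve points z_i and u^2/z_i lie on pairwise distinct orbits of multiplication by q. In
    particular they are pairwise distinct and differ from u and -u (the case i = j, n = 0 of
    [nr_prod]). *)
Record nonresonant lam : Prop := Nonresonant {
  nr_coords : forall k, param_coords lam k != 0;
  nr_ratio : forall (i j : 'I_6) (n : int), i != j ->
    zcoord lam i != q ^ n * zcoord lam j;
  nr_prod : forall (i j : 'I_6) (n : int),
    zcoord lam i * zcoord lam j != q ^ n * u ^+ 2;
  nr_d : forall n : int, d1 lam != q ^ n * d2 lam }.

Definition singular lam z :=
  exists i : 'I_6, z = zcoord lam i \/ z = u ^+ 2 / zcoord lam i.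

Lemma zcoord_neq0 lam i : (forall k, param_coords lam k != 0) -> zcoord lam i != 0.
Proof.
move=> H; have [[? ? ? ?] [? ? _ _]] := coords_neq0 H.
by case: i => [[|[|[|[|[|[|i]]]]]] Hi].
Qed.

Lemma singularP lam z : (forall k, param_coords lam k != 0) ->
  (Ppol u lam).[z] * (Qpol u lam).[z] = 0 -> singular lam z.
Proof.
move=> H; have [[a1 a2 a3 a4] [a5 a6 _ _]] := coords_neq0 H.
have K0 : z1 lam * z3 lam * z5 lam / (z2 lam * z4 lam * z6 lam) != 0.
  by rewrite !mulf_neq0 // invr_neq0 // !mulf_neq0.
rewrite horner_Ppol horner_Qpol.
move: (_ / (z2 lam * z4 lam * z6 lam)) K0 => K K0 /eqP.
rewrite !mulf_eq0 (negbTE K0) orFb !subr_eq0.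
pose o k (Hk : (k < 6)%N) := Ordinal Hk.
rewrite -!orbA; do 11?[case/orP]; move=> /eqP ->;
  by [exists (@o 0 isT); left | exists (@o 1 isT); left | exists (@o 2 isT); left
  | exists (@o 3 isT); left | exists (@o 4 isT); left | exists (@o 5 isT); left
  | exists (@o 0 isT); right | exists (@o 1 isT); right | exists (@o 2 isT); right
  | exists (@o 3 isT); right | exists (@o 4 isT); right | exists (@o 5 isT); right].
Qed.

(** A ratio q^k between two of the points z_i, u^2/z_i is a resonance of z_i / z_j or of z_i z_j /
    u^2, according to their kinds. Only i = j within one kind remains, and there q^k != 1. *)
Lemma singular_progression lam z k : nonresonant lam -> (0 < k)%N ->
  singular lam z -> singular lam (z * q ^+ k) -> False.
Proof.
move=> [H Hr Hp _] k0 [i Hi] [j Hj].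
have i0 := zcoord_neq0 i H; have j0 := zcoord_neq0 j H.
have ij : i = j -> zcoord lam i * q ^+ k = zcoord lam j -> False.
  move=> <- /(canRL (mulKf i0)); rewrite mulVf // => /eqP.
  by rewrite (negbTE (q1 k0)).
have qk0 : q ^+ k != 0 by rewrite expf_neq0.
case: Hi Hj => -> [] E.
- have [e|ne] := eqVneq i j; first exact: ij e E.
  have ne' : j != i by rewrite eq_sym.
  have /eqP := Hr j i k%:Z ne'; apply.
  by rewrite -E -exprnP mulrC.
- have /eqP := Hp i j (- k%:Z); apply; rewrite -exprnN.
  by apply: (mulIf qk0); rewrite mulrAC E; field; rewrite j0 qk0.
- have /eqP := Hp i j k%:Z; apply; rewrite -exprnP -E.
  by field; exact: i0.
- have E' : zcoord lam j * q ^+ k = zcoord lam i.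
    have : u ^+ 2 * q ^+ k * zcoord lam j = u ^+ 2 * zcoord lam i.
      apply: (mulfI (invr_neq0 i0)); rewrite mulrCA [LHS](_ : _ =
        u ^+ 2 / zcoord lam i * q ^+ k * zcoord lam j); last by field; exact: i0.
      by rewrite E; field; rewrite j0 i0.
    by rewrite -mulrA => /(mulfI (expf_neq0 2 u0)); rewrite mulrC.
  have [e|ne] := eqVneq j i.
    by apply: (ij (esym e)); move: E'; rewrite e.
  have ne' : i != j by rewrite eq_sym.
  have /eqP := Hr i j k%:Z ne'; apply.
  by rewrite -E' -exprnP mulrC.
Qed.

Section Fixed.
Variables (lam : param C) (b b' : 'M[{poly C}]_2).
Hypothesis nr : nonresonant lam.
Let zn0 := nr_coords nr.
Hypotheses (Hb : matrix_type u q lam b) (Hb' : matrix_type u q lam b').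

Definition intertwines1 (b b' : 'M[{poly C}]_2) N d := forall z, z != 0 ->
  d.[sigma u q z] *: (evmx N (sigma u q (z / q)) *m bmat b z) =
  d.[sigma u q (z / q)] *: (bmat b' z *m evmx N (sigma u q z)).

Lemma intertwines_cancel (c c' : 'M[{poly C}]_2) N d :
  intertwines u q lam lam c c' N d -> intertwines1 c c' N d.
Proof.
move=> H; apply: (@laurent_mx_eq _ _ _ (good_points u lam)).
- apply: laurent_scalemx.
    by apply: laurent_horner; exact: laurent_sigma.
  apply: laurent_mulmx; first exact: laurent_evalmx (laurent_sigmaq _ _).
  by apply: laurent_bmat; [exact: laurent_id | exact: laurent_inv].
- apply: laurent_scalemx.
    by apply: laurent_horner; exact: laurent_sigmaq.
  apply: laurent_mulmx; last exact: laurent_evalmx (laurent_sigma _ _).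
  by apply: laurent_bmat; [exact: laurent_id | exact: laurent_inv].
move=> z /(good_pointsP zn0) [z0 P0 Q0].
apply: (can_inj (scalerK P0)); rewrite !scalerA ![_.[z] * _]mulrC; exact: H.
Qed.

Lemma bmat_unit (c : 'M[{poly C}]_2) z : matrix_type u q lam c -> z != 0 ->
  ~ singular lam z -> bmat c z \in unitmx.
Proof.
move=> Hc z0 ns; rewrite unitmxE unitfE (mt_det Hc) //.
by apply/eqP => /(singularP zn0).
Qed.

(* At a root x0 of d where N does not vanish, the relation propagates this
   failure along z -> z / q or z -> q z unless z is singular, so that d would
   have infinitely many roots. *)
Lemma denominator_cancels N d : d != 0 -> intertwines1 b b' N d ->
  exists N0, N = d *: N0.
Proof.
have [n] := ubnP (size d); elim: n N d => // n IH N d; rewrite ltnS => sd d0 H.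
have [s1|s1] := eqVneq (size d) 1.
  have [c c0 ->] := size_poly1P _ (introT eqP s1).
  exists (c^-1%:P *: N); rewrite scalerA -polyCM mulfV // scale1r //.
(* Common roots of d and of all entries of N are divided out, by induction on the degree of d. What
   remains is the case where N vanishes at no root of d. *)
have [[x0 [dx0 Nx0]]|noroot] := pselect (exists x0, d.[x0] = 0 /\ evmx N x0 = 0).
  pose l := 'X - x0%:P : {poly C}.
  have l0 : l != 0 by rewrite polyXsubC_eq0.
  have [d' Dd] : exists d', d = l * d'.
    by exists (d %/ l); rewrite mulrC divpK // dvdp_XsubCl; apply/rootP.
  pose N1 : 'M[{poly C}]_2 := map_mx (fun p => p %/ l) N.
  have DN : N = l *: N1.
    apply/matrixP => i j; rewrite !mxE mulrC divpK // dvdp_XsubCl; apply/rootP.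
    by have := congr1 (fun A : 'M[C]_2 => A i j) Nx0; rewrite !mxE.
  have d1n0 : d' != 0 by apply: contraNneq d0 => E; rewrite Dd E mulr0.
  have sd1 : (size d' < n)%N.
    by move: sd; rewrite Dd size_mul // size_XsubC.
  have H1 : intertwines1 b b' N1 d'.
    have [s Hs] := sigma_nonroots u0 q0 l0.
    apply: (@laurent_mx_eq _ _ _ s).
    + apply: laurent_scalemx.
        by apply: laurent_horner; exact: laurent_sigma.
      apply: laurent_mulmx; first exact: laurent_evalmx (laurent_sigmaq _ _).
      by apply: laurent_bmat; [exact: laurent_id | exact: laurent_inv].
    + apply: laurent_scalemx.
        by apply: laurent_horner; exact: laurent_sigmaq.
      apply: laurent_mulmx; last exact: laurent_evalmx (laurent_sigma _ _).
      by apply: laurent_bmat; [exact: laurent_id | exact: laurent_inv].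
    move=> z /Hs [z0 l1 l2]; have := H z z0.
    rewrite DN Dd !evmxZ !hornerM -scalemxAl -scalemxAr !scalerA => E.
    apply: (can_inj (scalerK (mulf_neq0 l1 l2))).
    rewrite [LHS]scalerA [RHS]scalerA.
    rewrite [X in X *: _ = _](_ : _ = l.[sigma u q z] * d'.[sigma u q z] *
      l.[sigma u q (z / q)]); last by ring.
    by rewrite E; congr (_ *: _); ring.
  have [N0 E0] := IH _ _ sd1 d1n0 H1.
  by exists N0; rewrite DN E0 scalerA -Dd.
have nr_ z : d.[sigma u q z] = 0 -> evmx N (sigma u q z) != 0.
  by move=> E; apply/eqP => E'; apply: noroot; exists (sigma u q z).
have down z : z != 0 -> ~ singular lam z -> d.[sigma u q z] = 0 ->
    d.[sigma u q (z / q)] = 0.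
  move=> z0 ns E; apply/eqP/negPn/negP => E'; have := H z z0.
  rewrite E scale0r => /esym/eqP; rewrite scaler_eq0 (negbTE E') /= => /eqP F.
  by have /eqP := nr_ _ E; apply; rewrite -[LHS](mulKmx (bmat_unit Hb' z0 ns)) F mulmx0.
have up z : z != 0 -> ~ singular lam z -> d.[sigma u q (z / q)] = 0 ->
    d.[sigma u q z] = 0.
  move=> z0 ns E; apply/eqP/negPn/negP => E'; have := H z z0.
  rewrite E scale0r => /eqP; rewrite scaler_eq0 (negbTE E') /= => /eqP F.
  have /eqP := nr_ _ E; apply.
  by rewrite -[LHS](mulmxK (bmat_unit Hb z0 ns)) F mul0mx.
have noprog z0 c : z0 != 0 -> c != 0 -> (forall k, (0 < k)%N -> c ^+ k != 1) ->
    ~ (forall k, d.[sigma u q (z0 * c ^+ k)] = 0).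
  move=> z00 c0 Hc Hk.
  have Z := laurent_progression (laurent_horner d (laurent_sigma u q0)) z00 c0 Hc Hk.
  have /closed_nonrootP [x] := d0; have [z zz0 <-] := sigma_surj u0 q0 x.
  by rewrite rootE Z // eqxx.
have /closed_rootP [x /rootP dx] := s1.
have [z0 z00 Ez0] := sigma_surj u0 q0 x; rewrite -Ez0 in dx.
have qV0 : q^-1 != 0 by rewrite invr_neq0.
(* Passing from z to z/q is blocked only if z is singular, passing from z/q to z also only if z is.
   Hence the exponents -k and j + 1: they differ by at least 1, so two singular points in a ratio
   q^m with m > 0 result. *)
have [k Sk] : exists k, singular lam (z0 * q^-1 ^+ k).
  apply: contrapT => Hn; apply: (noprog z0 q^-1) => //.
    by move=> k k0; rewrite exprVn invr_eq1 q1.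
  elim=> [|k IHk]; first by rewrite mulr1.
  rewrite exprSr mulrA; apply: down => //; first by rewrite mulf_neq0 ?expf_neq0.
  by move=> Sk; apply: Hn; exists k.
have [j Sj] : exists j, singular lam (z0 * q ^+ j.+1).
  apply: contrapT => Hn; apply: (noprog z0 q) => //.
  elim=> [|m IHm]; first by rewrite mulr1.
  apply: up; first by rewrite mulf_neq0 ?expf_neq0.
    by move=> Sm; apply: Hn; exists m.
  by rewrite exprSr mulrA mulfK.
case: (@singular_progression lam (z0 * q^-1 ^+ k) (k + j.+1)%N nr) => //.
  by rewrite addnS.
by rewrite exprD mulrA exprVn mulfVK ?expf_neq0.
Qed.

End Fixed.

Lemma sigma_lift z : z != 0 -> sigma u q z = 1 * z + (u ^+ 2 / q) / z.
Proof. by move=> z0; rewrite /sigma; field; rewrite z0 q0. Qed.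

Lemma sigmaq_lift z : z != 0 -> sigma u q (z / q) = q^-1 * z + u ^+ 2 / z.
Proof. by move=> z0; rewrite /sigma; field; rewrite z0 q0. Qed.

Lemma eq_scaled (L R w X Y : C) : L = R -> X = L * w -> Y = R * w -> X = Y.
Proof. by move=> -> -> ->. Qed.

(** Degree with respect to conjugation by S(x) = diag(1, x), which shifts the off-diagonal entries
    by one. For k = 0 these are the shapes of gauge transformations: constant diagonal, linear upper
    entry, zero lower entry. *)
Definition weighted_deg N k := [/\ (size (N 0%R 0%R) <= k.+1)%N,
  (size (N 0%R 1%R) <= k.+2)%N, (size (N 1%R 0%R) <= k)%N & (size (N 1%R 1%R) <= k.+1)%N].

(** The leading matrix for weighted degree [k.+1]; its vanishing lowers the weighted degree to k,
    which explains the index. *)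
Definition weighted_top N k : 'M[C]_2 :=
  mx2 (N 0 0)`_k.+1 (N 0 1)`_k.+2 (N 1 0)`_k (N 1 1)`_k.+1.

Lemma sizeXM (p : {poly C}) n : (size p <= n)%N -> (size ('X * p : {poly C})%R <= n.+1)%N.
Proof.
move=> sp; apply: (leq_trans (size_polyMleq _ _)).
by rewrite size_polyX.
Qed.

(** At infinity sigma(z/q) behaves like z/q and sigma(z) like z, so leading terms of weighted degree
    k + 1 on the two sides differ by q^(k+1). The proof clears powers of z and compares top
    coefficients in each of the four entries. *)
Lemma intertwines_top b b' N k :
  [/\ (size (b 0%R 0%R) <= 7)%N, (size (b 0%R 1%R) <= 9)%N,
      (size (b 1%R 0%R) <= 6)%N & (size (b 1%R 1%R) <= 7)%N] ->
  [/\ (size (b' 0%R 0%R) <= 7)%N, (size (b' 0%R 1%R) <= 9)%N,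
      (size (b' 1%R 0%R) <= 6)%N & (size (b' 1%R 1%R) <= 7)%N] ->
  (forall z, z != 0 -> evmx N (sigma u q (z / q)) *m bmat b z =
                       bmat b' z *m evmx N (sigma u q z)) ->
  weighted_deg N k.+1 ->
  weighted_top N k *m limit_mx q b = q ^+ k.+1 *: (limit_mx q b' *m weighted_top N k).
Proof.
move=> [s1 s2 s3 s4] [t1 t2 t3 t4] H [w1 w2 w3 w4].
pose l n p := zlift q^-1 (u ^+ 2) n p; pose l' n p := zlift 1 (u ^+ 2 / q) n p.
have lE n (p : {poly C}) z : (size p <= n.+1)%N -> z != 0 ->
  (l n p).[z] = z ^+ n * p.[sigma u q (z / q)].
  by move=> sp z0; rewrite horner_zlift // sigmaq_lift.
have l'E n (p : {poly C}) z : (size p <= n.+1)%N -> z != 0 ->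
  (l' n p).[z] = z ^+ n * p.[sigma u q z].
  by move=> sp z0; rewrite horner_zlift // sigma_lift.
have sl n p : (size (l n p) <= n.*2.+1)%N by exact: size_zlift.
have sl' n p : (size (l' n p) <= n.*2.+1)%N by exact: size_zlift.
have cl n p : (l n p)`_(n.*2) = p`_n * q^-1 ^+ n by exact: coef_zlift.
have cl' n p : (l' n p)`_(n.*2) = p`_n by rewrite /l' coef_zlift expr1n mulr1.
have E z : z != 0 -> [/\
   (N 0 0).[sigma u q (z / q)] * (b 0 0).[z] + (N 0 1).[sigma u q (z / q)] * (b 1 0).[z] =
   (b' 0 0).[z] * (N 0 0).[sigma u q z] + (b' 0 1).[z] / z * (N 1 0).[sigma u q z],
   (N 0 0).[sigma u q (z / q)] * ((b 0 1).[z] / z) + (N 0 1).[sigma u q (z / q)] * (b 1 1).[z] =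
   (b' 0 0).[z] * (N 0 1).[sigma u q z] + (b' 0 1).[z] / z * (N 1 1).[sigma u q z],
   (N 1 0).[sigma u q (z / q)] * (b 0 0).[z] + (N 1 1).[sigma u q (z / q)] * (b 1 0).[z] =
   (b' 1 0).[z] * (N 0 0).[sigma u q z] + (b' 1 1).[z] * (N 1 0).[sigma u q z] &
   (N 1 0).[sigma u q (z / q)] * ((b 0 1).[z] / z) + (N 1 1).[sigma u q (z / q)] * (b 1 1).[z] =
   (b' 1 0).[z] * (N 0 1).[sigma u q z] + (b' 1 1).[z] * (N 1 1).[sigma u q z]].
  move=> z0; have := H z z0; rewrite !evmxE /bmat !mul_mx2 => M.
  by split; [have := congr1 (fun A : 'M[C]_2 => A 0 0) M
            |have := congr1 (fun A : 'M[C]_2 => A 0 1) M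
            |have := congr1 (fun A : 'M[C]_2 => A 1 0) M
            |have := congr1 (fun A : 'M[C]_2 => A 1 1) M]; rewrite !mx2E.
have nz0 z : z \notin [:: 0] -> z != 0 by rewrite inE.
have P1 : ('X * l k.+1 (N 0 0)) * b 0 0 + l k.+2 (N 0 1) * b 1 0 =
    b' 0 0 * ('X * l' k.+1 (N 0 0)) + b' 0 1 * ('X * l' k (N 1 0)).
  apply: (@poly_cofinite_eq _ _ _ [:: 0]) => z /nz0 z0; horner_simp.
  rewrite !lE // !l'E //; have [G _ _ _] := E z z0.
  apply: (@eq_scaled _ _ (z ^+ k.+2) _ _ G).
    by rewrite [z ^+ k.+2]exprS; ring.
  by rewrite [z ^+ k.+2]exprS [z ^+ k.+1]exprS; field.
have P2 : l k.+1 (N 0 0) * b 0 1 + l k.+2 (N 0 1) * b 1 1 =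
    b' 0 0 * l' k.+2 (N 0 1) + b' 0 1 * l' k.+1 (N 1 1).
  apply: (@poly_cofinite_eq _ _ _ [:: 0]) => z /nz0 z0; horner_simp.
  rewrite !lE // !l'E //; have [_ G _ _] := E z z0.
  apply: (@eq_scaled _ _ (z ^+ k.+2) _ _ G).
    by rewrite [z ^+ k.+2]exprS; field.
  by rewrite [z ^+ k.+2]exprS; field.
have P3 : ('X * l k (N 1 0)) * b 0 0 + l k.+1 (N 1 1) * b 1 0 =
    b' 1 0 * l' k.+1 (N 0 0) + b' 1 1 * ('X * l' k (N 1 0)).
  apply: (@poly_cofinite_eq _ _ _ [:: 0]) => z /nz0 z0; horner_simp.
  rewrite !lE // !l'E //; have [_ _ G _] := E z z0.
  apply: (@eq_scaled _ _ (z ^+ k.+1) _ _ G).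
    by rewrite [z ^+ k.+1]exprS; ring.
  by rewrite [z ^+ k.+1]exprS; ring.
have P4 : ('X * l k (N 1 0)) * b 0 1 + ('X * l k.+1 (N 1 1)) * b 1 1 =
    b' 1 0 * l' k.+2 (N 0 1) + b' 1 1 * ('X * l' k.+1 (N 1 1)).
  apply: (@poly_cofinite_eq _ _ _ [:: 0]) => z /nz0 z0; horner_simp.
  rewrite !lE // !l'E //; have [_ _ _ G] := E z z0.
  apply: (@eq_scaled _ _ (z ^+ k.+2) _ _ G).
    by rewrite [z ^+ k.+2]exprS [z ^+ k.+1]exprS; field.
  by rewrite [z ^+ k.+2]exprS; ring.
have cXl n p : ('X * l n p)`_(n.*2.+1) = p`_n * q^-1 ^+ n by rewrite coefXM cl.
have cXl' n p : ('X * l' n p)`_(n.*2.+1) = p`_n by rewrite coefXM cl'.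
have sXl n (p : {poly C}) : (size ('X * l n p)%R <= n.*2.+2)%N by rewrite sizeXM.
have sXl' n (p : {poly C}) : (size ('X * l' n p)%R <= n.*2.+2)%N by rewrite sizeXM.
have qk : q ^+ k.+1 * q^-1 ^+ k.+1 = 1 by rewrite -exprMn mulfV // expr1n.
have ek : q^-1 ^+ k = q^-1 ^+ k.+1 * q by rewrite exprSr mulfVK.
(* All four products have the same formal degree, where only the products of the formal leading
   coefficients contribute. *)
have top4 (p1 r1 p2 r2 p3 r3 p4 r4 : {poly C}) m1 n1 m2 n2 m3 n3 m4 n4 :
   (m1 + n1 = m2 + n2)%N -> (m1 + n1 = m3 + n3)%N -> (m1 + n1 = m4 + n4)%N ->
   (size p1 <= m1.+1)%N -> (size r1 <= n1.+1)%N ->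
   (size p2 <= m2.+1)%N -> (size r2 <= n2.+1)%N ->
   (size p3 <= m3.+1)%N -> (size r3 <= n3.+1)%N ->
   (size p4 <= m4.+1)%N -> (size r4 <= n4.+1)%N ->
   p1 * r1 + p2 * r2 = p3 * r3 + p4 * r4 ->
   p1`_m1 * r1`_n1 + p2`_m2 * r2`_n2 = p3`_m3 * r3`_n3 + p4`_m4 * r4`_n4.
  move=> E2 E3 E4 ? ? ? ? ? ? ? ? /(congr1 (fun p : {poly C} => p`_(m1 + n1))).
  by rewrite !coefD coefM_top // (coefM_topn (esym E2)) //
    (coefM_topn (esym E3)) // (coefM_topn (esym E4)).
have ar1 : (k.+1.*2.+1 + 6 = k.+2.*2 + 5)%N by lia.
have ar2 : (k.+1.*2.+1 + 6 = 6 + k.+1.*2.+1)%N by lia.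
have ar3 : (k.+1.*2.+1 + 6 = 8 + k.*2.+1)%N by lia.
have Q1 := top4 _ _ _ _ _ _ _ _ _ _ _ _ _ _ _ _ ar1 ar2 ar3
  (sXl _ _) s1 (sl _ _) s3 t1 (sXl' _ _) t2 (sXl' _ _) P1.
have ar4 : (k.+1.*2 + 8 = k.+2.*2 + 6)%N by lia.
have ar5 : (k.+1.*2 + 8 = 6 + k.+2.*2)%N by lia.
have ar6 : (k.+1.*2 + 8 = 8 + k.+1.*2)%N by lia.
have Q2 := top4 _ _ _ _ _ _ _ _ _ _ _ _ _ _ _ _ ar4 ar5 ar6
  (sl _ _) s2 (sl _ _) s4 t1 (sl' _ _) t2 (sl' _ _) P2.
have ar7 : (k.*2.+1 + 6 = k.+1.*2 + 5)%N by lia.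
have ar8 : (k.*2.+1 + 6 = 5 + k.+1.*2)%N by lia.
have ar9 : (k.*2.+1 + 6 = 6 + k.*2.+1)%N by lia.
have Q3 := top4 _ _ _ _ _ _ _ _ _ _ _ _ _ _ _ _ ar7 ar8 ar9
  (sXl _ _) s1 (sl _ _) s3 t3 (sl' _ _) t4 (sXl' _ _) P3.
have ar10 : (k.*2.+1 + 8 = k.+1.*2.+1 + 6)%N by lia.
have ar11 : (k.*2.+1 + 8 = 5 + k.+2.*2)%N by lia.
have ar12 : (k.*2.+1 + 8 = 6 + k.+1.*2.+1)%N by lia.
have Q4 := top4 _ _ _ _ _ _ _ _ _ _ _ _ _ _ _ _ ar10 ar11 ar12
  (sXl _ _) s2 (sXl _ _) s4 t3 (sl' _ _) t4 (sXl' _ _) P4.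
move: Q1 Q2 Q3 Q4; rewrite !cXl !cXl' !cl !cl' => Q1 Q2 Q3 Q4.
move: Q1 Q2 Q3 Q4; rewrite ek [_^-1 ^+ k.+2]exprSr.
move: (q ^+ k.+1) (q^-1 ^+ k.+1) qk => x y xy Q1 Q2 Q3 Q4.
have scaled (v w : C) : x * y * v = x * w -> v = x * w by rewrite xy mul1r.
rewrite /weighted_top /limit_mx !mul_mx2 scale_mx2.
apply: mx2_ext; rewrite !mx2E.
- by rewrite -Q1; apply: scaled; ring.
- by rewrite -Q2; apply: scaled; ring.
- have -> : (b' 1 0)`_5 / q * (N 0 0)`_k.+1 + (b' 1 1)`_6 / q * (N 1 0)`_k =
     q^-1 * ((b' 1 0)`_5 * (N 0 0)`_k.+1 + (b' 1 1)`_6 * (N 1 0)`_k) by ring.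
  by rewrite -Q3; apply: scaled; field.
- have -> : (b' 1 0)`_5 / q * (N 0 1)`_k.+2 + (b' 1 1)`_6 / q * (N 1 1)`_k.+1 =
     q^-1 * ((b' 1 0)`_5 * (N 0 1)`_k.+2 + (b' 1 1)`_6 * (N 1 1)`_k.+1) by ring.
  by rewrite -Q4; apply: scaled; field.
Qed.


Lemma intertwines1_reduce b b' N d : d != 0 -> intertwines1 b b' (d *: N) d ->
  intertwines1 b b' N 1.
Proof.
move=> d0 H; have [s Hs] := sigma_nonroots u0 q0 d0.
apply: (@laurent_mx_eq _ _ _ s).
- apply: laurent_scalemx; first by apply: laurent_horner; exact: laurent_sigma.
  apply: laurent_mulmx; first exact: laurent_evalmx (laurent_sigmaq _ _).
  by apply: laurent_bmat; [exact: laurent_id | exact: laurent_inv].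
- apply: laurent_scalemx; first by apply: laurent_horner; exact: laurent_sigmaq.
  apply: laurent_mulmx; last exact: laurent_evalmx (laurent_sigma _ _).
  by apply: laurent_bmat; [exact: laurent_id | exact: laurent_inv].
move=> z /Hs [z0 l1 l2]; have := H z z0.
rewrite !evmxZ !hornerC !scale1r -scalemxAl -scalemxAr !scalerA => E.
by apply: (can_inj (scalerK (mulf_neq0 l1 l2))); rewrite E mulrC.
Qed.

Lemma intertwines1_adj b b' N : intertwines1 b b' N 1 ->
  intertwines1 b' b (adj2 N) (\det N).
Proof.
move=> H z z0; have := H z z0; rewrite !hornerC !scale1r !evmx_adj -!det_evmx => E.
have := congr1 (fun A => adj2 (evmx N (sigma u q (z / q))) *m A *m
   adj2 (evmx N (sigma u q z))) E.
rewrite /= !mulmxA adj2_mul -!mulmxA mul_adj2 mul_scalar_mx => F.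
by rewrite F !mulmxA mul_mx_scalar.
Qed.

Lemma gauge_of_modification lam b b' : nonresonant lam ->
  matrix_type u q lam b -> matrix_type u q lam b' ->
  modification u q lam lam b b' -> gauge_equiv u q lam b b'.
Proof.
move=> nr Hb Hb' /(modification_intertwines u0 q0) [N [d [N0 d0]]].
move=> /(intertwines_cancel nr) H.
have [M EN] := denominator_cancels nr Hb Hb' d0 H.
move: H; rewrite EN => /(intertwines1_reduce d0) H.
have M0 : \det M != 0.
  apply: contraNneq N0 => M0; rewrite EN det2E !mxE -[_ - _](_ : d * d * \det M = _).
    by rewrite M0 mulr0.
  by rewrite det2E; ring.
have H' := intertwines1_adj H.
have [M' EM] := denominator_cancels nr Hb' Hb M0 H'.
have dM : \det M * \det M' = 1.
  apply: (mulfI M0); rewrite mulr1 -[RHS]det_adj2 EM.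
  by rewrite (det2E (_ *: _)) !mxE (det2E M'); ring.
have H1 z : z != 0 -> evmx M (sigma u q (z / q)) *m bmat b z =
                       bmat b' z *m evmx M (sigma u q z).
  by move=> z0; have := H z z0; rewrite !hornerC !scale1r.
have [V VU HV] := mt_asym Hb; have [V' VU' HV'] := mt_asym Hb'.
have L1 : V *m limit_mx q b = mx2 (d1 lam) 0 0 (d2 lam) *m V.
  by rewrite -HV mulmxKV.
have L2 : V' *m limit_mx q b' = mx2 (d1 lam) 0 0 (d2 lam) *m V'.
  by rewrite -HV' mulmxKV.
have [[_ _ _ _] [_ _ d10 d20]] := coords_neq0 (nr_coords nr).
(* In eigenbases of the two limits the leading matrix S satisfies S_ij (d_j - q^(k+1) d_i) = 0, and
   no bracket vanishes: q^(k+1) != 1 on the diagonal, d1/d2 outside q^Z off it. *)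
have desc k : weighted_deg M k.+1 -> weighted_deg M k.
  move=> w; have T := intertwines_top (mt_size Hb) (mt_size Hb') H1 w.
  suff : weighted_top M k = 0.
    rewrite /weighted_top => /matrixP Z.
    case: w => w1 w2 w3 w4.
    have red n (p : {poly C}) : (size p <= n.+1)%N -> p`_n = 0 -> (size p <= n)%N.
      move=> sp pn; apply/leq_sizeP => j; rewrite leq_eqVlt => /orP[/eqP <- //|nj].
      by rewrite nth_default // (leq_trans sp).
    by split; apply: red => //; [have := Z 0 0 | have := Z 0 1 | have := Z 1 0
       | have := Z 1 1]; rewrite !mxE.
  set W := weighted_top M k in T *.
  pose S := V' *m W *m invmx V.
  have ES : S *m mx2 (d1 lam) 0 0 (d2 lam) = q ^+ k.+1 *: (mx2 (d1 lam) 0 0 (d2 lam) *m S).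
    rewrite /S -mulmxA -[X in _ *m X](_ : limit_mx q b *m invmx V = _); last first.
      by apply: (can_inj (mulKmx VU)); rewrite mulmxA L1 mulmxK // mulKVmx.
    rewrite -mulmxA (mulmxA W) T -scalemxAl -scalemxAr; congr (_ *: _).
    by rewrite !mulmxA L2.
  have S0 : S = 0.
    have qk0 : q ^+ k.+1 != 1 by exact: q1.
    have ent (s0 a c : C) : a != q ^+ k.+1 * c -> s0 * a = q ^+ k.+1 * (c * s0) -> s0 = 0.
      move=> ne E; apply/eqP; have : s0 * (a - q ^+ k.+1 * c) == 0.
        by apply/eqP; rewrite mulrBr E; ring.
      by rewrite mulf_eq0 subr_eq0 (negbTE ne) orbF.
    have same (a : C) : a != 0 -> a != q ^+ k.+1 * a.
      by move=> a0; rewrite -subr_eq0 -{1}[a]mul1r -mulrBl mulf_neq0 // subr_eq0 eq_sym.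
    move: ES; rewrite (mx2_eta S) !mul_mx2 scale_mx2 => ES.
    have E00 := congr1 (fun A : 'M[C]_2 => A 0 0) ES.
    have E01 := congr1 (fun A : 'M[C]_2 => A 0 1) ES.
    have E10 := congr1 (fun A : 'M[C]_2 => A 1 0) ES.
    have E11 := congr1 (fun A : 'M[C]_2 => A 1 1) ES.
    move: E00 E01 E10 E11; rewrite !mx2E !mulr0 !mul0r !addr0 !add0r => E00 E01 E10 E11.
    have ne12 : d2 lam != q ^+ k.+1 * d1 lam.
      apply: contraNneq (nr_d nr (- k.+1%:Z)) => ->.
      by rewrite -exprnN mulrA mulVf ?mul1r ?expf_neq0.
    apply: mx2_ext; rewrite mx2E [RHS]mxE.
    + exact: ent _ _ _ (same _ d10) E00.
    + exact: ent _ _ _ ne12 E01.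
    + exact: ent _ _ _ (nr_d nr k.+1%:Z) E10.
    + exact: ent _ _ _ (same _ d20) E11.
  rewrite -[W](mulKmx VU') -[V' *m W](mulmxKV VU) -/S S0.
  by rewrite mul0mx mulmx0.
have [k0] : exists k, weighted_deg M k.
  exists (size (M 0 0)%R + size (M 0 1)%R + size (M 1 0)%R + size (M 1 1)%R)%N.
  by split; lia.
(* Descending to weighted degree 0 leaves exactly the shape of a gauge transformation. *)
elim: k0 => [|k IH /desc /IH //] [w1 w2 w3 w4].
have M10 : M 1 0 = 0 by apply/eqP; rewrite -size_poly_leq0.
have E1 := size1_polyC w1; have E4 := size1_polyC w4.
have M14 : (M 0 0)`_0 * (M 1 1)`_0 != 0.
  rewrite -polyC_eq0 polyCM -E1 -E4; move: M0; rewrite det2E M10 mulr0 subr0.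
  by [].
exists (M 0 0)`_0, (M 1 1)`_0, (M 0 1); split=> //.
- by move: M14; rewrite mulf_eq0 negb_or => /andP[].
- by move: M14; rewrite mulf_eq0 negb_or => /andP[].
move=> R z z0 Pz.
have ER x : R x = evmx M x.
  by rewrite /R evmxE M10 horner0 [in RHS]E1 [in RHS]E4 !hornerC.
have U : R (sigma u q z) \in unitmx.
  by rewrite unitmxE unitfE /R det_mx2 mulr0 subr0.
rewrite !connE -scalemxAr -scalemxAl; congr (_ *: _).
by apply: (can_inj (mulmxK U)); rewrite mulmxKV // !ER H1.
Qed.

End Uniqueness.

(** * Construction of the modification *)

Section Weights.
Variable C : fieldType.
Implicit Types (M N : 'M[{poly C}]_2).

(** Degrees in z, twice those in x = sigma(z). The lifts of R have [wdeg 0], B with its entry b_21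
    divided by z has [wdeg 4], and the triple product has [wdeg 8]; division by [D4] brings the
    degrees back to those of a connection. *)
Definition wdeg k M := [/\ (size (M 0%R 0%R) <= k.+3)%N, (size (M 0%R 1%R) <= k.+4.+1)%N,
  (size (M 1%R 0%R) <= k.+1)%N & (size (M 1%R 1%R) <= k.+3)%N].

Definition wtop k M : 'M[C]_2 :=
  mx2 (M 0 0)`_k.+2 (M 0 1)`_k.+4 (M 1 0)`_k (M 1 1)`_k.+2.

Lemma wtopE k M : [/\ wtop k M 0 0 = (M 0 0)`_k.+2, wtop k M 0 1 = (M 0 1)`_k.+4,
  wtop k M 1 0 = (M 1 0)`_k & wtop k M 1 1 = (M 1 1)`_k.+2].
Proof. by rewrite /wtop !mx2E. Qed.

Lemma size_add2 (m n l : nat) (p1 r1 p2 r2 : {poly C}) m' n' :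
  (m + n = l)%N -> (m' + n' = l)%N ->
  (size p1 <= m.+1)%N -> (size r1 <= n.+1)%N ->
  (size p2 <= m'.+1)%N -> (size r2 <= n'.+1)%N ->
  (size (p1 * r1 + p2 * r2)%R <= l.+1)%N /\
  (p1 * r1 + p2 * r2)`_l = p1`_m * r1`_n + p2`_m' * r2`_n'.
Proof.
move=> E1 E2 s1 s2 s3 s4; split; last first.
  by rewrite coefD (coefM_topn E1) // (coefM_topn E2).
rewrite (leq_trans (size_polyD _ _)) // geq_max -{1}E1 -E2.
by rewrite !size_polyM_top.
Qed.

Lemma wdeg_mul k l M N : wdeg k M -> wdeg l N ->
  wdeg (k + l).+2 (M *m N) /\ wtop (k + l).+2 (M *m N) = wtop k M *m wtop l N.
Proof.
move=> [a1 a2 a3 a4] [b1 b2 b3 b4].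
have [] := @size_add2 k.+2 l.+2 (k + l).+2.+2 _ _ _ _ k.+4 l _ _ a1 b1 a2 b3; [lia|lia|].
have [] := @size_add2 k.+2 l.+4 (k + l).+2.+4 _ _ _ _ k.+4 l.+2 _ _ a1 b2 a2 b4; [lia|lia|].
have [] := @size_add2 k l.+2 (k + l).+2 _ _ _ _ k.+2 l _ _ a3 b1 a4 b3; [lia|lia|].
have [] := @size_add2 k l.+4 (k + l).+2.+2 _ _ _ _ k.+2 l.+2 _ _ a3 b2 a4 b4; [lia|lia|].
move=> s1 t1 s2 t2 s3 t3 s4 t4; split; first by split; rewrite mul_mx2E.
by apply: mx2_ext; rewrite mul_mx2E !mx2E mul_mx2E.
Qed.

End Weights.

(** * The explicit modification shifting z2 and z4 *)

Section Step.
Variable C : numClosedFieldType.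
Variables u q : C.
Hypotheses (u0 : u != 0) (q0 : q != 0) (q1 : forall k, (0 < k)%N -> q ^+ k != 1).
Variable lam : param C.
Hypothesis nr : nonresonant u q lam.
Implicit Types (b : 'M[{poly C}]_2) (z s : C).
Let zn0 := nr_coords nr.
Let lamb := lambda_bar q lam.

Lemma lambda_bar_coords k : param_coords lamb k != 0.
Proof.
have [[? ? ? ?] [? ? ? ?]] := coords_neq0 zn0.
by case: k => [[|[|[|[|[|[|[|[|k]]]]]]]] Hk] //;
  rewrite /param_coords /tnth /= mulf_neq0 ?invr_neq0.
Qed.

(** Multiplying some z_i by q only shifts the exponent n in each condition, and d1/d2 is
    unchanged. *)
Lemma nonresonant_bar : nonresonant u q lamb.
Proof.
pose e (i : 'I_6) : int := if (i == 1%N :> nat) || (i == 3%N :> nat) then 1 else 0.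
have ze i : zcoord lamb i = q ^ e i * zcoord lam i.
  by case: i => [[|[|[|[|[|[|i]]]]]] Hi] //; rewrite /zcoord /tnth /= ?expr0z ?expr1z ?mul1r.
split; first exact: lambda_bar_coords.
- move=> i j n ij; rewrite !ze; apply: contra_neq (nr_ratio nr (n + e j - e i) ij) => E.
  apply: (mulfI (expfz_neq0 (e i) q0)); rewrite E !mulrA -!expfzDr //.
  by congr (q ^ _ * _); ring.
- move=> i j n; rewrite !ze; apply: contra_neq (nr_prod nr i j (n - e i - e j)) => E.
  apply: (mulfI (expfz_neq0 (e i + e j) q0)).
  rewrite [RHS]mulrA -expfzDr // [in RHS](_ : e i + e j + (n - e i - e j) = n); last by ring.
  by rewrite -E expfzDr //; ring.
- move=> n; have := nr_d nr n; rewrite /=; apply: contra_neq => E.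
  by apply: (mulfI (invr_neq0 q0)); rewrite E; ring.
Qed.

Let i1 : 'I_6 := @Ordinal 6 1 isT.
Let i3 : 'I_6 := @Ordinal 6 3 isT.

Lemma nr_neq i j : i != j -> zcoord lam i != zcoord lam j.
Proof. by move=> /(nr_ratio nr 0); rewrite expr0z mul1r. Qed.

Lemma nr_star i j : zcoord lam i != u ^+ 2 / zcoord lam j.
Proof.
have := nr_prod nr i j 0; rewrite expr0z mul1r; apply: contra_neq => ->.
by rewrite mulfVK // zcoord_neq0.
Qed.

Lemma nr_star2 i j : i != j -> u ^+ 2 / zcoord lam i != u ^+ 2 / zcoord lam j.
Proof.
move=> /nr_neq; apply: contra_neq => /(mulfI (expf_neq0 2 u0)) E.
by rewrite -[LHS]invrK E invrK.
Qed.

Lemma nr_u i : zcoord lam i != u /\ zcoord lam i != - u.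
Proof.
have := nr_prod nr i i 0; rewrite expr0z mul1r => H.
by split; apply: contra_neq H => ->; rewrite ?mulrNN expr2.
Qed.

Lemma nr_ustar i : u != u ^+ 2 / zcoord lam i /\ - u != u ^+ 2 / zcoord lam i.
Proof.
have [H1 H2] := nr_u i; have z0 := zcoord_neq0 i zn0.
split; [apply: contra_neq H1 | apply: contra_neq H2] => E.
  by apply: (mulfI u0); rewrite {1}E mulfVK.
have nu0 : - u != 0 by rewrite oppr_eq0.
by apply: (mulfI nu0); rewrite {1}E mulfVK // mulrNN.
Qed.

Let sg2 := sigma u q (z2 lam).
Let sg4 := sigma u q (z4 lam).

Lemma sigma_sub z (w : C) : z != 0 -> w != 0 ->
  sigma u q z - sigma u q w = (z - w) * (z - u ^+ 2 / (q * w)) / z.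
Proof. by move=> z0 w0; rewrite /sigma; field; rewrite w0 z0 q0. Qed.

Lemma sigmaq_sub z (w : C) : z != 0 -> w != 0 ->
  sigma u q (z / q) - sigma u q w = (z - q * w) * (z - u ^+ 2 / w) / (q * z).
Proof. by move=> z0 w0; rewrite /sigma; field; rewrite w0 z0 q0. Qed.

(** Equality sigma(z) = sigma(w) means z = w or z w = u^2/q; both are resonances for z2 and z4. *)
Lemma sg24 : sg2 != sg4.
Proof.
have [[_ zi0 _ zj0] _] := coords_neq0 zn0.
rewrite -subr_eq0 sigma_sub // !mulf_neq0 ?invr_neq0 // subr_eq0.
  exact: (@nr_neq i1 i3).
have := nr_prod nr i1 i3 (-1); apply: contra_neq => E.
by rewrite [LHS](_ : _ = z2 lam * z4 lam) // E exprN1; field; rewrite q0 zj0.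
Qed.

(* At z = z2 the matrix of b has rank one and its rows are proportional; with
   rho = c2 row_1 + c2' row_2, the vector (al2, be2) = (rho_2, - rho_1) spans the
   kernel, and likewise at z4.  The second row of R is then determined up to a
   factor, and cA, cB, cC parametrize its first row, i.e. the gauge freedom.  No
   choice of the constants works for all b: the good locus is [kap c b != 0]. *)
Record chart := Chart { c2 : C; c2' : C; c4 : C; c4' : C; cA : C; cB : C; cC : C }.
Implicit Types (c : chart).

Definition kvec1 (x y s : C) b : C := x * ((b 0 1).[s] / s) + y * (b 1 1).[s].
Definition kvec2 (x y s : C) b : C := - (x * (b 0 0).[s] + y * (b 1 0).[s]).

Definition al2 c b := kvec1 (c2 c) (c2' c) (z2 lam) b.
Definition be2 c b := kvec2 (c2 c) (c2' c) (z2 lam) b.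
Definition al4 c b := kvec1 (c4 c) (c4' c) (z4 lam) b.
Definition be4 c b := kvec2 (c4 c) (c4' c) (z4 lam) b.

Definition kap c b : C :=
  - cA c * be2 c b * be4 c b * (sg2 - sg4)
  - (cB c * be4 c b + cC c * be2 c b) * (al2 c b * be4 c b - al4 c b * be2 c b).

(** Interpolation at [sg2] and [sg4]: at each of these points both rows are multiples of (be, - al),
    hence annihilate the kernel vector (al, be) of that point. *)
Definition Rmat c b : 'M[{poly C}]_2 := mx2
  ((cB c * be4 c b) *: ('X - sg2%:P) + (cC c * be2 c b) *: ('X - sg4%:P))
  (cA c *: (('X - sg2%:P) * ('X - sg4%:P)) - (cB c * al4 c b) *: ('X - sg2%:P)
     - (cC c * al2 c b) *: ('X - sg4%:P))
  (be2 c b * be4 c b * (sg2 - sg4))%:P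
  ((al4 c b * be2 c b) *: ('X - sg2%:P) - (al2 c b * be4 c b) *: ('X - sg4%:P)).

Lemma det_Rmat c b : \det (Rmat c b) = kap c b *: (('X - sg2%:P) * ('X - sg4%:P)).
Proof.
rewrite /Rmat det_mx2 /kap; apply: (@poly_cofinite_eq _ _ _ [::]) => z _.
by horner_simp; ring.
Qed.

Definition D4 : {poly C} := \prod_(r <- [:: z2 lam; z4 lam; u ^+ 2 / z2 lam;
  u ^+ 2 / z4 lam]) ('X - r%:P).

Lemma horner_D4 z : D4.[z] = (z - z2 lam) * (z - z4 lam) * (z - u ^+ 2 / z2 lam) *
  (z - u ^+ 2 / z4 lam).
Proof. by rewrite /D4 !big_cons big_nil; horner_simp; ring. Qed.

Let l := zlift q^-1 (u ^+ 2).
Let l' := zlift 1 (u ^+ 2 / q).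

(** Polynomial form of R(sigma(z/q)), with entries scaled by z, z^2, 1, z; [Mright] does the same
    for adj R(sigma(z)). Dropping a factor z from b_21 in [Bsharp] makes these weights compatible
    with matrix products. *)
Definition Mleft (R : 'M[{poly C}]_2) : 'M[{poly C}]_2 :=
  mx2 (l 1 (R 0 0)) (l 2 (R 0 1)) (l 0 (R 1 0)) (l 1 (R 1 1)).
Definition Mright (R : 'M[{poly C}]_2) : 'M[{poly C}]_2 :=
  mx2 (l' 1 (R 1 1)) (- l' 2 (R 0 1)) (- l' 0 (R 1 0)) (l' 1 (R 0 0)).
Definition Bsharp b : 'M[{poly C}]_2 :=
  mx2 (b 0 0) (b 0 1) (drop_poly 1 (b 1 0)) (b 1 1).
Definition conj_sharp R b := Mleft R *m Bsharp b *m Mright R.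
Definition Nsharp c b := conj_sharp (Rmat c b) b.

Definition step c b : 'M[{poly C}]_2 := (kap c b)^-1%:P *:
  mx2 (Nsharp c b 0 0 %/ D4) (Nsharp c b 0 1 %/ D4) ('X * (Nsharp c b 1 0 %/ D4))
      (Nsharp c b 1 1 %/ D4).

Lemma size_lin (a : C) : size ('X - a%:P : {poly C}) = 2%N.
Proof. exact: size_XsubC. Qed.

Lemma Rmat_size c b : [/\ (size (Rmat c b 0%R 0%R) <= 2)%N, (size (Rmat c b 0%R 1%R) <= 3)%N,
  (size (Rmat c b 1%R 0%R) <= 1)%N & (size (Rmat c b 1%R 1%R) <= 2)%N].
Proof.
have sZ (x a : C) n : (2 <= n)%N -> (size (x *: ('X - a%:P : {poly C}))%R <= n)%N.
  by move=> Hn; rewrite (leq_trans (size_scale_leq _ _)) // size_lin.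
have sD (p r : {poly C}) n : (size p <= n)%N -> (size r <= n)%N -> (size (p + r)%R <= n)%N.
  by move=> sp sr; rewrite (leq_trans (size_polyD _ _)) // geq_max sp sr.
split; rewrite mx2E.
- by apply: sD; exact: sZ.
- apply: (sD); [apply: sD|]; rewrite ?size_polyN ?sZ //.
  rewrite (leq_trans (size_scale_leq _ _)) //.
  by apply: (@size_polyM_top _ 1 1); rewrite size_lin.
- exact: size_polyC_leq1.
- by apply: sD; rewrite ?size_polyN ?sZ.
Qed.

Definition conj_Rmat c b z := evmx (Rmat c b) (sigma u q (z / q)) *m bmat b z
  *m adj2 (evmx (Rmat c b) (sigma u q z)).

Lemma horner_drop1 (p : {poly C}) z : p.[0] = 0 -> p.[z] = z * (drop_poly 1 p).[z].
Proof.
move=> p0; rewrite -[in LHS](poly_take_drop 1 p) hornerD hornerM hornerXn expr1.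
have /size1_polyC -> : (size (take_poly 1 p) <= 1)%N by exact: size_take_poly.
by rewrite hornerC coef_take_poly /= -horner_coef0 p0 add0r mulrC.
Qed.

Lemma conj_sharpE (R : 'M[{poly C}]_2) b z :
  [/\ (size (R 0%R 0%R) <= 2)%N, (size (R 0%R 1%R) <= 3)%N,
  (size (R 1%R 0%R) <= 1)%N & (size (R 1%R 1%R) <= 2)%N] -> z != 0 -> (b 1 0).[0] = 0 ->
  mx2 (conj_sharp R b 0 0).[z] ((conj_sharp R b 0 1).[z] / z)
      (z * (conj_sharp R b 1 0).[z]) (conj_sharp R b 1 1).[z] =
  z ^+ 2 *: (evmx R (sigma u q (z / q)) *m bmat b z *m adj2 (evmx R (sigma u q z))).
Proof.
move=> [s1 s2 s3 s4] z0 b0.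
have e1 := sigma_lift u q0 z0; have e2 := sigmaq_lift u q0 z0.
rewrite !evmxE /bmat /adj2 !mx2E (horner_drop1 z b0) e1 e2 !mul_mx2 scale_mx2.
rewrite /conj_sharp /Mleft /Mright /Bsharp !mul_mx2 !mx2E.
apply: mx2_ext; rewrite !mx2E; horner_simp; rewrite !horner_zlift //; by field.
Qed.

Lemma NsharpE c b z : z != 0 -> (b 1 0).[0] = 0 ->
  mx2 (Nsharp c b 0 0).[z] ((Nsharp c b 0 1).[z] / z) (z * (Nsharp c b 1 0).[z])
      (Nsharp c b 1 1).[z] = z ^+ 2 *: conj_Rmat c b z.
Proof. by move=> z0 b0; apply: conj_sharpE => //; exact: Rmat_size. Qed.

Lemma D4_neq0 z : z != z2 lam -> z != z4 lam -> z != u ^+ 2 / z2 lam ->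
  z != u ^+ 2 / z4 lam -> D4.[z] != 0.
Proof. by move=> *; rewrite horner_D4 !mulf_neq0 // subr_eq0. Qed.

Lemma D4_poly_neq0 : D4 != 0.
Proof. by rewrite monic_neq0 // monic_prod_XsubC. Qed.

Lemma size_D4 : size D4 = 5%N.
Proof. by rewrite size_prod_XsubC. Qed.

Lemma coef_D4 : D4`_4 = 1.
Proof.
have /monicP := monic_prod_XsubC [:: z2 lam; z4 lam; u ^+ 2 / z2 lam;
  u ^+ 2 / z4 lam] xpredT id.
by rewrite lead_coefE size_D4.
Qed.

Lemma uniq_D4 : uniq [:: z2 lam; z4 lam; u ^+ 2 / z2 lam; u ^+ 2 / z4 lam].
Proof.
have h1 : z2 lam != z4 lam := @nr_neq i1 i3 isT.
have h2 : u ^+ 2 / z2 lam != u ^+ 2 / z4 lam := @nr_star2 i1 i3 isT.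
have h3 : z2 lam != u ^+ 2 / z2 lam := @nr_star i1 i1.
have h4 : z2 lam != u ^+ 2 / z4 lam := @nr_star i1 i3.
have h5 : z4 lam != u ^+ 2 / z2 lam := @nr_star i3 i1.
have h6 : z4 lam != u ^+ 2 / z4 lam := @nr_star i3 i3.
by rewrite /= !inE !negb_or h1 h2 h3 h4 h5 h6.
Qed.

Section OnType.
Variable b : 'M[{poly C}]_2.
Hypothesis Hb : matrix_type u q lam b.

Lemma kernel_right (x y s : C) : s != 0 -> \det (bmat b s) = 0 ->
  (b 0 0).[s] * kvec1 x y s b + (b 0 1).[s] / s * kvec2 x y s b = 0 /\
  (b 1 0).[s] * kvec1 x y s b + (b 1 1).[s] * kvec2 x y s b = 0.
Proof.
move=> s0; rewrite bmat_det /kvec1 /kvec2 => D.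
split.
  rewrite [LHS](_ : _ = y * ((b 0 0).[s] * (b 1 1).[s] - (b 0 1).[s] / s * (b 1 0).[s])).
    by rewrite D mulr0.
  by ring.
rewrite [LHS](_ : _ = - x * ((b 0 0).[s] * (b 1 1).[s] - (b 0 1).[s] / s * (b 1 0).[s])).
  by rewrite D mulr0.
by ring.
Qed.

(** The row (- kvec2, kvec1) is a combination of the rows of B(s), and B(s) B(u^2/s) = 0 because P
    vanishes at u^2/s. *)
Lemma kernel_left (x y s : C) : s != 0 -> (Ppol u lam).[u ^+ 2 / s] = 0 ->
  let s' := u ^+ 2 / s in
  - kvec2 x y s b * (b 0 0).[s'] + kvec1 x y s b * (b 1 0).[s'] = 0 /\
  - kvec2 x y s b * ((b 0 1).[s'] / s') + kvec1 x y s b * (b 1 1).[s'] = 0.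
Proof.
move=> s0 P0 s'; have s'0 : s' != 0 by rewrite mulf_neq0 ?invr_neq0 ?expf_neq0.
have := mt_inv Hb s'0; have -> : u ^+ 2 / s' = s by rewrite /s'; field; rewrite s0 u0.
rewrite P0 mulr0 /bmat mul_mx2 scalar_mx2 => M.
have := congr1 (fun A : 'M[C]_2 => A 0 0) M; have := congr1 (fun A : 'M[C]_2 => A 0 1) M.
have := congr1 (fun A : 'M[C]_2 => A 1 0) M; have := congr1 (fun A : 'M[C]_2 => A 1 1) M.
rewrite !mx2E /kvec1 /kvec2 => m4 m3 m2 m1; split.
  rewrite [LHS](_ : _ = x * ((b 0 0).[s] * (b 0 0).[s'] + (b 0 1).[s] / s * (b 1 0).[s'])
    + y * ((b 1 0).[s] * (b 0 0).[s'] + (b 1 1).[s] * (b 1 0).[s'])); last by ring.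
  by rewrite m1 m3 !mulr0 addr0.
rewrite [LHS](_ : _ = x * ((b 0 0).[s] * ((b 0 1).[s'] / s') + (b 0 1).[s] / s * (b 1 1).[s'])
    + y * ((b 1 0).[s] * ((b 0 1).[s'] / s') + (b 1 1).[s] * (b 1 1).[s'])); last by ring.
by rewrite m2 m4 !mulr0 addr0.
Qed.

Let z20 : z2 lam != 0. Proof. by have [[]] := coords_neq0 zn0. Qed.
Let z40 : z4 lam != 0. Proof. by have [[]] := coords_neq0 zn0. Qed.

Lemma Q_z2 : (Qpol u lam).[z2 lam] = 0 /\ (Qpol u lam).[z4 lam] = 0.
Proof. by rewrite !horner_Qpol !subrr !(mulr0, mul0r). Qed.

Lemma P_z2star : (Ppol u lam).[u ^+ 2 / z2 lam] = 0 /\ (Ppol u lam).[u ^+ 2 / z4 lam] = 0.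
Proof. by rewrite !horner_Ppol !subrr !(mulr0, mul0r). Qed.

(** At z2 and z4 the columns of adj R(sigma(z)) lie in the right kernel of B(z). At u^2/z2 and
    u^2/z4 the point sigma(z/q) is [sg2] or [sg4], and the rows of R there annihilate B(z) from the
    left. *)
Lemma conj_Rmat_zero c :
  [/\ conj_Rmat c b (z2 lam) = 0, conj_Rmat c b (z4 lam) = 0,
      conj_Rmat c b (u ^+ 2 / z2 lam) = 0 & conj_Rmat c b (u ^+ 2 / z4 lam) = 0].
Proof.
have [Q2 Q4] := Q_z2; have [P2 P4] := P_z2star.
have D2 : \det (bmat b (z2 lam)) = 0 by rewrite (mt_det Hb) // Q2 mulr0.
have D4' : \det (bmat b (z4 lam)) = 0 by rewrite (mt_det Hb) // Q4 mulr0.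
have [k21 k22] := kernel_right (c2 c) (c2' c) z20 D2.
have [k41 k42] := kernel_right (c4 c) (c4' c) z40 D4'.
have [l21 l22] := kernel_left (c2 c) (c2' c) z20 P2.
have [l41 l42] := kernel_left (c4 c) (c4' c) z40 P4.
move: k21 k22 k41 k42 l21 l22 l41 l42.
rewrite -!/(al2 c b) -!/(be2 c b) -!/(al4 c b) -!/(be4 c b).
have zeroE (w x y : C) : x = 0 -> y = w * x -> y = 0 by move=> -> ->; rewrite mulr0.
have zero2 (A : 'M[C]_2) : A 0 0 = 0 -> A 0 1 = 0 -> A 1 0 = 0 -> A 1 1 = 0 -> A = 0.
  by move=> *; apply: mx2_ext; rewrite [RHS]mxE.
rewrite /conj_Rmat !sigma_star // -/sg2 -/sg4.
set A2 := al2 c b; set B2 := be2 c b; set A4 := al4 c b; set B4 := be4 c b.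
move=> k21 k22 k41 k42 l21 l22 l41 l42.
have R2 : evmx (Rmat c b) sg2 = mx2 (cC c * B2 * (sg2 - sg4)) (- cC c * A2 * (sg2 - sg4))
   (B2 * B4 * (sg2 - sg4)) (- A2 * B4 * (sg2 - sg4)).
  by rewrite evmxE !mx2E; horner_simp; apply: mx2_ext; rewrite !mx2E -/A2 -/B2 -/A4 -/B4; ring.
have R4 : evmx (Rmat c b) sg4 = mx2 (cB c * B4 * (sg4 - sg2)) (- cB c * A4 * (sg4 - sg2))
   (B2 * B4 * (sg2 - sg4)) (A4 * B2 * (sg4 - sg2)).
  by rewrite evmxE !mx2E; horner_simp; apply: mx2_ext; rewrite !mx2E -/A2 -/B2 -/A4 -/B4; ring.
have F2 : bmat b (z2 lam) *m adj2 (evmx (Rmat c b) sg2) = 0.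
  rewrite R2 /adj2 !mx2E /bmat mul_mx2; apply: zero2; rewrite !mx2E.
  - by apply: (zeroE (- B4 * (sg2 - sg4)) _ _ k21); ring.
  - by apply: (zeroE (cC c * (sg2 - sg4)) _ _ k21); ring.
  - by apply: (zeroE (- B4 * (sg2 - sg4)) _ _ k22); ring.
  - by apply: (zeroE (cC c * (sg2 - sg4)) _ _ k22); ring.
have F4 : bmat b (z4 lam) *m adj2 (evmx (Rmat c b) sg4) = 0.
  rewrite R4 /adj2 !mx2E /bmat mul_mx2; apply: zero2; rewrite !mx2E.
  - by apply: (zeroE (B2 * (sg4 - sg2)) _ _ k41); ring.
  - by apply: (zeroE (cB c * (sg4 - sg2)) _ _ k41); ring.
  - by apply: (zeroE (B2 * (sg4 - sg2)) _ _ k42); ring.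
  - by apply: (zeroE (cB c * (sg4 - sg2)) _ _ k42); ring.
have G2 : evmx (Rmat c b) sg2 *m bmat b (u ^+ 2 / z2 lam) = 0.
  rewrite R2 /bmat mul_mx2; apply: zero2; rewrite !mx2E.
  - by apply: (zeroE (- cC c * (sg2 - sg4)) _ _ l21); ring.
  - by apply: (zeroE (- cC c * (sg2 - sg4)) _ _ l22); ring.
  - by apply: (zeroE (- B4 * (sg2 - sg4)) _ _ l21); ring.
  - by apply: (zeroE (- B4 * (sg2 - sg4)) _ _ l22); ring.
have G4 : evmx (Rmat c b) sg4 *m bmat b (u ^+ 2 / z4 lam) = 0.
  rewrite R4 /bmat mul_mx2; apply: zero2; rewrite !mx2E.
  - by apply: (zeroE (- cB c * (sg4 - sg2)) _ _ l41); ring.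
  - by apply: (zeroE (- cB c * (sg4 - sg2)) _ _ l42); ring.
  - by apply: (zeroE (B2 * (sg4 - sg2)) _ _ l41); ring.
  - by apply: (zeroE (B2 * (sg4 - sg2)) _ _ l42); ring.
by split; rewrite ?G2 ?G4 ?mul0mx // -mulmxA ?F2 ?F4 mulmx0.
Qed.

Lemma Nsharp_dvd c i j : D4 %| Nsharp c b i j.
Proof.
have [t1 t2 t3 t4] := conj_Rmat_zero c.
have z20' : u ^+ 2 / z2 lam != 0 by rewrite mulf_neq0 ?invr_neq0 ?expf_neq0.
have z40' : u ^+ 2 / z4 lam != 0 by rewrite mulf_neq0 ?invr_neq0 ?expf_neq0.
have key z : z != 0 -> conj_Rmat c b z = 0 -> root (Nsharp c b i j) z.
  move=> z0 T; have := NsharpE c z0 (mt_b21 Hb); rewrite T scaler0 => M.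
  apply/rootP; move: i j; apply: ord2P; apply: ord2P.
  - by have := congr1 (fun A : 'M[C]_2 => A 0 0) M; rewrite /= mx2E [RHS]mxE.
  - have := congr1 (fun A : 'M[C]_2 => A 0 1) M; rewrite /= mx2E [RHS]mxE => /eqP.
    by rewrite mulf_eq0 invr_eq0 (negbTE z0) orbF => /eqP.
  - have := congr1 (fun A : 'M[C]_2 => A 1 0) M; rewrite /= mx2E [RHS]mxE => /eqP.
    by rewrite mulf_eq0 (negbTE z0) => /eqP.
  - by have := congr1 (fun A : 'M[C]_2 => A 1 1) M; rewrite /= mx2E [RHS]mxE.
apply: uniq_roots_dvdp; last by rewrite uniq_rootsE uniq_D4.
by rewrite /= !key.
Qed.

Lemma stepE c :
  [/\ step c b 0 0 = (kap c b)^-1%:P * (Nsharp c b 0 0 %/ D4),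
      step c b 0 1 = (kap c b)^-1%:P * (Nsharp c b 0 1 %/ D4),
      step c b 1 0 = (kap c b)^-1%:P * ('X * (Nsharp c b 1 0 %/ D4)) &
      step c b 1 1 = (kap c b)^-1%:P * (Nsharp c b 1 1 %/ D4)].
Proof. by split; rewrite /step mxE mx2E. Qed.

Lemma bmat_step c z : z != 0 -> D4.[z] != 0 ->
  bmat (step c b) z = ((kap c b)^-1 * z ^+ 2 / D4.[z]) *: conj_Rmat c b z.
Proof.
move=> z0 Dz; have := NsharpE c z0 (mt_b21 Hb).
have E i j : (Nsharp c b i j).[z] = (Nsharp c b i j %/ D4).[z] * D4.[z].
  by rewrite -hornerM divpK // Nsharp_dvd.
rewrite !E => M.
have -> : ((kap c b)^-1 * z ^+ 2 / D4.[z]) *: conj_Rmat c b z =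
  ((kap c b)^-1 / D4.[z]) *: (z ^+ 2 *: conj_Rmat c b z).
  by rewrite scalerA; congr (_ *: _); ring.
rewrite /bmat; have [-> -> -> ->] := stepE c.
rewrite -M scale_mx2; apply: mx2_ext; rewrite !mx2E !(hornerM, hornerX, hornerC);
  move: (kap c b)^-1 => k; by field; rewrite ?Dz ?z0.
Qed.

Definition dsig x := (x - sg2) * (x - sg4).

Lemma det_evRmat c x : \det (evmx (Rmat c b) x) = kap c b * dsig x.
Proof. by rewrite det_evmx det_Rmat /dsig; horner_simp. Qed.

(** As sigma(z) - sigma(z2) = (z - z2) (z - u^2/(q z2)) / z, the zeros u^2/z2 and u^2/z4 of P are
    traded for u^2/(q z2) and u^2/(q z4); [D4] collects what cancels. *)
Lemma Ppol_bar z : z != 0 -> D4.[z] != 0 ->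
  (Ppol u lamb).[z] = z ^+ 2 * (Ppol u lam).[z] * dsig (sigma u q z) / D4.[z].
Proof.
move=> z0 D0; apply: (mulIf D0); rewrite mulfVK //.
rewrite /dsig /sg2 /sg4 !sigma_sub // !horner_Ppol horner_D4 /lamb /lambda_bar /=.
move: (u ^+ 2 / z2 lam) (u ^+ 2 / z4 lam) (u ^+ 2 / z6 lam) => s2 s4 s6.
move: (u ^+ 2 / (q * z2 lam)) (u ^+ 2 / (q * z4 lam)) => t2 t4.
by field.
Qed.

Lemma Qpol_bar z : z != 0 -> D4.[z] != 0 ->
  (Qpol u lamb).[z] = z ^+ 2 * (Qpol u lam).[z] * dsig (sigma u q (z / q)) / D4.[z].
Proof.
move=> z0 D0; apply: (mulIf D0); rewrite mulfVK //.
rewrite /dsig /sg2 /sg4 !sigmaq_sub // !horner_Qpol horner_D4 /lamb /lambda_bar /=.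
have -> : z1 lam * z3 lam * z5 lam / (q * z2 lam * (q * z4 lam) * z6 lam) =
  q^-1 ^+ 2 * (z1 lam * z3 lam * z5 lam / (z2 lam * z4 lam * z6 lam)).
  by rewrite expr2 !invfM; ring.
move: (z1 lam * z3 lam * z5 lam / (z2 lam * z4 lam * z6 lam)) => K.
move: (u ^+ 2 / z1 lam) (u ^+ 2 / z3 lam) (u ^+ 2 / z5 lam) => s1 s3 s5.
move: (u ^+ 2 / z2 lam) (u ^+ 2 / z4 lam) => s2 s4.
by field; rewrite q0 z0.
Qed.

Lemma D4_star z : z != 0 -> D4.[u ^+ 2 / z] = u ^+ 4 / z ^+ 4 * D4.[z].
Proof.
by move=> z0; rewrite !horner_D4; field; rewrite z0 z20 z40.
Qed.

Definition D4_points : seq C :=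
  0 :: [:: z2 lam; z4 lam; u ^+ 2 / z2 lam; u ^+ 2 / z4 lam].

Lemma D4_pointsP z : z \notin D4_points -> z != 0 /\ D4.[z] != 0.
Proof.
rewrite !inE !negb_or => /and5P[h0 h1 h2 h3 h4].
by split=> //; exact: D4_neq0.
Qed.

Lemma bmat_step_det c z : kap c b != 0 -> z != 0 ->
  \det (bmat (step c b) z) = (Ppol u lamb).[z] * (Qpol u lamb).[z].
Proof.
move=> k0; move: z; apply: (@laurent_eq _ _ _ D4_points).
- by apply: laurent_det; apply: laurent_bmat; [exact: laurent_id | exact: laurent_inv].
- by apply: laurent_mul; exact: laurent_poly.
move=> z /D4_pointsP [z0 D0].
rewrite bmat_step // detZ /conj_Rmat !det_mulmx det_adj2 !det_evRmat (mt_det Hb) //.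
rewrite Ppol_bar // Qpol_bar //; by field; rewrite D0 k0.
Qed.

(** Since sigma(u^2/z) = sigma(z/q), the inner factors adj R and R of the product have the same
    argument and collapse to det R; the involution condition for b then collapses the rest. *)
Lemma bmat_step_inv c z : kap c b != 0 -> z != 0 ->
  bmat (step c b) (u ^+ 2 / z) *m bmat (step c b) z =
  ((Ppol u lamb).[u ^+ 2 / z] * (Ppol u lamb).[z])%:M.
Proof.
move=> k0; move: z; apply: (@laurent_mx_eq _ _ _ D4_points).
- apply: laurent_mulmx; apply: laurent_bmat.
  + exact: laurent_Vscale.
  + exact: laurent_star.
  + exact: laurent_id.
  + exact: laurent_inv.
- have H := laurent_mul (laurent_horner (Ppol u lamb) (laurent_Vscale (u ^+ 2)))
                            (laurent_poly (Ppol u lamb)).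
  move=> i j; apply: (laurent_ext _ (laurent_mul H (laurent_cst ((i == j)%:R)))).
  by move=> w _; rewrite mxE; case: eqP; rewrite ?mulr1 ?mulr0.
move=> z /D4_pointsP [z0 D0].
have w0 : u ^+ 2 / z != 0 by rewrite mulf_neq0 ?invr_neq0 ?expf_neq0.
have D0' : D4.[u ^+ 2 / z] != 0.
  by rewrite D4_star // !mulf_neq0 ?invr_neq0 ?expf_neq0.
rewrite !bmat_step // -scalemxAl -scalemxAr scalerA /conj_Rmat sigma_star // sigma_star' //.
set R := evmx _ (sigma u q z); set R' := evmx _ (sigma u q (z / q)).
have -> : R *m bmat b (u ^+ 2 / z) *m adj2 R' *m (R' *m bmat b z *m adj2 R) =
   R *m (bmat b (u ^+ 2 / z) *m (adj2 R' *m R') *m bmat b z) *m adj2 R.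
  by rewrite !mulmxA.
rewrite adj2_mul mul_mx_scalar -scalemxAl (mt_inv Hb) // scale_scalar_mx.
rewrite mul_mx_scalar -scalemxAl mul_adj2 !scale_scalar_mx; congr (_%:M).
rewrite !det_evRmat !Ppol_bar // sigma_star' //.
by field; rewrite D0 D0' k0 z0.
Qed.

(** At a fixed point v of the involution sigma(v/q) = sigma(v), and conjugation keeps a scalar
    matrix scalar. The case v = -u carries A(-u) = 1 over to the modified connection. *)
Lemma bmat_step_one c v : kap c b != 0 -> v ^+ 2 = u ^+ 2 -> D4.[v] != 0 ->
  bmat b v = ((Ppol u lam).[v])%:M -> bmat (step c b) v = ((Ppol u lamb).[v])%:M.
Proof.
move=> k0 vu Dv Bv; have v0 : v != 0.
  by apply: contraTneq (expf_neq0 2 u0) => E; rewrite -vu E expr0n eqxx.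
rewrite bmat_step // /conj_Rmat Bv mul_mx_scalar -scalemxAl.
have -> : sigma u q (v / q) = sigma u q v.
  by rewrite -(sigma_star' u0 q0 v0) -vu; congr (sigma u q _); field.
rewrite mul_adj2 !scale_scalar_mx det_evRmat Ppol_bar //; congr (_%:M).
by field; rewrite Dv k0.
Qed.

Lemma D4_u : D4.[u] != 0 /\ D4.[- u] != 0.
Proof.
have [a1 a2] := nr_u i1; have [a3 a4] := nr_u i3.
have [b1 b2] := nr_ustar i1; have [b3 b4] := nr_ustar i3.
by split; apply: D4_neq0 => //; rewrite eq_sym.
Qed.

Lemma wdeg_Mleft (R : 'M[{poly C}]_2) : [/\ (size (R 0%R 0%R) <= 2)%N, (size (R 0%R 1%R) <= 3)%N,
  (size (R 1%R 0%R) <= 1)%N & (size (R 1%R 1%R) <= 2)%N] -> wdeg 0 (Mleft R).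
Proof. by move=> _; split; rewrite mx2E; apply: size_zlift. Qed.

Lemma wdeg_Mright (R : 'M[{poly C}]_2) : [/\ (size (R 0%R 0%R) <= 2)%N, (size (R 0%R 1%R) <= 3)%N,
  (size (R 1%R 0%R) <= 1)%N & (size (R 1%R 1%R) <= 2)%N] -> wdeg 0 (Mright R).
Proof. by move=> _; split; rewrite mx2E ?size_polyN; apply: size_zlift. Qed.

Lemma wdeg_Bsharp : wdeg 4 (Bsharp b).
Proof.
have [s1 s2 s3 s4] := mt_size Hb; split; rewrite mx2E //.
by rewrite size_drop_poly leq_subLR add1n.
Qed.

Lemma wdeg_Nsharp c : wdeg 8 (Nsharp c b) /\
  wtop 8 (Nsharp c b) = wtop 0 (Mleft (Rmat c b)) *m wtop 4 (Bsharp b)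
     *m wtop 0 (Mright (Rmat c b)).
Proof.
have sR := Rmat_size c b.
have [w1 t1] := wdeg_mul (wdeg_Mleft sR) wdeg_Bsharp.
by have [w2 t2] := wdeg_mul w1 (wdeg_Mright sR); rewrite t1 in t2.
Qed.

Lemma quot_D4 n (p : {poly C}) : D4 %| p -> (size p <= n.+4.+1)%N ->
  (size (p %/ D4)%R <= n.+1)%N /\ (p %/ D4)`_n = p`_n.+4.
Proof.
move=> dv sp; have s1 : (size (p %/ D4)%R <= n.+1)%N.
  by rewrite size_divp ?D4_poly_neq0 // size_D4 /= leq_subLR.
split=> //; have := @coefM_topn _ n 4 n.+4 (p %/ D4) D4 (addn4 n) s1.
by rewrite size_D4 => /(_ isT); rewrite divpK // coef_D4 mulr1.
Qed.

Lemma limit_conj (R : 'M[{poly C}]_2) :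
  let T := mx2 (R 0 0)`_1 (R 0 1)`_2 (R 1 0)`_0 (R 1 1)`_1 in
  let W := wtop 0 (Mleft R) *m wtop 4 (Bsharp b) *m wtop 0 (Mright R) in
  mx2 (W 0 0) (W 0 1) (W 1 0 / q) (W 1 1 / q) = q^-1 *: (T *m limit_mx q b *m adj2 T).
Proof.
move=> T W.
have cz (a d : C) n (p : {poly C}) k : k = n.*2 -> (zlift a d n p)`_k = p`_n * a ^+ n.
  by move=> ->; rewrite coef_zlift.
have [a1 a2 a3 a4] : let A := wtop 0 (Mleft R) in
   [/\ A 0 0 = (R 0 0)`_1 / q, A 0 1 = (R 0 1)`_2 / q ^+ 2, A 1 0 = (R 1 0)`_0
     & A 1 1 = (R 1 1)`_1 / q].
  have [/= -> -> -> ->] := wtopE 0 (Mleft R).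
  have [-> -> -> ->] : [/\ Mleft R 0 0 = l 1 (R 0 0), Mleft R 0 1 = l 2 (R 0 1),
    Mleft R 1 0 = l 0 (R 1 0) & Mleft R 1 1 = l 1 (R 1 1)] by split; rewrite mx2E.
  by rewrite /l !(cz _ _ 1 _ 2) // (cz _ _ 2 _ 4) // (cz _ _ 0 _ 0) // expr0 mulr1 -exprVn.
have [d1 d2 d3 d4] : let A := wtop 0 (Mright R) in
   [/\ A 0 0 = (R 1 1)`_1, A 0 1 = - (R 0 1)`_2, A 1 0 = - (R 1 0)`_0
     & A 1 1 = (R 0 0)`_1].
  have [/= -> -> -> ->] := wtopE 0 (Mright R).
  have [-> -> -> ->] : [/\ Mright R 0 0 = l' 1 (R 1 1), Mright R 0 1 = - l' 2 (R 0 1),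
    Mright R 1 0 = - l' 0 (R 1 0) & Mright R 1 1 = l' 1 (R 0 0)] by split; rewrite mx2E.
  by rewrite /l' !coefN !(cz _ _ 1 _ 2) // (cz _ _ 2 _ 4) // (cz _ _ 0 _ 0) // !expr1n !mulr1.
have [b1 b2 b3 b4] : let A := wtop 4 (Bsharp b) in
   [/\ A 0 0 = (b 0 0)`_6, A 0 1 = (b 0 1)`_8, A 1 0 = (b 1 0)`_5
     & A 1 1 = (b 1 1)`_6].
  have [/= -> -> -> ->] := wtopE 4 (Bsharp b).
  have [-> -> -> ->] : [/\ Bsharp b 0 0 = b 0 0, Bsharp b 0 1 = b 0 1,
    Bsharp b 1 0 = drop_poly 1 (b 1 0) & Bsharp b 1 1 = b 1 1] by split; rewrite mx2E.
  by rewrite coef_drop_poly.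
have E i j := mul_mx2E (wtop 0 (Mleft R) *m wtop 4 (Bsharp b)) (wtop 0 (Mright R)) i j.
have E' i j := mul_mx2E (wtop 0 (Mleft R)) (wtop 4 (Bsharp b)) i j.
have {E E'} : [/\ W 0 0 = ((R 0 0)`_1 / q * (b 0 0)`_6 + (R 0 1)`_2 / q ^+ 2 * (b 1 0)`_5)
    * (R 1 1)`_1 + ((R 0 0)`_1 / q * (b 0 1)`_8 + (R 0 1)`_2 / q ^+ 2 * (b 1 1)`_6)
    * - (R 1 0)`_0,
  W 0 1 = ((R 0 0)`_1 / q * (b 0 0)`_6 + (R 0 1)`_2 / q ^+ 2 * (b 1 0)`_5)
    * - (R 0 1)`_2 + ((R 0 0)`_1 / q * (b 0 1)`_8 + (R 0 1)`_2 / q ^+ 2 * (b 1 1)`_6)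
    * (R 0 0)`_1,
  W 1 0 = ((R 1 0)`_0 * (b 0 0)`_6 + (R 1 1)`_1 / q * (b 1 0)`_5)
    * (R 1 1)`_1 + ((R 1 0)`_0 * (b 0 1)`_8 + (R 1 1)`_1 / q * (b 1 1)`_6)
    * - (R 1 0)`_0 &
  W 1 1 = ((R 1 0)`_0 * (b 0 0)`_6 + (R 1 1)`_1 / q * (b 1 0)`_5)
    * - (R 0 1)`_2 + ((R 1 0)`_0 * (b 0 1)`_8 + (R 1 1)`_1 / q * (b 1 1)`_6)
    * (R 0 0)`_1].
  move: (E 0 0) (E 0 1) (E 1 0) (E 1 1) (E' 0 0) (E' 0 1) (E' 1 0) (E' 1 1).
  move: a1 a2 a3 a4 b1 b2 b3 b4 d1 d2 d3 d4; rewrite -/W.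
  move: (wtop 0 (Mleft R) *m wtop 4 (Bsharp b)) (wtop 0 (Mleft R)) (wtop 4 (Bsharp b)) (wtop 0 (Mright R)).
  move: W => W AB A B D /= -> -> -> -> -> -> -> -> -> -> -> -> -> -> -> -> -> -> -> ->.
  by [].
move: W => W [-> -> -> ->].
rewrite /T /limit_mx /adj2 !mul_mx2 scale_mx2 !mx2E.
by congr (mx2 _ _ _ _); field.
Qed.

(** T is the leading matrix of R and adj T = kap T^-1, so the limit is conjugated by T and divided
    by q, the latter because R is evaluated at sigma(z/q) on the left. This is the origin of d_i ->
    d_i/q. *)
Lemma limit_step c : kap c b != 0 ->
  let T := mx2 (Rmat c b 0 0)`_1 (Rmat c b 0 1)`_2 (Rmat c b 1 0)`_0 (Rmat c b 1 1)`_1 in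
  limit_mx q (step c b) = (kap c b * q)^-1 *: (T *m limit_mx q b *m adj2 T) /\
  \det T = kap c b.
Proof.
move=> k0 T; split.
  have [[w1 w2 w3 w4] wt] := wdeg_Nsharp c.
  have [_ q1'] := quot_D4 (Nsharp_dvd c 0 0) w1.
  have [_ q2] := quot_D4 (Nsharp_dvd c 0 1) w2.
  have [_ q3] := quot_D4 (Nsharp_dvd c 1 0) w3.
  have [_ q4] := quot_D4 (Nsharp_dvd c 1 1) w4.
  have [e1 e2 e3 e4] := stepE c.
  have [t1 t2 t3 t4] := wtopE 8 (Nsharp c b).
  rewrite invfM -scalerA -(limit_conj (Rmat c b)) -wt t1 t2 t3 t4.
  by rewrite /limit_mx e1 e2 e3 e4 !coefCM coefXM /= q1' q2 q3 q4 scale_mx2 !mulrA.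
rewrite /T det_mx2.
have := congr1 (fun p : {poly C} => p`_2) (det_Rmat c b).
have [r1 r2 r3 r4] := Rmat_size c b.
rewrite det2E coefB (@coefM_topn _ 1 1 2) // (@coefM_topn _ 2 0 2) // => ->.
rewrite coefZ (@coefM_topn _ 1 1 2) ?size_XsubC //.
by rewrite !coefB !coefX !coefC /= !subr0 !mulr1.
Qed.

Lemma step_type c : kap c b != 0 -> matrix_type u q lamb (step c b).
Proof.
move=> k0.
have [[w1 w2 w3 w4] _] := wdeg_Nsharp c.
have [s1 _] := quot_D4 (Nsharp_dvd c 0 0) w1.
have [s2 _] := quot_D4 (Nsharp_dvd c 0 1) w2.
have [s3 _] := quot_D4 (Nsharp_dvd c 1 0) w3.
have [s4 _] := quot_D4 (Nsharp_dvd c 1 1) w4.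
have [e1 e2 e3 e4] := stepE c.
have sC (p : {poly C}) n : (size p <= n)%N -> (size ((kap c b)^-1%:P * p)%R <= n)%N.
  by move=> sp; rewrite mul_polyC (leq_trans (size_scale_leq _ _)).
split.
- by split; rewrite ?e1 ?e2 ?e3 ?e4; apply: sC => //; apply: sizeXM.
- by rewrite e3 !hornerM hornerX mul0r mulr0.
- by move=> z; exact: bmat_step_det.
- by move=> z; exact: bmat_step_inv.
- by apply: bmat_step_one => //; [have [] := D4_u | exact: mt_one Hb].
have [EL dT] := limit_step k0; have [V VU HV] := mt_asym Hb.
set T := mx2 _ _ _ _ in EL dT.
have TU : T \in unitmx by rewrite unitmxE unitfE dT.
have adjE : adj2 T = kap c b *: invmx T.
  by apply: (can_inj (mulKmx TU)); rewrite mul_adj2 dT -scalemxAr mulmxV // scalemx1.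
have VT : V *m invmx T \in unitmx by rewrite unitmx_mul VU unitmx_inv.
exists (V *m invmx T) => //.
apply: (can_inj (mulmxK VT)); rewrite mulmxKV // EL adjE.
have -> : mx2 (d1 lamb) 0 0 (d2 lamb) = q^-1 *: mx2 (d1 lam) 0 0 (d2 lam).
  by rewrite scale_mx2 !mulr0.
rewrite -HV -!scalemxAr -!scalemxAl !scalerA -!mulmxA !mulKmx //.
by rewrite invfM mulrAC mulVf // mul1r.
Qed.

Lemma step_modification c : kap c b != 0 -> modification u q lam lamb b (step c b).
Proof.
move=> k0; exists (Rmat c b), 1; split; last 1 first.
- move=> R.
  have d0 : \det (Rmat c b) != 0.
    by rewrite det_Rmat scaler_eq0 negb_or k0 mulf_neq0 ?polyXsubC_eq0.
  have [s Hs] := sigma_nonroots u0 q0 d0.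
  exists (good_points u lam ++ good_points u lamb ++ D4_points ++ s) => z.
  rewrite 3!mem_cat 3!negb_or => /and4P[h1 h2 h3 h4].
  have [z0 P0 _] := good_pointsP zn0 h1.
  have [_ P0' _] := good_pointsP lambda_bar_coords h2.
  have [_ D0] := D4_pointsP h3; have [_ Ds _] := Hs _ h4.
  have RE x : R x = evmx (Rmat c b) x by rewrite /R hornerC invr1 scale1r.
  rewrite !RE; have U : evmx (Rmat c b) (sigma u q z) \in unitmx.
    by rewrite unitmxE unitfE det_evmx.
  apply: (can_inj (mulmxK U)); rewrite mulmxKV // !connE bmat_step // scalerA.
  have dd : dsig (sigma u q z) != 0.
    by move: Ds; rewrite -det_evmx det_evRmat mulf_eq0 negb_or => /andP[].
  rewrite -scalemxAl /conj_Rmat -[_ *m adj2 _ *m _]mulmxA adj2_mul mul_mx_scalar scalerA.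
  rewrite -scalemxAr; congr (_ *: _); rewrite det_evRmat Ppol_bar //.
  by field; rewrite D0 k0 P0 dd z0.
- by rewrite det_Rmat scaler_eq0 negb_or k0 mulf_neq0 ?polyXsubC_eq0.
- exact: oner_neq0.
Qed.

End OnType.
End Step.

(** * Existence of a chart at every connection *)

Section Charts.
Variable C : numClosedFieldType.
Variables u q : C.
Hypotheses (u0 : u != 0) (q0 : q != 0) (q1 : forall k, (0 < k)%N -> q ^+ k != 1).
Variable lam : param C.
Hypothesis nr : nonresonant u q lam.
Implicit Types (z s : C).
Let zn0 := nr_coords nr.

Definition star_root (p : bool * 'I_6) : C :=
  if p.1 then u ^+ 2 / zcoord lam p.2 else zcoord lam p.2.

(** The first six codes are the zeros of P, the other six those of Q; [true] stands for u^2/z_i.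
    Coding the roots by indices lets distinctness be read off from nonresonance. *)
Definition root_codes : seq (bool * 'I_6) :=
  [:: (false, @Ordinal 6 0 isT); (true, @Ordinal 6 1 isT); (false, @Ordinal 6 2 isT);
      (true, @Ordinal 6 3 isT); (false, @Ordinal 6 4 isT); (true, @Ordinal 6 5 isT);
      (true, @Ordinal 6 0 isT); (false, @Ordinal 6 1 isT); (true, @Ordinal 6 2 isT);
      (false, @Ordinal 6 3 isT); (true, @Ordinal 6 4 isT); (false, @Ordinal 6 5 isT)].

Definition all_roots : seq C := map star_root root_codes.

Lemma all_rootsE : all_roots =
  [:: z1 lam; u ^+ 2 / z2 lam; z3 lam; u ^+ 2 / z4 lam; z5 lam; u ^+ 2 / z6 lam;
      u ^+ 2 / z1 lam; z2 lam; u ^+ 2 / z3 lam; z4 lam; u ^+ 2 / z5 lam; z6 lam].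
Proof. by []. Qed.

Lemma star_root_inj : injective star_root.
Proof.
move=> [[] i] [[] j]; rewrite /star_root /=.
- have [-> //|ij] := eqVneq i j.
  by move/eqP; rewrite (negbTE (nr_star2 u0 nr ij)).
- by move/eqP; rewrite eq_sym (negbTE (nr_star nr j i)).
- by move/eqP; rewrite (negbTE (nr_star nr i j)).
- have [-> //|ij] := eqVneq i j.
  by move/eqP; rewrite (negbTE (nr_neq nr ij)).
Qed.

Lemma uniq_all_roots : uniq all_roots.
Proof. by rewrite map_inj_uniq //; exact: star_root_inj. Qed.

Definition PQ_lead : C := (z1 lam * z3 lam * z5 lam) / (z2 lam * z4 lam * z6 lam).

Lemma PQ_prod : Ppol u lam * Qpol u lam = PQ_lead *: \prod_(r <- all_roots) ('X - r%:P).
Proof.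
rewrite all_rootsE !big_cons big_nil /Ppol /Qpol -scalerAr mulr1; congr (_ *: _).
by rewrite !mulrA.
Qed.

Lemma all_roots_neq0 s : s \in all_roots -> s != 0.
Proof.
move=> /mapP[[c i] _ ->]; rewrite /star_root /=; have z0 := zcoord_neq0 i zn0.
by case: c; rewrite // mulf_neq0 ?invr_neq0 ?expf_neq0.
Qed.

Section OnType.
Variable b : 'M[{poly C}]_2.
Hypothesis Hb : matrix_type u q lam b.

Lemma det_poly : 'X * (b 0 0 * b 1 1) - b 0 1 * b 1 0 = 'X * (Ppol u lam * Qpol u lam).
Proof.
apply: (@poly_cofinite_eq _ _ _ [:: 0]) => z; rewrite inE => z0.
transitivity (z * \det (bmat b z)).
  by rewrite bmat_det; horner_simp; field.
by rewrite (mt_det Hb z0) -hornerM -[X in X * _]hornerX -hornerM.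
Qed.

(** If B(s) = 0, every entry is divisible by X - s and the determinant by its square, whereas the
    twelve zeros of P Q are simple. *)
Lemma bmat_neq0 s : s \in all_roots -> bmat b s != 0.
Proof.
move=> sR; have s0 := all_roots_neq0 sR; apply/eqP => M.
have ent i j := congr1 (fun A : 'M[C]_2 => A i j) M.
move: (ent 0 0) (ent 0 1) (ent 1 0) (ent 1 1); rewrite /bmat !mx2E !mxE => r1 /eqP r2 r3 r4.
move: r2; rewrite mulf_eq0 invr_eq0 (negbTE s0) orbF => /eqP r2.
have fac (p : {poly C}) : p.[s] = 0 -> exists p', p = ('X - s%:P) * p'.
  move=> ps; exists (p %/ ('X - s%:P)); rewrite mulrC divpK // dvdp_XsubCl.
  exact/rootP.
have [p1 e1] := fac _ r1; have [p2 e2] := fac _ r2.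
have [p3 e3] := fac _ r3; have [p4 e4] := fac _ r4.
have := det_poly; rewrite PQ_prod e1 e2 e3 e4.
rewrite (perm_big _ (perm_to_rem sR)) big_cons /= => E.
have lin0 : 'X - s%:P != 0 :> {poly C} by rewrite polyXsubC_eq0.
have E' : ('X - s%:P) * ('X * (p1 * p4) - p2 * p3) =
   PQ_lead *: ('X * \prod_(r <- rem s all_roots) ('X - r%:P)).
  apply: (mulfI lin0); rewrite -!mul_polyC; move: E; rewrite -!mul_polyC => E.
  transitivity ('X * (('X - s%:P) * p1 * (('X - s%:P) * p4))
    - ('X - s%:P) * p2 * (('X - s%:P) * p3)); first by ring.
  by rewrite E; ring.
have K0 : PQ_lead != 0.
  have [[? ? ? ?] [? ? _ _]] := coords_neq0 zn0.
  by rewrite mulf_neq0 ?invr_neq0 // !mulf_neq0.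
have N : (\prod_(r <- rem s all_roots) ('X - r%:P)).[s] != 0.
  rewrite -rootE root_prod_XsubC (mem_rem_uniq _ uniq_all_roots).
  by rewrite !inE eqxx.
have /eqP := congr1 (fun p : {poly C} => p.[s]) E'.
rewrite hornerM hornerXsubC subrr mul0r eq_sym hornerZ hornerM hornerX.
by rewrite mulf_eq0 (negbTE K0) mulf_eq0 (negbTE s0) (negbTE N).
Qed.

(** The involution and determinant conditions give B(u^2/z) = (u^6/z^6) adj B(z); the sign is that
    of an off-diagonal entry of the adjugate. *)
Lemma b21_star z : z != 0 -> (b 1 0).[u ^+ 2 / z] = - (u ^+ 6 / z ^+ 6) * (b 1 0).[z].
Proof.
move: z; apply: (@laurent_eq _ _ _ (good_points u lam)).
- by apply: laurent_horner; exact: laurent_Vscale.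
- apply: laurent_mul; last exact: laurent_poly.
  apply: laurent_opp; apply: laurent_mul (laurent_cst _) _.
  by exists 1, 6 => z _; rewrite hornerC div1r.
move=> z /(good_pointsP zn0) [z0 P0 Q0].
have := congr1 (fun A => A *m adj2 (bmat b z)) (mt_inv Hb z0).
rewrite /= -mulmxA mul_adj2 (mt_det Hb z0) Ppol_star // mul_mx_scalar mul_scalar_mx.
move=> /(congr1 (fun A : 'M[C]_2 => A 1 0)); rewrite !mxE /= => E.
apply: (mulfI (mulf_neq0 P0 Q0)); rewrite E; ring.
Qed.

(** At u this is the normalization of A. At -u it follows from the antisymmetry alone, whatever the
    sign of A(-u). *)
Lemma b21_u : (b 1 0).[u] = 0 /\ (b 1 0).[- u] = 0.
Proof.
split.
  have := congr1 (fun A : 'M[C]_2 => A 1 0) (mt_one Hb).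
  by rewrite /bmat mx2E !mxE.
have nu0 : - u != 0 by rewrite oppr_eq0.
have := b21_star nu0; have -> : u ^+ 2 / - u = - u by field.
have -> : u ^+ 6 / (- u) ^+ 6 = 1 by field.
rewrite mulN1r => /eqP; rewrite -addr_eq0 -mulr2n mulrn_eq0 /= => /eqP; done.
Qed.

(** With 0, u, -u and the images under z -> u^2/z, these would make seven zeros, against degree at
    most 5. *)
Lemma b21_not_both : b 1 0 != 0 -> (b 1 0).[z2 lam] = 0 -> (b 1 0).[z4 lam] = 0 -> False.
Proof.
move=> b0 r2 r4.
have [[_ z20 _ z40] _] := coords_neq0 zn0.
have [ru rnu] := b21_u.
have r2' : (b 1 0).[u ^+ 2 / z2 lam] = 0 by rewrite b21_star // r2 mulr0.
have r4' : (b 1 0).[u ^+ 2 / z4 lam] = 0 by rewrite b21_star // r4 mulr0.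
pose o1 : 'I_6 := @Ordinal 6 1 isT; pose o3 : 'I_6 := @Ordinal 6 3 isT.
have U : uniq [:: 0; u; - u; z2 lam; z4 lam; u ^+ 2 / z2 lam; u ^+ 2 / z4 lam].
  have [a1 a2] := nr_u nr o1; have [a3 a4] := nr_u nr o3.
  have [c1 c2] := nr_ustar u0 nr o1; have [c3 c4] := nr_ustar u0 nr o3.
  rewrite 3!cons_uniq (uniq_D4 u0 nr) andbT !inE !negb_or.
  move: a1 a2 a3 a4 c1 c2 c3 c4; rewrite /zcoord /tnth /= => a1 a2 a3 a4 c1 c2 c3 c4.
  have z20' : u ^+ 2 / z2 lam != 0 by rewrite mulf_neq0 ?invr_neq0 ?expf_neq0.
  have z40' : u ^+ 2 / z4 lam != 0 by rewrite mulf_neq0 ?invr_neq0 ?expf_neq0.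
  rewrite ![0 == _]eq_sym u0 oppr_eq0 u0 z20 z40 z20' z40' c1 c2 c3 c4.
  rewrite ![_ == z2 lam]eq_sym ![_ == z4 lam]eq_sym a1 a2 a3 a4 !andbT /=.
  by rewrite -addr_eq0 -mulr2n mulrn_eq0.
have A : all (root (b 1 0)) [:: 0; u; - u; z2 lam; z4 lam; u ^+ 2 / z2 lam; u ^+ 2 / z4 lam].
  by rewrite /= !rootE (mt_b21 Hb) ru rnu r2 r4 r2' r4' eqxx.
have := max_poly_roots b0 A U; have [_ _ s3 _] := mt_size Hb.
by move=> /leq_trans /(_ s3).
Qed.

Lemma exists_kvec s : s \in all_roots ->
  exists x y, kvec1 x y s b != 0 \/ kvec2 x y s b != 0.
Proof.
move=> /bmat_neq0; rewrite /kvec1 /kvec2 => M.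
have [e1|h] := boolP ((b 0 0).[s] != 0).
  by exists 1, 0; right; rewrite mul1r mul0r addr0 oppr_eq0.
have [e2|h2] := boolP ((b 0 1).[s] / s != 0).
  by exists 1, 0; left; rewrite mul1r mul0r addr0.
exists 0, 1; rewrite !mul0r !mul1r !add0r oppr_eq0.
have [e3|h3] := boolP ((b 1 0).[s] != 0); first by right.
left; apply: contra M => /eqP e4; move: h h2 h3; rewrite !negbK => /eqP h /eqP h2 /eqP h3.
by apply/eqP; apply: mx2_ext; rewrite [RHS]mxE /bmat mx2E.
Qed.

(** If be2 = 0, the kernel vector at z2 is (al2, 0) with al2 != 0, so b_21(z2) = 0, and likewise at
    z4. Hence at most one of be2, be4 vanishes, and each of the three cases is served by setting one
    of [cA], [cB], [cC] to 1. *)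
Lemma exists_chart : b 1 0 != 0 -> exists c : chart C, kap u q lam c b != 0.
Proof.
move=> b0; have [[_ z20 _ z40] _] := coords_neq0 zn0.
have R2 : z2 lam \in all_roots by rewrite all_rootsE !inE eqxx !orbT.
have R4 : z4 lam \in all_roots by rewrite all_rootsE !inE eqxx !orbT.
have [x2 [y2 K2]] := exists_kvec R2; have [x4 [y4 K4]] := exists_kvec R4.
have [Q2 Q4] := Q_z2 u lam.
have D2 : \det (bmat b (z2 lam)) = 0 by rewrite (mt_det Hb) // Q2 mulr0.
have D4' : \det (bmat b (z4 lam)) = 0 by rewrite (mt_det Hb) // Q4 mulr0.
have [_ k2] := kernel_right x2 y2 z20 D2.
have [_ k4] := kernel_right x4 y4 z40 D4'.
have sg := sg24 q0 nr; rewrite -subr_eq0 in sg.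
pose ch a1 a2 a3 := Chart x2 y2 x4 y4 a1 a2 a3.
rewrite /kap.
have [e2|n2] := eqVneq (kvec2 x2 y2 (z2 lam) b) 0.
  move: K2; rewrite e2 eqxx => -[n1|//].
  have [e4|n4] := eqVneq (kvec2 x4 y4 (z4 lam) b) 0.
    move: K4; rewrite e4 eqxx => -[n3|//]; exfalso; apply: b21_not_both => //.
      by move: k2; rewrite e2 mulr0 addr0 => /eqP; rewrite mulf_eq0 (negbTE n1) orbF => /eqP.
    by move: k4; rewrite e4 mulr0 addr0 => /eqP; rewrite mulf_eq0 (negbTE n3) orbF => /eqP.
  exists (ch 0 1 0); rewrite /al2 /be2 /al4 /be4 /= e2.
  rewrite !(mulr0, mul0r, oppr0, mulr1, mul1r, sub0r, addr0, subr0).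
  by rewrite oppr_eq0 !mulf_neq0.
have [e4|n4] := eqVneq (kvec2 x4 y4 (z4 lam) b) 0.
  move: K4; rewrite e4 eqxx => -[n3|//].
  exists (ch 0 0 1); rewrite /al2 /be2 /al4 /be4 /= e4.
  rewrite !(mulr0, mul0r, oppr0, mulr1, mul1r, sub0r, addr0, add0r, subr0).
  by rewrite oppr_eq0 mulf_neq0 // oppr_eq0 mulf_neq0.
exists (ch 1 0 0); rewrite /al2 /be2 /al4 /be4 /=.
rewrite !(mul0r, addr0, add0r, subr0).
by rewrite !mulf_neq0 // oppr_eq0 oner_neq0.
Qed.

End OnType.
End Charts.

(** * The coordinates as invariant rows *)

Section Coordinates.
Variable C : numClosedFieldType.
Variables u q : C.
Hypotheses (u0 : u != 0) (q0 : q != 0).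
Implicit Types (lam : param C) (t p f g z : C).

Definition Kpol lam z : C := (z2 lam - z) * (z4 lam - z) * (z6 lam - z).

Section Fixed.
Variables (lam : param C) (t p : C).
Hypotheses (t0 : t != 0) (pt : p * u - t != 0).
Let s := u ^+ 2 / t.
Let x := t + s.
Let y := (p * t - u) / (p * u - t).

Lemma g_numE : g_num u lam x y * (p * u - t) =
  (t + u) * (t * (p * (z6 lam - s)) - s * (z6 lam - t)).
Proof. by rewrite /g_num /x /y /s; field; rewrite pt t0. Qed.

Lemma g_denE : g_den u lam x y * (p * u - t) =
  (t + u) * (p * (z6 lam - s) - (z6 lam - t)).
Proof. by rewrite /g_den /x /y /s; field; rewrite pt t0. Qed.

Lemma f_numE : f_num u lam x y * (p * u - t) =
  (t + u) * (p * t * Kpol lam s - s * Kpol lam t).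
Proof.
by rewrite /f_num /sigma1 /sigma2 /sigma3 /Kpol /x /y /s; field; rewrite pt t0.
Qed.

Lemma f_denE : f_den u lam x y * (p * u - t) =
  (t + u) * (t * (p * t * Kpol lam s) - s * (s * Kpol lam t)).
Proof.
by rewrite /f_den /sigma1 /sigma2 /sigma3 /Kpol /x /y /s; field; rewrite pt t0.
Qed.

(** Clearing p u - t exposes a common factor t + u of numerator and denominator. What is left is the
    condition at z = t for the row with first entry g - z. *)
Lemma g_coordinate : g_den u lam x y != 0 ->
  [/\ t + u != 0, p * (z6 lam - s) - (z6 lam - t) != 0 &
      let g := g_num u lam x y / g_den u lam x y in
      p * (z6 lam - s) * (g - t) = (z6 lam - t) * (g - s)].
Proof.
move=> D; have := mulf_neq0 D pt; rewrite g_denE mulf_eq0 negb_or => /andP[h1 h2].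
split=> //.
have -> : g_num u lam x y / g_den u lam x y =
   (t * (p * (z6 lam - s)) - s * (z6 lam - t)) / (p * (z6 lam - s) - (z6 lam - t)).
  apply: (mulIf D); rewrite mulfVK //; apply: (mulIf pt); rewrite g_numE.
  rewrite -[RHS]mulrA g_denE; by field.
by field.
Qed.

(** The same computation with z2, z4, z6 all involved. The relation reads X (f t - 1) = Y (f s - 1),
    the condition at z = t for the row with first entry f z - 1. *)
Lemma f_coordinate : f_den u lam x y != 0 ->
  let X := p * t * Kpol lam s in let Y := s * Kpol lam t in
  t * X - s * Y != 0 /\
  (f_num u lam x y / f_den u lam x y) * (t * X - s * Y) = X - Y.
Proof.
move=> D X Y; have := mulf_neq0 D pt; rewrite f_denE mulf_eq0 negb_or => /andP[h1 h2].
split=> //; apply: (mulfI h1); rewrite mulrCA -f_denE -f_numE; by field.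
Qed.

End Fixed.
End Coordinates.

(** * Invariant rows of a connection in normal form *)

Section Rows.
Variable C : numClosedFieldType.
Variables u q : C.
Hypotheses (u0 : u != 0) (q0 : q != 0) (q1 : forall k, (0 < k)%N -> q ^+ k != 1).
Variable lam : param C.
Hypothesis nr : nonresonant u q lam.
Variables (b : 'M[{poly C}]_2) (t : C).
Hypothesis Hb : matrix_type u q lam b.
Hypothesis Hmu : bmat b (- u) = ((Ppol u lam).[- u])%:M.
Hypotheses (t0 : t != 0) (tu : t != u) (tnu : t != - u).
Hypothesis b21E : b 1 0 = 'X * ('X^2 - (u ^+ 2)%:P) * ('X - t%:P) * ('X - (u ^+ 2 / t)%:P).
Hypothesis Pt : (Ppol u lam).[t] != 0.
Implicit Types (z : C).
Let s := u ^+ 2 / t.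
Let zn0 := nr_coords nr.

Lemma horner_b21 z : (b 1 0).[z] = z * ((z - u) * (z + u) * (z - t) * (z - s)).
Proof. by rewrite b21E; horner_simp; rewrite -/s; ring. Qed.

Lemma coef_b21 : (b 1 0)`_5 = 1.
Proof.
have -> : b 1 0 = \prod_(r <- [:: 0; u; - u; t; s]) ('X - r%:P).
  apply: (@poly_cofinite_eq _ _ _ [::]) => z _; rewrite horner_b21.
  by rewrite !big_cons big_nil; horner_simp; ring.
have /monicP := monic_prod_XsubC [:: 0; u; - u; t; s] xpredT id.
by rewrite lead_coefE size_prod_XsubC.
Qed.

Let s0 : s != 0. Proof. by rewrite mulf_neq0 ?invr_neq0 ?expf_neq0. Qed.
Let us : u ^+ 2 / s = t. Proof. by rewrite /s; field; rewrite u0 t0. Qed.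

Let u2 : u != - u.
Proof. by rewrite -addr_eq0 -mulr2n mulrn_eq0. Qed.

Lemma uniq_b21_roots : uniq [:: u; - u; t; s].
Proof.
have ts : t != s.
  apply/negP => /eqP E; have : (t - u) * (t + u) = 0.
    by rewrite -subr_sqr expr2 {2}E /s mulrC divfK // subrr.
  move/eqP; rewrite mulf_eq0 subr_eq0 addr_eq0 (negbTE tu) (negbTE tnu) //.
have su : s != u.
  apply: contraNneq tu => E; apply/eqP/(mulIf s0).
  by rewrite {1}/s [LHS]mulrC divfK // E.
have snu : s != - u.
  apply: contraNneq tnu => E; apply/eqP/(mulIf s0).
  by rewrite {1}/s [LHS]mulrC divfK // E mulrNN expr2.
rewrite /= !inE !negb_or u2 ts [u == t]eq_sym [u == s]eq_sym [- u == t]eq_sym.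
by rewrite [- u == s]eq_sym tu su tnu snu.
Qed.

(* A row (phi, W / z) that the connection, twisted by the scalar function
   - e P / (z Pi), carries from z to u ^ 2 / z. *)
Definition row_mx2 (phi W : {poly C}) z : 'M[C]_2 := mx2 phi.[z] (W.[z] / z) 0 0.

Definition row_eq e (Pi : {poly C}) (b : 'M[{poly C}]_2) (phi W : {poly C}) :=
  forall z, z != 0 -> - e *: (row_mx2 phi W z *m bmat b z) =
    (z * Pi.[z]) *: row_mx2 phi W (u ^+ 2 / z).

Lemma row_eqE e Pi (b' : 'M[{poly C}]_2) phi W : row_eq e Pi b' phi W <->
  forall z, z != 0 ->
    - e * (phi.[z] * (b' 0 0).[z] + W.[z] / z * (b' 1 0).[z]) = z * Pi.[z] * phi.[u ^+ 2 / z] /\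
    - e * (phi.[z] * ((b' 0 1).[z] / z) + W.[z] / z * (b' 1 1).[z]) =
      z * Pi.[z] * (W.[u ^+ 2 / z] / (u ^+ 2 / z)).
Proof.
split=> H z z0.
  have := H z z0; rewrite /row_mx2 /bmat mul_mx2 !scale_mx2 => M.
  have := congr1 (fun A : 'M[C]_2 => A 0 0) M; have := congr1 (fun A : 'M[C]_2 => A 0 1) M.
  by rewrite !mx2E.
have [H1 H2] := H z z0.
rewrite /row_mx2 /bmat mul_mx2 !scale_mx2 H1 H2; congr (mx2 _ _ _ _); ring.
Qed.

Section OneRow.
Variables (e : C) (Pi : {poly C}) (a d : C).
Hypotheses (e0 : e != 0) (sPi : size Pi = 7%N) (mPi : Pi`_6 = 1).
Hypothesis twist : forall z, z != 0 ->
  e ^+ 2 * ((Ppol u lam).[z] * (Ppol u lam).[u ^+ 2 / z]) =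
  u ^+ 2 * (Pi.[z] * Pi.[u ^+ 2 / z]).
Hypothesis twist_u : - e * (Ppol u lam).[u] = u * Pi.[u].
Hypothesis twist_mu : - e * (Ppol u lam).[- u] = - u * Pi.[- u].

(** The row equation at infinity. The involution sends infinity to 0, whence the low coefficients a
    and W_0 on the right-hand sides. *)
Lemma row_top (W : {poly C}) : (size W <= 4)%N -> row_eq e Pi b (d *: 'X + a%:P) W ->
  - e * (d * (b 0 0)`_6 + W`_3) = a /\
  - e * u ^+ 2 * (d * (b 0 1)`_8 + W`_3 * (b 1 1)`_6) = W`_0.
Proof.
move=> sW /row_eqE H.
have [s1 s2 s3 s4] := mt_size Hb.
have sl (x y : C) : (size (x *: 'X + y%:P)%R <= 2)%N.
  rewrite (leq_trans (size_polyD _ _)) // geq_max (leq_trans (size_scale_leq _ _)) ?size_polyX //.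
  by rewrite (leq_trans (size_polyC_leq1 _)).
have cl (x y : C) : (x *: 'X + y%:P)`_1 = x.
  by rewrite coefD coefZ coefX coefC mulr1 addr0.
have [c sc bc] : exists2 c : {poly C}, (size c <= 5)%N /\ c`_4 = 1 & b 1 0 = 'X * c.
  exists (drop_poly 1 (b 1 0)).
    by rewrite coef_drop_poly coef_b21 size_drop_poly leq_subLR.
  apply: (@poly_cofinite_eq _ _ _ [::]) => z _; rewrite hornerM hornerX.
  by apply: horner_drop1; exact: mt_b21 Hb.
case: sc => sc c4.
pose Ws := zlift 0 (u ^+ 2) 3 W.
have sWs : (size Ws <= 4)%N.
  apply: (leq_trans (size_sum _ _ _)); apply/bigmax_leqP => i _.
  rewrite scale0r add0r -polyC_exp mul_polyC.
  do 2![apply: (leq_trans (size_scale_leq _ _))].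
  by rewrite size_polyXn ltnS leq_subr.
have Ws3 : Ws`_3 = W`_0.
  rewrite /Ws /zlift !big_ord_recl big_ord0 /= !coefD !coefZ !scale0r !add0r.
  by rewrite -!polyC_exp !coefCM !coefXn coef0 /=; ring.
have P1 : - e *: ((d *: 'X + a%:P) * b 0 0 + W * c) = Pi * (a *: 'X + (d * u ^+ 2)%:P).
  apply: (@poly_cofinite_eq _ _ _ [:: 0]) => z; rewrite inE => z0.
  have [+ _] := H z z0; rewrite bc; horner_simp => E.
  rewrite [LHS](_ : _ = - e * ((d * z + a) * (b 0 0).[z] + W.[z] / z * (z * c.[z])));
    last by field.
  by rewrite E; field.
have P2 : - (e * u ^+ 2) *: ((d *: 'X + a%:P) * b 0 1 + W * b 1 1) = Pi * Ws.
  apply: (@poly_cofinite_eq _ _ _ [:: 0]) => z; rewrite inE => z0.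
  have [_ +] := H z z0; rewrite (hornerM Pi Ws) horner_zlift //.
  rewrite mul0r add0r; horner_simp => E.
  rewrite [LHS](_ : _ = z * u ^+ 2 * (- e * ((d * z + a) * ((b 0 1).[z] / z)
     + W.[z] / z * (b 1 1).[z]))); last by field.
  by rewrite E; field; rewrite u0 z0.
have sPi' : (size Pi <= 7)%N by rewrite sPi.
move: (congr1 (fun p : {poly C} => p`_7) P1) (congr1 (fun p : {poly C} => p`_9) P2).
rewrite !coefZ !coefD (@coefM_topn _ 1 6 7) // (@coefM_topn _ 3 4 7) //.
rewrite (@coefM_topn _ 6 1 7) // !cl mPi c4 !mulr1 mul1r => E1.
rewrite (@coefM_topn _ 1 8 9) // (@coefM_topn _ 3 6 9) // (@coefM_topn _ 6 3 9) //.
by rewrite !cl mPi Ws3 mul1r -mulNr => E2.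
Qed.

Hypothesis at_t : - e * ((d * t + a) * (b 0 0).[t]) = t * Pi.[t] * (d * s + a).
Hypothesis ndeg : Pi.[t] != 0 \/ (b 0 0).[t] != 0.

(** From b_21(t) = 0 and the involution, b_11(s) b_11(t) = P(s) P(t), which converts the relation at
    t into the one at s after multiplication by t Pi(t). If Pi(t) = 0, then [ndeg] forces b_11(s) =
    0 and d t + a = 0, and both sides vanish. *)
Lemma at_star : - e * ((d * s + a) * (b 0 0).[s]) = s * Pi.[s] * (d * t + a).
Proof.
have := mt_inv Hb t0; rewrite -/s => /(congr1 (fun A : 'M[C]_2 => A 0 0)).
rewrite mul_mx2E /bmat !mx2E mxE /= horner_b21 subrr !(mulr0, mul0r) addr0 => I.
have T := twist t0; rewrite -/s in T.
have ts : t * s = u ^+ 2 by rewrite /s mulrC divfK.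
have [Pit|Pit] := eqVneq Pi.[t] 0; last first.
  have tP : t * Pi.[t] != 0 by rewrite mulf_neq0.
  apply: (mulfI tP).
  transitivity (e * (b 0 0).[s] * - (t * Pi.[t] * (d * s + a))); first by ring.
  rewrite -at_t.
  transitivity (e ^+ 2 * ((b 0 0).[s] * (b 0 0).[t]) * (d * t + a)); first by ring.
  have -> : (b 0 0).[s] * (b 0 0).[t] = (Ppol u lam).[t] * (Ppol u lam).[s].
    by rewrite I ?mulr1n mulrC.
  by rewrite T -ts; ring.
have b11t : (b 0 0).[t] != 0 by case: ndeg; rewrite // Pit eqxx.
have Ps : (Ppol u lam).[s] = 0.
  move/eqP: T; rewrite Pit mul0r mulr0 mulf_eq0 expf_eq0 (negbTE e0) /=.
  by rewrite mulf_eq0 (negbTE Pt) => /eqP.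
have b11s : (b 0 0).[s] = 0.
  by move/eqP: I; rewrite Ps mul0r mulf_eq0 (negbTE b11t) orbF => /eqP.
have l0 : d * t + a = 0.
  move/eqP: at_t; rewrite Pit mulr0 mul0r mulf_eq0 oppr_eq0 (negbTE e0) /=.
  by rewrite mulf_eq0 (negbTE b11t) orbF => /eqP.
by rewrite b11s l0 !mulr0.
Qed.

(** The first column determines W by division by b_21/z. The dividend vanishes at u and -u by the
    normalizations of B and of the twist, at t by [at_t] and at s by [at_star]. The second column
    follows from the first column at z and at u^2/z through the involution, wherever b_21(u^2/z) !=
    0. *)
Lemma row_exists : exists2 W : {poly C}, (size W <= 4)%N & row_eq e Pi b (d *: 'X + a%:P) W.
Proof.
have [s1 s2 s3 s4] := mt_size Hb.
have sl (x y : C) : (size (x *: 'X + y%:P)%R <= 2)%N.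
  rewrite (leq_trans (size_polyD _ _)) // geq_max (leq_trans (size_scale_leq _ _)) ?size_polyX //.
  by rewrite (leq_trans (size_polyC_leq1 _)).
(* N1 has to equal e W b_21/z; its degree is at most 7, so W has degree at most 3. *)
pose N1 := - e *: ((d *: 'X + a%:P) * b 0 0) - Pi * (a *: 'X + (d * u ^+ 2)%:P).
have sN1 : (size N1 <= 8)%N.
  rewrite (leq_trans (size_polyD _ _)) // size_polyN geq_max.
  apply/andP; split.
    by apply: (leq_trans (size_scale_leq _ _)); apply: (@size_polyM_top _ 1 6).
  by apply: (@size_polyM_top _ 6 1); rewrite ?sPi.
have N1E z : z != 0 -> N1.[z] = - e * ((d * z + a) * (b 0 0).[z])
    - z * Pi.[z] * (d * (u ^+ 2 / z) + a).
  by move=> z0; rewrite /N1; horner_simp; field.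
pose rs := [:: u; - u; t; s].
pose D := \prod_(r <- rs) ('X - r%:P).
have nu0 : - u != 0 by rewrite oppr_eq0.
have e11 v : bmat b v = ((Ppol u lam).[v])%:M -> (b 0 0).[v] = (Ppol u lam).[v].
  move=> /(congr1 (fun A : 'M[C]_2 => A 0 0)).
  by rewrite /bmat mx2E mxE.
have ru : N1.[u] = 0.
  rewrite N1E // (e11 _ (mt_one Hb)) mulrCA twist_u.
  by have -> : u ^+ 2 / u = u; [field | ring].
have rnu : N1.[- u] = 0.
  rewrite N1E // (e11 _ Hmu) mulrCA twist_mu.
  by have -> : u ^+ 2 / - u = - u; [field | ring].
have rt : N1.[t] = 0 by rewrite N1E // -/s at_t subrr.
have rs_ : N1.[s] = 0 by rewrite N1E // us at_star subrr.
have DN : D %| N1.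
  apply: uniq_roots_dvdp; last by rewrite uniq_rootsE uniq_b21_roots.
  by rewrite /= !rootE ru rnu rt rs_ eqxx.
have D0 : D != 0 by rewrite monic_neq0 // monic_prod_XsubC.
have [W eW sW] : exists2 W : {poly C}, N1 = e *: (W * D) & (size W <= 4)%N.
  exists (e^-1 *: (N1 %/ D)).
    by rewrite -scalerAl scalerA mulfV // scale1r divpK.
  rewrite (leq_trans (size_scale_leq _ _)) // size_divp // size_prod_XsubC /=.
  by rewrite leq_subLR.
exists W => //; apply/row_eqE.
have R1 z : z != 0 ->
  - e * ((d *: 'X + a%:P).[z] * (b 0 0).[z] + W.[z] / z * (b 1 0).[z]) =
    z * Pi.[z] * (d *: 'X + a%:P).[u ^+ 2 / z].
  move=> z0; have := N1E z z0; rewrite eW horner_b21 /D !big_cons big_nil.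
  horner_simp => E; apply/eqP; rewrite -subr_eq0; apply/eqP.
  transitivity (- e * ((d * z + a) * (b 0 0).[z]) - z * Pi.[z] * (d * (u ^+ 2 / z) + a)
    - e * (W.[z] * ((z - u) * (z + u) * (z - t) * (z - s)))); first by field.
  by rewrite -E; ring.
move=> z z0; split; first exact: R1.
move: z z0; apply: (@laurent_eq _ _ _ (0 :: u :: - u :: t :: [:: s])).
- apply: laurent_mul (laurent_cst _) _; apply: laurent_add; apply: laurent_mul.
  + exact: laurent_poly.
  + by apply: laurent_mul; [exact: laurent_poly | exact: laurent_inv].
  + by apply: laurent_mul; [exact: laurent_poly | exact: laurent_inv].
  + exact: laurent_poly.
- apply: laurent_mul.
    by apply: laurent_mul; [exact: laurent_id | exact: laurent_poly].
  apply: laurent_mul; first by apply: laurent_horner; exact: laurent_Vscale.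
  exact: laurent_star.
move=> z; rewrite !inE !negb_or => /and5P[z0 zu znu zt zs].
pose w := u ^+ 2 / z; have w0 : w != 0 by rewrite mulf_neq0 ?invr_neq0 ?expf_neq0.
have uw : u ^+ 2 / w = z by rewrite /w; field; rewrite u0 z0.
have bw : (b 1 0).[w] != 0.
  rewrite (b21_star nr Hb z0) mulf_neq0 //.
    by rewrite oppr_eq0 mulf_neq0 ?invr_neq0 ?expf_neq0.
  rewrite horner_b21 !mulf_neq0 // ?subr_eq0 //.
  by rewrite addr_eq0.
have A1 := R1 z z0; have A2 := R1 w w0; rewrite uw in A2.
have := mt_inv Hb w0; rewrite uw => M.
have M1 := congr1 (fun A : 'M[C]_2 => A 0 0) M.
have M2 := congr1 (fun A : 'M[C]_2 => A 1 0) M.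
move: M1 M2; rewrite !mul_mx2E /bmat !mx2E !mxE /= mulr1n mulr0n => M1 M2.
have T := twist z0; rewrite -/w in A1 T *.
move: A1 A2 M1 M2 T bw; move: (_.[z]) (_.[w]) => α α'.
move: (b 0 0).[z] (b 0 1).[z] (b 1 0).[z] (b 1 1).[z] => x1 x2 x3 x4.
move: (b 0 0).[w] (b 0 1).[w] (b 1 0).[w] (b 1 1).[w] => y1 y2 y3 y4.
move: (Ppol u lam).[z] (Ppol u lam).[w] Pi.[z] Pi.[w] W.[z] W.[w] => P P' Q Q' V V'.
move=> A1 A2 M1 M2 T bw.
have wz : w * z = u ^+ 2 by rewrite /w divfK.
move: (V / z) (V' / w) (x2 / z) A1 A2 M1 => v v' x2' A1 A2 M1.
apply: (mulIf bw); apply: (mulfI e0).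
have L : e * (- e * (α * x2' + v * x4) * y3) =
   - e ^+ 2 * α * (x1 * y1 + x2' * y3) - e ^+ 2 * v * (x3 * y1 + x4 * y3)
   - e * y1 * (- e * (α * x1 + v * x3)) by ring.
have R : e * (z * Q * v' * y3) = - (z * Q) * (- e * (α' * y1 + v' * y3) + e * α' * y1) by ring.
rewrite L R A1 A2 M1 M2.
transitivity (- α * (e ^+ 2 * (P * P')) - e * y1 * z * Q * α'); first by ring.
by rewrite T -wz; ring.
Qed.

End OneRow.
End Rows.

(** * The twisting factors of the two rows *)

Section Twists.
Variable C : numClosedFieldType.
Variables u q : C.
Hypotheses (u0 : u != 0).
Variable lam : param C.
Hypothesis zn0 : forall k, param_coords lam k != 0.
Implicit Types (z : C).

(* The first entries of the invariant rows are g - z for the index g and f z - 1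
   for the index f. *)
Definition e_g : C := z6 lam.
Definition e_f : C := z2 lam * z4 lam * z6 lam / u ^+ 2.

(** Pi is P with z - u^2/z_i replaced by z - z_i, for i = 6 in index g and for i = 2, 4, 6 in index
    f. The constant e is normalized so that - e P / (z Pi) equals 1 at u and at -u. *)
Definition Pi_g : {poly C} := \prod_(r <- [:: z1 lam; z3 lam; z5 lam; u ^+ 2 / z2 lam;
  u ^+ 2 / z4 lam; z6 lam]) ('X - r%:P).
Definition Pi_f : {poly C} := \prod_(r <- [:: z1 lam; z3 lam; z5 lam; z2 lam;
  z4 lam; z6 lam]) ('X - r%:P).
Definition Pi4 : {poly C} := \prod_(r <- [:: z1 lam; z3 lam; z5 lam; z6 lam]) ('X - r%:P).

Lemma horner_Pi_g z : Pi_g.[z] = (z - z1 lam) * (z - z3 lam) * (z - z5 lam) *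
  (z - u ^+ 2 / z2 lam) * (z - u ^+ 2 / z4 lam) * (z - z6 lam).
Proof. by rewrite /Pi_g !big_cons big_nil; horner_simp; ring. Qed.

Lemma horner_Pi_f z : Pi_f.[z] = (z - z1 lam) * (z - z3 lam) * (z - z5 lam) *
  (z - z2 lam) * (z - z4 lam) * (z - z6 lam).
Proof. by rewrite /Pi_f !big_cons big_nil; horner_simp; ring. Qed.

Lemma horner_Pi4 z : Pi4.[z] = (z - z1 lam) * (z - z3 lam) * (z - z5 lam) * (z - z6 lam).
Proof. by rewrite /Pi4 !big_cons big_nil; horner_simp; ring. Qed.

Lemma coef_prod_XsubC (s : seq C) : (\prod_(r <- s) ('X - r%:P))`_(size s) = 1.
Proof.
have /monicP := monic_prod_XsubC s xpredT id.
by rewrite lead_coefE size_prod_XsubC.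
Qed.

Lemma Pi_g_monic : size Pi_g = 7%N /\ Pi_g`_6 = 1.
Proof. by rewrite size_prod_XsubC (coef_prod_XsubC [:: _; _; _; _; _; _]). Qed.

Lemma Pi_f_monic : size Pi_f = 7%N /\ Pi_f`_6 = 1.
Proof. by rewrite size_prod_XsubC (coef_prod_XsubC [:: _; _; _; _; _; _]). Qed.

Lemma e_g_neq0 : e_g != 0.
Proof. by have [_ []] := coords_neq0 zn0. Qed.

Lemma e_f_neq0 : e_f != 0.
Proof.
have [[_ ? _ ?] [_ ? _ _]] := coords_neq0 zn0.
by rewrite !mulf_neq0 ?invr_neq0 ?expf_neq0.
Qed.

Lemma flip_factor z r : z != 0 -> r != 0 ->
  r ^+ 2 * ((z - u ^+ 2 / r) * (u ^+ 2 / z - u ^+ 2 / r)) =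
  u ^+ 2 * ((z - r) * (u ^+ 2 / z - r)).
Proof. by move=> z0 r0; field; rewrite r0 z0. Qed.

Lemma flip_fixed v r : v ^+ 2 = u ^+ 2 -> r != 0 -> - r * (v - u ^+ 2 / r) = v * (v - r).
Proof. by move=> vu r0; rewrite -vu; field. Qed.

Lemma twist_g z : z != 0 ->
  e_g ^+ 2 * ((Ppol u lam).[z] * (Ppol u lam).[u ^+ 2 / z]) =
  u ^+ 2 * (Pi_g.[z] * Pi_g.[u ^+ 2 / z]).
Proof.
move=> z0; have [_ [_ z60 _ _]] := coords_neq0 zn0.
have := flip_factor z0 z60; rewrite !horner_Ppol !horner_Pi_g /e_g => E.
set w := u ^+ 2 / z in E *; move: (u ^+ 2 / z2 lam) (u ^+ 2 / z4 lam) => s2 s4.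
transitivity (z6 lam ^+ 2 * ((z - u ^+ 2 / z6 lam) * (w - u ^+ 2 / z6 lam)) *
  ((z - z1 lam) * (z - z3 lam) * (z - z5 lam) * (z - s2) * (z - s4)
  * ((w - z1 lam) * (w - z3 lam) * (w - z5 lam) * (w - s2) * (w - s4)))); first by ring.
by rewrite E; ring.
Qed.

Lemma twist_g_fixed v : v ^+ 2 = u ^+ 2 -> - e_g * (Ppol u lam).[v] = v * Pi_g.[v].
Proof.
move=> vu; have [_ [_ z60 _ _]] := coords_neq0 zn0.
have := flip_fixed vu z60; rewrite horner_Ppol horner_Pi_g /e_g => E.
move: (u ^+ 2 / z2 lam) (u ^+ 2 / z4 lam) => s2 s4.
transitivity (- z6 lam * (v - u ^+ 2 / z6 lam) *
  ((v - z1 lam) * (v - z3 lam) * (v - z5 lam) * (v - s2) * (v - s4))); first by ring.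
by rewrite E; ring.
Qed.

Lemma twist_f z : z != 0 ->
  e_f ^+ 2 * ((Ppol u lam).[z] * (Ppol u lam).[u ^+ 2 / z]) =
  u ^+ 2 * (Pi_f.[z] * Pi_f.[u ^+ 2 / z]).
Proof.
move=> z0; have [[_ z20 _ z40] [_ z60 _ _]] := coords_neq0 zn0.
have := flip_factor z0 z60; have := flip_factor z0 z40; have := flip_factor z0 z20.
rewrite !horner_Ppol !horner_Pi_f /e_f.
move: (u ^+ 2 / z) => w E2 E4 E6.
transitivity (u ^+ 2 ^- 2 *
   (z2 lam ^+ 2 * ((z - u ^+ 2 / z2 lam) * (w - u ^+ 2 / z2 lam))) *
   (z4 lam ^+ 2 * ((z - u ^+ 2 / z4 lam) * (w - u ^+ 2 / z4 lam))) *
   (z6 lam ^+ 2 * ((z - u ^+ 2 / z6 lam) * (w - u ^+ 2 / z6 lam))) *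
  ((z - z1 lam) * (z - z3 lam) * (z - z5 lam)
  * ((w - z1 lam) * (w - z3 lam) * (w - z5 lam)))).
  move: (u ^+ 2 / z2 lam) (u ^+ 2 / z4 lam) (u ^+ 2 / z6 lam) => s2 s4 s6.
  by field.
by rewrite E2 E4 E6; field.
Qed.

Lemma twist_f_fixed v : v ^+ 2 = u ^+ 2 -> - e_f * (Ppol u lam).[v] = v * Pi_f.[v].
Proof.
move=> vu; have [[_ z20 _ z40] [_ z60 _ _]] := coords_neq0 zn0.
have := flip_fixed vu z60; have := flip_fixed vu z40; have := flip_fixed vu z20.
rewrite horner_Ppol horner_Pi_f /e_f => E2 E4 E6.
transitivity (u ^- 2 * (- z2 lam * (v - u ^+ 2 / z2 lam)) * (- z4 lam * (v - u ^+ 2 / z4 lam))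
  * (- z6 lam * (v - u ^+ 2 / z6 lam)) *
  ((v - z1 lam) * (v - z3 lam) * (v - z5 lam))); first by ring.
have v0 : v != 0 by apply: contraTneq (expf_neq0 2 u0) => E; rewrite -vu E expr0n eqxx.
by rewrite E2 E4 E6 -vu; field.
Qed.

End Twists.

(** * The determinant of the two rows *)

Section Delta.
Variable C : numClosedFieldType.
Variables u q : C.
Hypotheses (u0 : u != 0) (q0 : q != 0) (q1 : forall k, (0 < k)%N -> q ^+ k != 1).
Variable lam : param C.
Hypothesis nr : nonresonant u q lam.
Variables (b : 'M[{poly C}]_2) (t : C).
Hypothesis Hb : matrix_type u q lam b.
Hypothesis b21E : b 1 0 = 'X * ('X^2 - (u ^+ 2)%:P) * ('X - t%:P) * ('X - (u ^+ 2 / t)%:P).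
Implicit Types (z : C) (V W : {poly C}).
Let zn0 := nr_coords nr.

(** Stack the two rows into a 2 x 2 matrix: the determinant of the product with B is the product of
    the determinants, and the row equations evaluate it. *)
Lemma two_rows (ef eg : C) (Pf Pg psi V phi W : {poly C}) z : z != 0 ->
  row_eq u ef Pf b psi V -> row_eq u eg Pg b phi W ->
  let D x := psi.[x] * W.[x] - phi.[x] * V.[x] in
  ef * eg * u ^+ 2 * ((Ppol u lam).[z] * (Qpol u lam).[z]) * D z =
  z ^+ 4 * (Pf.[z] * Pg.[z]) * D (u ^+ 2 / z).
Proof.
move=> z0 /row_eqE /(_ z z0) [F1 F2] /row_eqE /(_ z z0) [G1 G2] D.
rewrite -(mt_det Hb z0) bmat_det /D; set w := u ^+ 2 / z in F1 F2 G1 G2 *.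
have w0 : w != 0 by rewrite mulf_neq0 ?invr_neq0 ?expf_neq0.
have wz : w * z = u ^+ 2 by rewrite /w divfK.
have : ef * eg * (psi.[z] * (W.[z] / z) - phi.[z] * (V.[z] / z)) *
   ((b 0 0).[z] * (b 1 1).[z] - (b 0 1).[z] / z * (b 1 0).[z]) =
   (z * Pf.[z]) * (z * Pg.[z]) * (psi.[w] * (W.[w] / w) - phi.[w] * (V.[w] / w)).
  transitivity ((- ef * (psi.[z] * (b 0 0).[z] + V.[z] / z * (b 1 0).[z])) *
    (- eg * (phi.[z] * ((b 0 1).[z] / z) + W.[z] / z * (b 1 1).[z])) -
    (- ef * (psi.[z] * ((b 0 1).[z] / z) + V.[z] / z * (b 1 1).[z])) *
    (- eg * (phi.[z] * (b 0 0).[z] + W.[z] / z * (b 1 0).[z]))); first by ring.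
  by rewrite F1 F2 G1 G2; ring.
set dB := _ - _ / z * _; move: dB => dB E.
transitivity (u ^+ 2 * z * (ef * eg * (psi.[z] * (W.[z] / z) - phi.[z] * (V.[z] / z)) * dB)).
  by field.
by rewrite E -wz; field; rewrite w0.
Qed.

Section WithRows.
Variables (f g : C) (V W : {poly C}).
Hypotheses (sV : (size V <= 4)%N) (sW : (size W <= 4)%N).
Hypothesis rf : row_eq u (e_f u lam) (Pi_f lam) b (f *: 'X + (- 1)%:P) V.
Hypothesis rg : row_eq u (e_g lam) (Pi_g u lam) b (- 1 *: 'X + g%:P) W.

Definition delta : {poly C} := (f *: 'X + (- 1)%:P) * W - (- 1 *: 'X + g%:P) * V.

Definition Pi4_star z := (z - u ^+ 2 / z1 lam) * (z - u ^+ 2 / z3 lam)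
   * (z - u ^+ 2 / z5 lam) * (z - u ^+ 2 / z6 lam).

Lemma horner_delta z : delta.[z] = (f * z - 1) * W.[z] - (g - z) * V.[z].
Proof. by rewrite /delta; horner_simp; ring. Qed.

Lemma delta_star z : z != 0 ->
  e_f u lam * e_g lam * u ^+ 2 * PQ_lead lam * Pi4_star z * delta.[z] =
  z ^+ 4 * delta.[u ^+ 2 / z] * (Pi4 lam).[z].
Proof.
move: z; apply: (@laurent_eq _ _ _ (0 :: all_roots u lam)).
- apply: laurent_mul; last exact: laurent_poly.
  apply: laurent_mul; first exact: laurent_cst.
  have li a : laurent (fun z : C => z - a).
    by apply: laurent_add; [exact: laurent_id | exact: laurent_cst].
  by apply: laurent_mul; [apply: laurent_mul; [apply: laurent_mul|]|].
- apply: laurent_mul; last exact: laurent_poly.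
  apply: laurent_mul; last by apply: laurent_horner; exact: laurent_Vscale.
  by apply: (laurent_ext _ (laurent_poly 'X^4)) => z _; rewrite hornerXn.
move=> z; rewrite inE negb_or => /andP[z0 zr].
have := two_rows z0 rf rg => /=.
have D x : (f *: 'X + (- 1)%:P).[x] * W.[x] - (- 1 *: 'X + g%:P).[x] * V.[x] = delta.[x].
  by rewrite /delta; horner_simp.
rewrite !D => E.
pose com := (z - z2 lam) * (z - z4 lam) * (z - u ^+ 2 / z2 lam) * (z - u ^+ 2 / z4 lam).
have nz r : r \in all_roots u lam -> z - r != 0.
  by move=> rr; rewrite subr_eq0; apply: contraNneq zr => ->.
have c0 : com * (Pi4 lam).[z] != 0.
  by rewrite horner_Pi4 /com !mulf_neq0 // nz // all_rootsE !inE eqxx ?orbT.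
apply: (mulIf c0); move: E.
rewrite horner_Ppol horner_Qpol horner_Pi_f horner_Pi_g horner_Pi4 /com /Pi4_star /PQ_lead.
move: (_ / (z2 lam * z4 lam * z6 lam)) => K.
move: (u ^+ 2 / z1 lam) (u ^+ 2 / z3 lam) (u ^+ 2 / z5 lam) => s1 s3 s5.
move: (u ^+ 2 / z2 lam) (u ^+ 2 / z4 lam) (u ^+ 2 / z6 lam) => s2 s4 s6.
move: (e_f u lam * e_g lam * u ^+ 2) (z ^+ 4) delta.[z] delta.[u ^+ 2 / z] => e y d d' E.
transitivity (e * ((z - z1 lam) * (z - s2) * (z - z3 lam) * (z - s4) * (z - z5 lam) * (z - s6) *
    (K * ((z - s1) * (z - z2 lam) * (z - s3) * (z - z4 lam) * (z - s5) * (z - z6 lam)))) * d).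
  by ring.
by rewrite E; ring.
Qed.

(** At a zero of [Pi4] the symmetry [delta_star] forces delta = 0, because [Pi4_star] is nonzero
    there by nonresonance. The degree being at most 4, a constant is left; it is read off at
    infinity by [row_top], where the leading coefficient of b_11 cancels. *)
Lemma deltaE : delta = (- (f * g - u ^+ 2 / (z2 lam * z4 lam)) / z6 lam) *: Pi4 lam.
Proof.
have [[z10 z20 z30 z40] [z50 z60 _ _]] := coords_neq0 zn0.
have sl (x y : C) : (size (x *: 'X + y%:P)%R <= 2)%N.
  rewrite (leq_trans (size_polyD _ _)) // geq_max (leq_trans (size_scale_leq _ _)) ?size_polyX //.
  by rewrite (leq_trans (size_polyC_leq1 _)).
have cl (x y : C) : (x *: 'X + y%:P)`_1 = x.
  by rewrite coefD coefZ coefX coefC mulr1 addr0.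
have sD : (size delta <= 5)%N.
  rewrite (leq_trans (size_polyD _ _)) // size_polyN geq_max.
  by apply/andP; split; apply: (@size_polyM_top _ 1 3).
have root_i i : zcoord lam i \in [:: z1 lam; z3 lam; z5 lam; z6 lam] ->
    root delta (zcoord lam i).
  move=> ii; have zi0 := zcoord_neq0 i zn0; have := delta_star zi0.
  have -> : (Pi4 lam).[zcoord lam i] = 0.
    by apply/rootP; rewrite root_prod_XsubC.
  have c0 : e_f u lam * e_g lam * u ^+ 2 * PQ_lead lam != 0.
    have K0 : PQ_lead lam != 0 by rewrite mulf_neq0 ?invr_neq0 // !mulf_neq0.
    rewrite mulf_neq0 // mulf_neq0 ?expf_neq0 // mulf_neq0 //.
    exact: e_f_neq0.
  have p0 : Pi4_star (zcoord lam i) != 0.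
    by rewrite /Pi4_star !mulf_neq0 // subr_eq0; [exact: (nr_star nr i (@Ordinal 6 0 isT))
     | exact: (nr_star nr i (@Ordinal 6 2 isT)) | exact: (nr_star nr i (@Ordinal 6 4 isT))
     | exact: (nr_star nr i (@Ordinal 6 5 isT))].
  by move=> E; apply/rootP; apply: (mulfI (mulf_neq0 c0 p0)); rewrite E !mulr0.
have dv : Pi4 lam %| delta.
  apply: uniq_roots_dvdp.
    rewrite /= (root_i (@Ordinal 6 0 isT)) ?inE ?eqxx // (root_i (@Ordinal 6 2 isT)) ?inE ?eqxx ?orbT //.
    rewrite (root_i (@Ordinal 6 4 isT)) ?inE ?eqxx ?orbT //.
    by rewrite (root_i (@Ordinal 6 5 isT)) ?inE ?eqxx ?orbT.
  rewrite uniq_rootsE.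
  have -> : [:: z1 lam; z3 lam; z5 lam; z6 lam] = map (zcoord lam)
     [:: @Ordinal 6 0 isT; @Ordinal 6 2 isT; @Ordinal 6 4 isT; @Ordinal 6 5 isT] by [].
  rewrite map_inj_uniq // => i j /eqP; have [//|ij] := eqVneq i j.
  by rewrite (negbTE (nr_neq nr ij)).
have s4 : size (Pi4 lam) = 5%N by rewrite size_prod_XsubC.
have c4 : (Pi4 lam)`_4 = 1 by rewrite (coef_prod_XsubC [:: _; _; _; _]).
have [c Dc] : exists c, delta = c *: Pi4 lam.
  have : (size (delta %/ Pi4 lam)%R <= 1)%N.
    rewrite size_divp ?leq_subLR; last by rewrite -size_poly_eq0 s4.
    by rewrite s4.
  by move=> /size1_polyC E; exists (delta %/ Pi4 lam)`_0; rewrite -mul_polyC -E divpK.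
have d4 : delta`_4 = f * W`_3 + V`_3.
  rewrite coefB (@coefM_topn _ 1 3 4) // (@coefM_topn _ 1 3 4) // !cl.
  by rewrite mulN1r opprK.
have Ec : c = f * W`_3 + V`_3 by rewrite -d4 Dc coefZ c4 mulr1.
rewrite Dc Ec; congr (_ *: _).
have [sf mf] := Pi_f_monic lam; have [sg mg] := Pi_g_monic u lam.
have [tf _] := row_top u0 Hb b21E sf mf sV rf.
have [tg _] := row_top u0 Hb b21E sg mg sW rg.
move: tf tg; rewrite /e_f /e_g; move: (b 0 0)`_6 W`_3 V`_3 => a w v tf tg.
have -> : w = a - g / z6 lam by rewrite -tg; field.
have -> : v = u ^+ 2 / (z2 lam * z4 lam * z6 lam) - f * a.
  apply: (mulfI (e_f_neq0 u0 zn0)); rewrite /e_f.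
  apply: (addrI (z2 lam * z4 lam * z6 lam / u ^+ 2 * (f * a))); rewrite -mulrDr.
  apply: oppr_inj; rewrite -mulNr tf; by field; rewrite u0 z20 z40 z60.
by field; rewrite z20 z40 z60.
Qed.

End WithRows.
End Delta.

(** * Transport of a row along the modification *)

Section Transport.
Variable C : numClosedFieldType.
Variables u q : C.
Hypotheses (u0 : u != 0) (q0 : q != 0) (q1 : forall k, (0 < k)%N -> q ^+ k != 1).
Variable lam : param C.
Hypothesis nr : nonresonant u q lam.
Let lamb := lambda_bar q lam.
Variables (b bb R : 'M[{poly C}]_2) (kappa : C).
Hypothesis Hb : matrix_type u q lam b.
Hypothesis sR : [/\ (size (R 0%R 0%R) <= 2)%N, (size (R 0%R 1%R) <= 3)%N,
  (size (R 1%R 0%R) <= 1)%N & (size (R 1%R 1%R) <= 2)%N].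
Hypothesis kappa0 : kappa != 0.
Hypothesis detR : forall x, \det (evmx R x) = kappa * dsig u q lam x.
Hypothesis rel : forall z, z != 0 ->
  (Ppol u lamb).[z] *: (evmx R (sigma u q (z / q)) *m bmat b z) =
  (Ppol u lam).[z] *: (bmat bb z *m evmx R (sigma u q z)).
Variables (g : C) (W : {poly C}).
Hypothesis sW : (size W <= 4)%N.
Hypothesis rg : row_eq u (e_g lam) (Pi_g u lam) b (- 1 *: 'X + g%:P) W.
Implicit Types (z : C).
Let zn0 := nr_coords nr.
Let phi : {poly C} := - 1 *: 'X + g%:P.

Let r11 := zlift q^-1 (u ^+ 2) 1 (R 0 0).
Let r12 := zlift q^-1 (u ^+ 2) 2 (R 0 1).
Let r22 := zlift q^-1 (u ^+ 2) 1 (R 1 1).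
Let r21 := (R 1 0)`_0.

(* z phi adj(R)(sigma(z / q)); divided by [Sq] it is the invariant row of index f of
   the modified connection. *)
Definition psi1 : {poly C} := phi * r22 - r21 *: W.
Definition psi2 : {poly C} := r11 * W - phi * r12.

Lemma R10E x : (R 1 0).[x] = r21.
Proof. by have [_ _ s3 _] := sR; rewrite [in LHS](size1_polyC s3) hornerC. Qed.

Lemma r11E z : z != 0 -> r11.[z] = z * (R 0 0).[sigma u q (z / q)].
Proof. by have [s1 _ _ _] := sR; move=> z0; rewrite horner_zlift // -sigmaq_lift. Qed.
Lemma r22E z : z != 0 -> r22.[z] = z * (R 1 1).[sigma u q (z / q)].
Proof. by have [_ _ _ s4] := sR; move=> z0; rewrite horner_zlift // -sigmaq_lift. Qed.
Lemma r12E z : z != 0 -> r12.[z] = z ^+ 2 * (R 0 1).[sigma u q (z / q)].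
Proof. by have [_ s2 _ _] := sR; move=> z0; rewrite horner_zlift // -sigmaq_lift. Qed.

Lemma row_adj z : z != 0 ->
  row_mx2 phi W z *m adj2 (evmx R (sigma u q (z / q))) =
  mx2 (psi1.[z] / z) (psi2.[z] / z ^+ 2) 0 0.
Proof.
move=> z0; have p1 : psi1.[z] = phi.[z] * r22.[z] - r21 * W.[z] by rewrite /psi1; horner_simp.
have p2 : psi2.[z] = r11.[z] * W.[z] - phi.[z] * r12.[z] by rewrite /psi2; horner_simp.
rewrite p1 p2 r22E // r11E // r12E // evmxE R10E /row_mx2 /adj2 !mx2E mul_mx2.
by congr (mx2 _ _ _ _); field.
Qed.

Lemma null_rows (a1 a2 c1 c2 x y : C) : a1 * x + a2 * y = 0 -> c1 * x + c2 * y = 0 ->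
  (x != 0) || (y != 0) -> a1 * c2 - a2 * c1 = 0.
Proof.
move=> A K /orP[n|n]; apply: (mulfI n); rewrite mulr0.
  transitivity (c2 * (a1 * x + a2 * y) - a2 * (c1 * x + c2 * y)); first by ring.
  by rewrite A K !mulr0 subr0.
transitivity (a1 * (c1 * x + c2 * y) - c1 * (a1 * x + a2 * y)); first by ring.
by rewrite A K !mulr0 subr0.
Qed.

(** At such a point a nonzero column of B(s) is annihilated by the row and by both rows of
    R(sigma(s/q)). So the row is proportional to each of them, and the minors forming [psi1] and
    [psi2] vanish. *)
Lemma psi_roots s : s \in all_roots u lam -> (Ppol u lam).[s] = 0 ->
  (Pi_g u lam).[s] = 0 -> (Ppol u lamb).[s] != 0 -> psi1.[s] = 0 /\ psi2.[s] = 0.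
Proof.
move=> sr Ps Gs Pbs; have s0 := all_roots_neq0 u0 nr sr.
have := rel s0; rewrite Ps scale0r => /eqP; rewrite scaler_eq0 (negbTE Pbs) /= => /eqP RB.
have := rg s0; rewrite Gs mulr0 scale0r => /eqP.
rewrite scaler_eq0 oppr_eq0 (negbTE (e_g_neq0 zn0)) /= => /eqP FB.
have B0 := bmat_neq0 u0 nr Hb sr.
have [j nj] : exists j, (bmat b s 0 j != 0) || (bmat b s 1 j != 0).
  apply: contrapT => H; move/eqP: B0; apply; apply/matrixP => i j; rewrite [RHS]mxE.
  apply/eqP/negPn/negP => N; apply: H; exists j; move: N.
  by move: i; apply: ord2P => ->; rewrite ?orbT.
have f1 := congr1 (fun A : 'M[C]_2 => A 0 j) FB.
have f2 := congr1 (fun A : 'M[C]_2 => A 0 j) RB.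
have f3 := congr1 (fun A : 'M[C]_2 => A 1 j) RB.
have z0j i : (0 : 'M[C]_2) i j = 0 by rewrite mxE.
move: f1 f2 f3; rewrite !mul_mx2E !z0j; move: (bmat b s 0 j) (bmat b s 1 j) nj => x y nj.
rewrite /row_mx2 !mx2E evmxE !mx2E R10E => f1 f2 f3.
have n1 := null_rows f1 f3 nj; have n2 := null_rows f1 f2 nj.
have p1 : psi1.[s] = phi.[s] * r22.[s] - r21 * W.[s] by rewrite /psi1; horner_simp.
have p2 : psi2.[s] = r11.[s] * W.[s] - phi.[s] * r12.[s] by rewrite /psi2; horner_simp.
rewrite p1 p2 r22E // r11E // r12E //; split.
  transitivity (s * (phi.[s] * (R 1 1).[sigma u q (s / q)] - W.[s] / s * r21)); first by field.
  by rewrite n1 mulr0.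
transitivity (- s ^+ 2 * (phi.[s] * (R 0 1).[sigma u q (s / q)]
  - W.[s] / s * (R 0 0).[sigma u q (s / q)])); first by field.
by rewrite n2 mulr0.
Qed.

Let s2 := u ^+ 2 / z2 lam.
Let s4 := u ^+ 2 / z4 lam.
Definition Sq : {poly C} := \prod_(r <- [:: s2; s4]) ('X - r%:P).

Lemma horner_Sq z : Sq.[z] = (z - s2) * (z - s4).
Proof. by rewrite /Sq !big_cons big_nil; horner_simp; ring. Qed.

Lemma Pbar_star_neq0 : (Ppol u lamb).[s2] != 0 /\ (Ppol u lamb).[s4] != 0.
Proof.
have [[z10 z20 z30 z40] [z50 z60 _ _]] := coords_neq0 zn0.
pose o0 : 'I_6 := @Ordinal 6 0 isT; pose o1 : 'I_6 := @Ordinal 6 1 isT.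
pose o2 : 'I_6 := @Ordinal 6 2 isT; pose o3 : 'I_6 := @Ordinal 6 3 isT.
pose o4 : 'I_6 := @Ordinal 6 4 isT; pose o5 : 'I_6 := @Ordinal 6 5 isT.
have nq x : x != 0 -> u ^+ 2 / x != u ^+ 2 / (q * x).
  move=> x0; apply: contraNneq (q1 (ltnSn 0)) => E; rewrite expr1.
  have := congr1 (fun y => y * (q * x) / u ^+ 2) E => /= E'.
  by apply/eqP; transitivity (u ^+ 2 / x * (q * x) / u ^+ 2);
    [field; rewrite u0 x0 | rewrite E'; field; rewrite u0 q0 x0].
have nq2 x y : x != 0 -> y != 0 -> y != q ^ (-1) * x -> u ^+ 2 / x != u ^+ 2 / (q * y).
  move=> x0 y0; apply: contraNneq => E; rewrite exprN1.
  have E' : q * y = x.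
    transitivity (u ^+ 2 / (u ^+ 2 / (q * y))); first by field; rewrite u0 y0 q0.
    by rewrite -E; field; rewrite u0 x0.
  by rewrite -E' mulKf.
split; rewrite horner_Ppol /= !mulf_neq0 // subr_eq0 /s2 /s4.
- by rewrite eq_sym; exact: (nr_star nr o0 o1).
- exact: nq.
- by rewrite eq_sym; exact: (nr_star nr o2 o1).
- by apply: nq2 => //; exact: (nr_ratio nr (-1) (isT : o3 != o1)).
- by rewrite eq_sym; exact: (nr_star nr o4 o1).
- exact: (nr_star2 u0 nr (isT : o1 != o5)).
- by rewrite eq_sym; exact: (nr_star nr o0 o3).
- by apply: nq2 => //; exact: (nr_ratio nr (-1) (isT : o1 != o3)).
- by rewrite eq_sym; exact: (nr_star nr o2 o3).
- exact: nq.
- by rewrite eq_sym; exact: (nr_star nr o4 o3).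
- exact: (nr_star2 u0 nr (isT : o3 != o5)).
Qed.

Lemma Sq_dvd : Sq %| psi1 /\ Sq %| psi2.
Proof.
have [P2 P4] := Pbar_star_neq0.
have [p2 p4] := P_z2star u lam.
have r2 : s2 \in all_roots u lam by rewrite all_rootsE !inE eqxx !orbT.
have r4 : s4 \in all_roots u lam by rewrite all_rootsE !inE eqxx !orbT.
have g2 : (Pi_g u lam).[s2] = 0 by rewrite horner_Pi_g subrr !(mulr0, mul0r).
have g4 : (Pi_g u lam).[s4] = 0 by rewrite horner_Pi_g subrr !(mulr0, mul0r).
have [a2 c2] := psi_roots r2 p2 g2 P2; have [a4 c4] := psi_roots r4 p4 g4 P4.
have U : uniq_roots [:: s2; s4].
  rewrite uniq_rootsE /= inE andbT.
  exact: (nr_star2 u0 nr (isT : (@Ordinal 6 1 isT) != (@Ordinal 6 3 isT))).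
by split; apply: uniq_roots_dvdp => //; rewrite /= !rootE ?a2 ?a4 ?c2 ?c4 eqxx.
Qed.

Definition L1 := psi1 %/ Sq.
Definition V0 := psi2 %/ Sq.

Lemma L1E : psi1 = L1 * Sq.
Proof. by rewrite /L1 divpK //; have [] := Sq_dvd. Qed.
Lemma V0E : psi2 = V0 * Sq.
Proof. by rewrite /V0 divpK //; have [] := Sq_dvd. Qed.

Lemma Sq_size : size Sq = 3%N.
Proof. by rewrite size_prod_XsubC. Qed.

Lemma size_phi : (size phi <= 2)%N.
Proof.
rewrite (leq_trans (size_polyD _ _)) // geq_max (leq_trans (size_scale_leq _ _)) ?size_polyX //.
by rewrite (leq_trans (size_polyC_leq1 _)).
Qed.

Lemma size_psi1 : (size psi1 <= 4)%N.
Proof.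
rewrite (leq_trans (size_polyD _ _)) // size_polyN geq_max; apply/andP; split.
  by apply: (@size_polyM_top _ 1 2); [exact: size_phi | exact: (size_zlift _ _ 1)].
by rewrite (leq_trans (size_scale_leq _ _)).
Qed.

Lemma size_psi2 : (size psi2 <= 6)%N.
Proof.
rewrite (leq_trans (size_polyD _ _)) // size_polyN geq_max; apply/andP; split.
  by apply: (@size_polyM_top _ 2 3); [exact: (size_zlift _ _ 1) | exact: sW].
by apply: (@size_polyM_top _ 1 4); [exact: size_phi | exact: (size_zlift _ _ 2)].
Qed.

Lemma size_L1 : (size L1 <= 2)%N.
Proof.
rewrite size_divp -?size_poly_eq0 Sq_size // leq_subLR.
exact: size_psi1.
Qed.

Lemma size_V0 : (size V0 <= 4)%N.
Proof.
rewrite size_divp -?size_poly_eq0 Sq_size // leq_subLR.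
exact: size_psi2.
Qed.

Lemma row_transport z : z != 0 -> Sq.[z] != 0 ->
  row_mx2 L1 V0 z = (z / Sq.[z]) *: (row_mx2 phi W z *m adj2 (evmx R (sigma u q (z / q)))).
Proof.
move=> z0 S0; rewrite row_adj // /row_mx2 scale_mx2 L1E V0E !hornerM.
by congr (mx2 _ _ _ _); field; rewrite ?S0 ?z0.
Qed.

Lemma laurent_row (p r : {poly C}) f : laurent f -> laurent (fun z => (f z)^-1) ->
  laurent_mx (fun z => row_mx2 p r (f z)).
Proof.
move=> Hf Hf'; apply: laurent_mx2; do ?exact: laurent_cst.
  exact: laurent_horner.
by apply: laurent_mul => //; exact: laurent_horner.
Qed.

(** The relations for R and for the row combine, the scalar changing by values of det R. Through
    sigma(z/q) these trade the zeros u^2/z2, u^2/z4 of [Pi_g] for q z2, q z4, which yields [Pi_f] at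
    the shifted parameters. *)
Lemma row_eq_transport : row_eq u (e_f u lamb) (Pi_f lamb) bb L1 V0.
Proof.
have [[z10 z20 z30 z40] [z50 z60 _ _]] := coords_neq0 zn0.
have ds0 : (('X - (sigma u q (z2 lam))%:P) * ('X - (sigma u q (z4 lam))%:P) : {poly C}) != 0.
  by rewrite mulf_neq0 ?polyXsubC_eq0.
have [s Hs] := sigma_nonroots u0 q0 ds0.
apply: (@laurent_mx_eq _ _ _ (good_points u lam ++ D4_points u lam ++ s)).
- apply: laurent_scalemx; first exact: laurent_cst.
  apply: laurent_mulmx; first exact: laurent_row (laurent_id _) (laurent_inv _).
  by apply: laurent_bmat; [exact: laurent_id | exact: laurent_inv].
- apply: laurent_scalemx; first by apply: laurent_mul; [exact: laurent_id | exact: laurent_poly].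
  by apply: laurent_row; [exact: laurent_Vscale | exact: laurent_star].
move=> z; rewrite 2!mem_cat 2!negb_or => /and3P[h1 h2 h3].
have [z0 P0 _] := good_pointsP zn0 h1; have [_ D0] := D4_pointsP h2.
have [_ d1 _] := Hs _ h3.
have dd : dsig u q lam (sigma u q z) != 0 by move: d1; rewrite /dsig; horner_simp.
pose w := u ^+ 2 / z; have w0 : w != 0 by rewrite mulf_neq0 ?invr_neq0 ?expf_neq0.
have [/and4P[n1 n2 n3 n4]] : [&& z - z2 lam != 0, z - z4 lam != 0, z - s2 != 0 & z - s4 != 0].
  move: h2; rewrite /D4_points !inE !negb_or => /and5P[_ e1 e2 e3 e4].
  by rewrite !subr_eq0 e1 e2 e3 e4.
have ws2 : w - s2 = - (u ^+ 2 / (z2 lam * z)) * (z - z2 lam).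
  by rewrite /w /s2; field; rewrite z0 z20.
have ws4 : w - s4 = - (u ^+ 2 / (z4 lam * z)) * (z - z4 lam).
  by rewrite /w /s4; field; rewrite z0 z40.
have Sz : Sq.[z] != 0 by rewrite horner_Sq mulf_neq0.
have Sw : Sq.[w] != 0.
  by rewrite horner_Sq ws2 ws4 !mulf_neq0 // ?oppr_eq0 ?mulf_neq0 ?invr_neq0 ?expf_neq0 ?mulf_neq0.
have sgw : sigma u q (w / q) = sigma u q z by rewrite /w sigma_star.
have RU : evmx R (sigma u q z) \in unitmx.
  by rewrite unitmxE unitfE detR mulf_neq0.
rewrite (row_transport z0 Sz) -/w (row_transport w0 Sw) sgw.
apply: (can_inj (mulmxK RU)); apply: (can_inj (scalerK P0)).
have rz := rel z0; have gz := rg z0; rewrite -/w in gz.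
have EL : (Ppol u lam).[z] *: (- e_f u lamb *:
   ((z / Sq.[z]) *: (row_mx2 phi W z *m adj2 (evmx R (sigma u q (z / q)))) *m bmat bb z)
    *m evmx R (sigma u q z)) =
   (- e_f u lamb * (z / Sq.[z])) *: (row_mx2 phi W z *m adj2 (evmx R (sigma u q (z / q)))
     *m ((Ppol u lam).[z] *: (bmat bb z *m evmx R (sigma u q z)))).
  rewrite -!scalemxAl -!scalemxAr !scalerA !mulmxA; congr (_ *: _); ring.
rewrite EL -rz -scalemxAr !mulmxA -(mulmxA _ (adj2 _) (evmx R _)) adj2_mul mul_mx_scalar.
rewrite -!scalemxAl -[_ *m adj2 _ *m evmx R _]mulmxA adj2_mul mul_mx_scalar.
have eg0 := e_g_neq0 zn0.
have -> : row_mx2 phi W z *m bmat b z =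
   (- (z * (Pi_g u lam).[z]) / e_g lam) *: row_mx2 phi W w.
  apply: (can_inj (scalerK (_ : - e_g lam != 0))); first by rewrite oppr_eq0.
  by rewrite gz scalerA; congr (_ *: _); field.
rewrite !scalerA; congr (_ *: _).
rewrite !detR Ppol_bar // -/lamb.
rewrite /dsig !sigmaq_sub // -/s2 -/s4 -/(dsig u q lam _).
move: dd; rewrite /dsig; set x2 := _ - sigma u q (z2 lam); set x4 := _ - sigma u q (z4 lam).
rewrite mulf_eq0 negb_or => /andP[x20 x40].
rewrite (horner_D4 u lam z) -/s2 -/s4 horner_Pi_f horner_Pi_g horner_Sq (horner_Sq w) ws2 ws4.
rewrite -/s2 -/s4 /e_f /e_g /= /w.
move: (s2) (s4) n3 n4 => v2 v4 n3 n4.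
move: (Ppol u lam).[z] P0 => P P0.
by field; rewrite z0 q0 u0 z20 z40 z60 n1 n2 n3 n4.
Qed.

End Transport.

Section Reversal.
Variable C : fieldType.
Implicit Types (p : {poly C}).

(* [rev_eval n p f] is [f ^+ n * p.[f^-1]], defined at [f = 0] too. *)
Definition rev_eval n p (f : C) := \sum_(i < n.+1) p`_i * f ^+ (n - i).

Lemma rev_evalD n p r f : rev_eval n (p + r) f = rev_eval n p f + rev_eval n r f.
Proof. by rewrite /rev_eval -big_split; apply: eq_bigr => i _; rewrite coefD mulrDl. Qed.

Lemma rev_evalZ n a p f : rev_eval n (a *: p) f = a * rev_eval n p f.
Proof. by rewrite /rev_eval mulr_sumr; apply: eq_bigr => i _; rewrite coefZ mulrA. Qed.

Lemma rev_eval_lin n d a p f : (size p <= n.+1)%N ->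
  rev_eval n.+1 ((d *: 'X + a%:P) * p) f = (d + a * f) * rev_eval n p f.
Proof.
move=> sp; rewrite mulrDl -scalerAl mul_polyC rev_evalD !rev_evalZ mulrDl; congr (_ + _).
  rewrite /rev_eval big_ord_recl coefXM mul0r add0r; congr (_ * _).
  by apply: eq_bigr => i _; rewrite coefXM /= /bump /= add1n subSS.
rewrite -mulrA; congr (_ * _).
rewrite /rev_eval big_ord_recr /= [p`_n.+1]nth_default // mul0r addr0 mulr_sumr.
apply: eq_bigr => i _; rewrite /= subSn ?leq_ord // exprS; ring.
Qed.

Lemma coef_lin (d a : C) p i :
  ((d *: 'X + a%:P) * p)`_i = d * (if i is j.+1 then p`_j else 0) + a * p`_i.
Proof. by rewrite mulrDl -scalerAl mul_polyC coefD !coefZ coefXM; case: i. Qed.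

End Reversal.

Section Limits.
Variable C : numClosedFieldType.
Variables u q : C.
Hypotheses (q0 : q != 0).
Variable lam : param C.
Variable b : 'M[{poly C}]_2.
Hypothesis Hb : matrix_type u q lam b.

(** Similarity to diag(d1, d2) enters the equations through these two invariants, whence their
    symmetry in d1 and d2. *)
Lemma limit_trace_det :
  (b 0 0)`_6 + (b 1 1)`_6 / q = d1 lam + d2 lam /\
  (b 0 0)`_6 * (b 1 1)`_6 - (b 0 1)`_8 * (b 1 0)`_5 = q * (d1 lam * d2 lam).
Proof.
have [V VU HV] := mt_asym Hb.
have T := congr1 mxtrace HV; have D := congr1 determinant HV.
rewrite -mulmxA mxtrace_mulC mulmxKV // in T.
rewrite -mulmxA det_mulmx mulrC -det_mulmx mulmxKV // in D.
have tr (M : 'M[C]_2) : \tr M = M 0 0 + M 1 1.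
  rewrite /mxtrace !big_ord_recl big_ord0 addr0.
  by congr (M _ _ + M _ _); apply: val_inj.
move: T D; rewrite !tr /limit_mx !mx2E !det_mx2 mul0r subr0 => -> D; split=> //.
by rewrite -D; field.
Qed.

End Limits.

Lemma Ppol_factors (C : numClosedFieldType) (u : C) lam t : (Ppol u lam).[t] != 0 ->
  (t - z1 lam != 0) && (t - u ^+ 2 / z2 lam != 0) && (t - z3 lam != 0) &&
  (t - u ^+ 2 / z4 lam != 0) && (t - z5 lam != 0) && (t - u ^+ 2 / z6 lam != 0).
Proof. by rewrite horner_Ppol !mulf_eq0 !negb_or. Qed.

Section RowsAt.
Variable C : numClosedFieldType.
Variables u : C.
Hypothesis (u0 : u != 0).
Variable lam : param C.
Hypothesis zn0 : forall k, param_coords lam k != 0.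
Variables (t p : C).
Hypotheses (t0 : t != 0) (Pt : (Ppol u lam).[t] != 0).
Let s := u ^+ 2 / t.

Lemma f_row_at x y : - e_f u lam * (x * (p * (Ppol u lam).[t])) - t * (Pi_f lam).[t] * y =
  - (t ^+ 2 * ((t - z1 lam) * (t - z3 lam) * (t - z5 lam)) / u ^+ 2) *
    (p * t * Kpol lam s * x - s * Kpol lam t * y).
Proof.
have [[_ z20 _ z40] [_ z60 _ _]] := coords_neq0 zn0.
rewrite horner_Ppol horner_Pi_f /e_f /Kpol /s.
by field; rewrite u0 t0 z20 z40 z60.
Qed.

Lemma f_row_at_neq0 : t ^+ 2 * ((t - z1 lam) * (t - z3 lam) * (t - z5 lam)) / u ^+ 2 != 0.
Proof.
have /andP[/andP[/andP[/andP[/andP[h1 _] h3] _] h5] _] := Ppol_factors Pt.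
apply: mulf_neq0; last by rewrite invr_neq0 // expf_neq0.
by apply: mulf_neq0; rewrite ?expf_neq0 // !mulf_neq0.
Qed.

Lemma g_row_at x y : - e_g lam * (x * (p * (Ppol u lam).[t])) - t * (Pi_g u lam).[t] * y =
  - (t * ((t - z1 lam) * (t - z3 lam) * (t - z5 lam) * (t - u ^+ 2 / z2 lam) *
   (t - u ^+ 2 / z4 lam))) * (p * (z6 lam - s) * x - (z6 lam - t) * y).
Proof.
have [_ [_ z60 _ _]] := coords_neq0 zn0.
rewrite horner_Ppol horner_Pi_g /e_g /s.
move: (u ^+ 2 / z2 lam) (u ^+ 2 / z4 lam) => s2 s4.
by field; rewrite t0 z60.
Qed.

End RowsAt.

Section RowsOfCoordinates.
Variable C : numClosedFieldType.
Variables u q : C.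
Hypotheses (u0 : u != 0) (q0 : q != 0) (q1 : forall k, (0 < k)%N -> q ^+ k != 1).
Variable lam : param C.
Hypothesis nr : nonresonant u q lam.
Variables (b : 'M[{poly C}]_2) (t : C).
Hypothesis Hb : matrix_type u q lam b.
Hypothesis Hmu : bmat b (- u) = ((Ppol u lam).[- u])%:M.
Hypotheses (t0 : t != 0) (tnu : t != - u).
Hypothesis b21E : b 1 0 = 'X * ('X^2 - (u ^+ 2)%:P) * ('X - t%:P) * ('X - (u ^+ 2 / t)%:P).
Hypothesis Pt : (Ppol u lam).[t] != 0.
Let zn0 := nr_coords nr.
Let s := u ^+ 2 / t.
Let p := (b 0 0).[t] / (Ppol u lam).[t].
Hypothesis pt : p * u - t != 0.

(** At t = u the normalization of A gives p = 1, and p u - t would vanish. *)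
Lemma t_neq_u : t != u.
Proof.
apply: contraNneq pt => tu; have Pu := Pt; rewrite tu in Pu; rewrite /p tu.
have -> : (b 0 0).[u] = (Ppol u lam).[u].
  have := congr1 (fun A : 'M[C]_2 => A 0 0) (mt_one Hb).
  by rewrite /bmat mx2E mxE.
by rewrite divff // mul1r subrr.
Qed.

Let pP : p * (Ppol u lam).[t] = (b 0 0).[t]. Proof. by rewrite /p divfK. Qed.

Lemma g_row g : p * (z6 lam - s) - (z6 lam - t) != 0 ->
  p * (z6 lam - s) * (g - t) = (z6 lam - t) * (g - s) ->
  exists2 W : {poly C}, (size W <= 4)%N &
    row_eq u (e_g lam) (Pi_g u lam) b (- 1 *: 'X + g%:P) W.
Proof.
move=> nd E; have [sg mg] := Pi_g_monic u lam.
have uu := erefl (u ^+ 2); have uu' : (- u) ^+ 2 = u ^+ 2 by rewrite sqrrN.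
apply: (@row_exists _ u q u0 lam nr b t Hb Hmu t0 t_neq_u tnu b21E Pt
   (e_g lam) (Pi_g u lam) g (- 1) (e_g_neq0 zn0) sg).
- exact: twist_g.
- exact: twist_g_fixed.
- exact: twist_g_fixed.
- apply/eqP; rewrite -subr_eq0 -pP g_row_at // -/s.
  rewrite (_ : p * (z6 lam - s) * (-1 * t + g) - (z6 lam - t) * (-1 * s + g) = 0) ?mulr0 //.
  by apply/eqP; rewrite subr_eq0 !mulN1r ![- _ + g]addrC E.
have [Pg|Pg] := eqVneq (Pi_g u lam).[t] 0; last by left.
right; apply: contraNneq nd => b0.
have p0 : p = 0 by rewrite /p b0 mul0r.
move/eqP: Pg; rewrite horner_Pi_g !mulf_eq0.
have /andP[/andP[/andP[/andP[/andP[h1 h2] h3] h4] h5] _] := Ppol_factors Pt.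
rewrite (negbTE h1) (negbTE h2) (negbTE h3) (negbTE h4) (negbTE h5) /=.
by rewrite subr_eq0 => /eqP ->; rewrite p0 mul0r subrr subrr.
Qed.

Let X := p * t * Kpol lam s.
Let Y := s * Kpol lam t.

Lemma f_row f : t * X - s * Y != 0 -> f * (t * X - s * Y) = X - Y ->
  exists2 V : {poly C}, (size V <= 4)%N &
    row_eq u (e_f u lam) (Pi_f lam) b (f *: 'X + (- 1)%:P) V.
Proof.
move=> nd E; have [sg mg] := Pi_f_monic lam.
have uu := erefl (u ^+ 2); have uu' : (- u) ^+ 2 = u ^+ 2 by rewrite sqrrN.
apply: (@row_exists _ u q u0 lam nr b t Hb Hmu t0 t_neq_u tnu b21E Pt
   (e_f u lam) (Pi_f lam) (- 1) f (e_f_neq0 u0 zn0) sg).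
- exact: twist_f.
- exact: twist_f_fixed.
- exact: twist_f_fixed.
- apply/eqP; rewrite -subr_eq0 -pP f_row_at // -/s.
  rewrite (_ : p * t * Kpol lam s * (f * t + -1) - s * Kpol lam t * (f * s + -1) = 0)
    ?mulr0 //.
  rewrite -/X -/Y; transitivity (f * (t * X - s * Y) - (X - Y)); first by ring.
  by rewrite E subrr.
have [Pg|Pg] := eqVneq (Pi_f lam).[t] 0; last by left.
right; apply: contraNneq nd => b0.
have p0 : p = 0 by rewrite /p b0 mul0r.
have K0 : Kpol lam t = 0.
  have := f_row_at_neq0 u0 t0 Pt; rewrite mulf_eq0 negb_or => /andP[+ _].
  rewrite mulf_eq0 negb_or => /andP[_ n].
  apply: (mulfI n); rewrite mulr0; apply: oppr_inj; rewrite oppr0 -Pg horner_Pi_f /Kpol; ring.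
by rewrite /X /Y p0 K0 !(mul0r, mulr0) subrr.
Qed.

(** At z = t the entry b_21 vanishes, so V drops out and the first column fixes the ratio l1 :
    l0. *)
Lemma f_row_unique (l1 l0 f : C) (V : {poly C}) : t * X - s * Y != 0 ->
  f * (t * X - s * Y) = X - Y ->
  row_eq u (e_f u lam) (Pi_f lam) b (l1 *: 'X + l0%:P) V -> l1 = - l0 * f.
Proof.
move=> nd E /row_eqE /(_ t t0) [H _].
have b21t : (b 1 0).[t] = 0 by rewrite b21E !hornerM hornerXsubC subrr mulr0 mul0r.
move/eqP: H; rewrite b21t mulr0 addr0 -subr_eq0 -pP f_row_at // mulf_eq0 oppr_eq0.
rewrite (negbTE (f_row_at_neq0 u0 t0 Pt)) /= -/X -/Y; horner_simp; rewrite -/s => /eqP H.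
apply: (mulIf nd); rewrite -[RHS]mulrA E; apply/eqP; rewrite -subr_eq0; apply/eqP.
by rewrite -H; ring.
Qed.

End RowsOfCoordinates.

(** * The Painleve equation *)

Section Equations.
Variable C : numClosedFieldType.
Variables u q : C.
Hypotheses (u0 : u != 0) (q0 : q != 0) (q1 : forall k, (0 < k)%N -> q ^+ k != 1).
Variable lam : param C.
Hypothesis nr : nonresonant u q lam.
Let lamb := lambda_bar q lam.
Variables (b bb R : 'M[{poly C}]_2) (kappa : C).
Hypotheses (Hb : matrix_type u q lam b) (Hbb : matrix_type u q lamb bb).
Hypothesis sR : [/\ (size (R 0%R 0%R) <= 2)%N, (size (R 0%R 1%R) <= 3)%N,
  (size (R 1%R 0%R) <= 1)%N & (size (R 1%R 1%R) <= 2)%N].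
Hypothesis kappa0 : kappa != 0.
Hypothesis detR : forall x, \det (evmx R x) = kappa * dsig u q lam x.
Hypothesis rel : forall z, z != 0 ->
  (Ppol u lamb).[z] *: (evmx R (sigma u q (z / q)) *m bmat b z) =
  (Ppol u lam).[z] *: (bmat bb z *m evmx R (sigma u q z)).
Variables (t tb : C).
Hypothesis b21E : b 1 0 = 'X * ('X^2 - (u ^+ 2)%:P) * ('X - t%:P) * ('X - (u ^+ 2 / t)%:P).
Hypothesis bb21E :
  bb 1 0 = 'X * ('X^2 - (u ^+ 2)%:P) * ('X - tb%:P) * ('X - (u ^+ 2 / tb)%:P).
Variables (f g fb gb : C) (W V Wb : {poly C}).
Hypotheses (sW : (size W <= 4)%N) (sV : (size V <= 4)%N) (sWb : (size Wb <= 4)%N).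
Hypothesis rg : row_eq u (e_g lam) (Pi_g u lam) b (- 1 *: 'X + g%:P) W.
Hypothesis rf : row_eq u (e_f u lam) (Pi_f lam) b (f *: 'X + (- 1)%:P) V.
Hypothesis rgb : row_eq u (e_g lamb) (Pi_g u lamb) bb (- 1 *: 'X + gb%:P) Wb.
Hypothesis fb_unique : forall (l1 l0 : C) (V : {poly C}),
  row_eq u (e_f u lamb) (Pi_f lamb) bb (l1 *: 'X + l0%:P) V -> l1 = - l0 * fb.
Let zn0 := nr_coords nr.
Let nrb : nonresonant u q lamb := nonresonant_bar q0 nr.

Let phi : {poly C} := - 1 *: 'X + g%:P.
Let l1 := (L1 u q lam R g W)`_1.
Let l0 := (L1 u q lam R g W)`_0.
Let V0 := V0 u q lam R g W.
Let r11 := zlift q^-1 (u ^+ 2) 1 (R 0 0).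
Let r12 := zlift q^-1 (u ^+ 2) 2 (R 0 1).
Let r22 := zlift q^-1 (u ^+ 2) 1 (R 1 1).
Let r21 := (R 1 0)`_0.
Let s2 := u ^+ 2 / z2 lam.
Let s4 := u ^+ 2 / z4 lam.

Lemma linE (p : {poly C}) : (size p <= 2)%N -> p = p`_1 *: 'X + (p`_0)%:P.
Proof.
move=> sp; apply/polyP => i; rewrite coefD coefZ coefX coefC.
case: i => [|[|i]] /=; rewrite ?mulr0 ?mulr1 ?add0r ?addr0 //.
by rewrite nth_default // (leq_trans sp).
Qed.

Lemma L1lin : L1 u q lam R g W = l1 *: 'X + l0%:P.
Proof. by apply: linE; exact: size_L1. Qed.

Lemma rowV0 : row_eq u (e_f u lamb) (Pi_f lamb) bb (l1 *: 'X + l0%:P) V0.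
Proof. rewrite -L1lin; exact: (row_eq_transport u0 q0 q1 nr Hb sR kappa0 detR rel rg). Qed.

Lemma l1E : l1 = - l0 * fb.
Proof. exact: fb_unique rowV0. Qed.

Lemma psi1_fact : psi1 u q R g W = (l1 *: 'X + l0%:P) * Sq u lam.
Proof. by rewrite -L1lin; exact: (L1E u0 q0 q1 nr Hb sR rel rg). Qed.

Lemma psi2_fact : psi2 u q R g W = V0 * Sq u lam.
Proof. exact: (V0E u0 q0 q1 nr Hb sR rel rg). Qed.

Lemma zlift1_coef (a c : C) (p : {poly C}) : (zlift a c 1 p)`_0 = p`_1 * c.
Proof.
have -> : zlift a c 1 p = p`_0 *: 'X + p`_1 *: (a *: 'X^2 + c%:P).
  rewrite /zlift !big_ord_recl big_ord0 addr0.
  by congr (_ *: _ + _ *: _); [exact: mul1r | exact: mulr1].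
by rewrite coefD !coefZ coefX coefD coefZ coefXn coefC /=; ring.
Qed.

Lemma zlift1_coef2 (a c : C) (p : {poly C}) : (zlift a c 1 p)`_2 = p`_1 * a.
Proof. by rewrite -[2%N]/(1.*2) coef_zlift expr1. Qed.

Lemma Sq_coefs : [/\ (Sq u lam)`_2 = 1, (Sq u lam)`_0 = s2 * s4 & (size (Sq u lam) <= 3)%N].
Proof.
split; first by rewrite (coef_prod_XsubC [:: _; _]).
  by rewrite -horner_coef0 horner_Sq -/s2 -/s4; ring.
by rewrite size_prod_XsubC.
Qed.

(** First column of the identity row adj(R) R = det(R) row at sigma(z/q), with powers of z
    cleared. *)
Lemma adj_identity : psi1 u q R g W * r11 + r21 *: psi2 u q R g W =
  (kappa / q ^+ 2) *: (phi * (('X - (q * z2 lam)%:P) * ('X - (q * z4 lam)%:P) * Sq u lam)).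
Proof.
have [[_ z20 _ z40] _] := coords_neq0 zn0.
apply: (@poly_cofinite_eq _ _ _ [:: 0]) => z; rewrite inE => z0.
have D := detR (sigma u q (z / q)); rewrite evmxE det_mx2 /dsig !sigmaq_sub // (R10E sR) in D.
transitivity (phi.[z] * (r22.[z] * r11.[z] - r12.[z] * r21)).
  by rewrite /psi1 /psi2 -/phi -/r11 -/r12 -/r22 -/r21; horner_simp; ring.
rewrite /r11 /r12 /r22 (r11E u q0 sR z0) (r12E u q0 sR z0) (r22E u q0 sR z0).
transitivity (phi.[z] * z ^+ 2 * ((R 0 0).[sigma u q (z / q)] * (R 1 1).[sigma u q (z / q)]
   - (R 0 1).[sigma u q (z / q)] * r21)); first by ring.
rewrite /r21 D hornerZ hornerM [in RHS]hornerM horner_Sq -/s2 -/s4; move: phi.[z] => y.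
horner_simp; by field; rewrite q0 z0.
Qed.

Lemma reduced_identity : (l1 *: 'X + l0%:P) * r11 + r21 *: V0 =
  (kappa / q ^+ 2) *: (phi * (('X - (q * z2 lam)%:P) * ('X - (q * z4 lam)%:P))).
Proof.
have S0 : Sq u lam != 0 by rewrite monic_neq0 // monic_prod_XsubC.
apply: (mulIf S0); have := adj_identity; rewrite psi1_fact psi2_fact -!mul_polyC => E.
transitivity ((l1%:P * 'X + l0%:P) * Sq u lam * r11 + r21%:P * (V0 * Sq u lam)).
  by ring.
by rewrite E; ring.
Qed.

(** If [l0] = 0 the first entry of the transported row is 0, its equation reads V0 b_21 = 0, hence
    V0 = 0, and [reduced_identity] would make phi vanish. *)
Lemma l0_neq0 : l0 != 0.
Proof.
apply/negP => /eqP l00; have l10 : l1 = 0 by rewrite l1E l00 oppr0 mul0r.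
have V00 : V0 = 0.
  apply: (@poly_cofinite _ _ [:: 0; u; - u; tb; u ^+ 2 / tb]) => z.
  rewrite !inE !negb_or => /and5P[z0 zu znu zt zs].
  have /row_eqE /(_ z z0) [H _] := rowV0.
  move/eqP: H; rewrite l00 l10 scale0r add0r !horner0 mul0r add0r mulr0.
  rewrite mulf_eq0 oppr_eq0 (negbTE (e_f_neq0 u0 (nr_coords nrb))) /=.
  rewrite mulf_eq0 => /orP[|].
    by rewrite mulf_eq0 invr_eq0 (negbTE z0) orbF => /eqP.
  rewrite (horner_b21 bb21E) !mulf_eq0 (negbTE z0) !subr_eq0 addr_eq0.
  by rewrite (negbTE zu) (negbTE znu) (negbTE zt) (negbTE zs).
have := reduced_identity; rewrite l00 l10 V00 scale0r add0r mul0r scaler0 addr0.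
move/esym/eqP; rewrite scaler_eq0 mulf_eq0 invr_eq0 expf_eq0 (negbTE q0) (negbTE kappa0) /=.
rewrite !mulf_eq0 !polyXsubC_eq0 !orbF => /eqP P.
have := congr1 (fun p : {poly C} => p`_1) P.
rewrite /phi coefD coefZ coefX coefC coef0 /= mulr1 addr0 => /eqP.
by rewrite oppr_eq0 oner_eq0.
Qed.

Lemma phi_coefs : phi`_1 = - 1 /\ phi`_0 = g.
Proof. by rewrite /phi !coefD !coefZ !coefX !coefC /= mulr0 mulr1 add0r addr0. Qed.

Let kp := u ^+ 2 / (q * z2 lam * z4 lam).

(** From [psi1_fact] at infinity and at 0: the coefficient of z^3 times q u^2 g plus the constant
    term eliminates [rho], the leading coefficient of R_22. The trace and determinant of the limit
    then factor the quadratic in g. *)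
Lemma third_relation :
  r21 * ((g - d1 lam * z6 lam) * (g - d2 lam * z6 lam)) = - l0 * z6 lam * (fb * g - kp).
Proof.
have [[_ z20 _ z40] [_ z60 _ _]] := coords_neq0 zn0.
have [S2 S0 sS] := Sq_coefs.
have [p1 p0] := phi_coefs.
have c3 := congr1 (fun p : {poly C} => p`_3) psi1_fact.
have c0 := congr1 (fun p : {poly C} => p`_0) psi1_fact.
have sr22 : (size r22 <= 3)%N by exact: (size_zlift _ _ 1).
move: c3 c0; rewrite /psi1 -/phi -/r22 -/r21 !coefB !coefZ !coef_lin S2 S0.
rewrite [(Sq u lam)`_3]nth_default // [r22`_3]nth_default // /r22 zlift1_coef zlift1_coef2.
rewrite !(mulr0, addr0, add0r, mulr1).
have [sg mg] := Pi_g_monic u lam.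
have [top3 top0] := row_top u0 Hb b21E sg mg sW rg.
have [tr dt] := limit_trace_det q0 Hb.
have bc : (b 1 0)`_5 = 1 by exact: (coef_b21 b21E).
move: top3 top0 tr dt; rewrite bc /e_g !mulr1.
move: (b 0 0)`_6 (b 0 1)`_8 (b 1 1)`_6 W`_3 W`_0 (R 1 1)`_1 => a bt d w3 w0 rho.
move=> top3 top0 tr dt c3 c0.
have Ew3 : w3 = a - g / z6 lam by rewrite -top3; field.
have Ed : d = q * (d1 lam + d2 lam - a) by rewrite -tr; field.
have Ebt : bt = a * d - q * (d1 lam * d2 lam) by rewrite -dt; ring.
have El1 := l1E.
have : q * u ^+ 2 * g * l1 + l0 * (s2 * s4) =
   r21 * (q * u ^+ 2 / z6 lam) * ((g - d1 lam * z6 lam) * (g - d2 lam * z6 lam)).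
  rewrite -c3 -c0 -top0 Ew3 Ebt Ed; field; by rewrite q0 z60.
rewrite El1 /s2 /s4 => H.
have qu : q * u ^+ 2 / z6 lam != 0 by rewrite !mulf_neq0 ?invr_neq0 ?expf_neq0.
apply: (mulfI qu); rewrite mulrA [q * u ^+ 2 / z6 lam * r21]mulrC -H /kp.
by field; rewrite q0 z20 z40 z60.
Qed.

(** Evaluation of [psi1_fact] at z = g, where phi vanishes. *)
Lemma second_relation : r21 * W.[g] = l0 * (fb * g - 1) * ((g - s2) * (g - s4)).
Proof.
have := congr1 (fun p : {poly C} => p.[g]) psi1_fact.
rewrite /psi1 -/phi -/r21 hornerM horner_Sq -/s2 -/s4 l1E.
rewrite hornerD hornerM hornerN hornerZ.
have -> : phi.[g] = 0 by rewrite /phi; horner_simp; ring.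
horner_simp => E; apply: oppr_inj; rewrite -[LHS]add0r -[X in X - _](mul0r r22.[g]) E; ring.
Qed.

Lemma first_relation :
  (f * g - 1) * W.[g] * z6 lam = - (f * g - u ^+ 2 / (z2 lam * z4 lam)) * (Pi4 lam).[g].
Proof.
have [_ [_ z60 _ _]] := coords_neq0 zn0.
have D := deltaE u0 nr Hb b21E sV sW rf rg.
have := congr1 (fun p : {poly C} => p.[g]) D.
rewrite horner_delta hornerZ subrr mul0r subr0 => ->.
by rewrite mulrAC divfK.
Qed.

Lemma equation1 :
  (f * g - 1) * (fb * g - 1) * ((g - s2) * (g - s4)) *
    ((g - d1 lam * z6 lam) * (g - d2 lam * z6 lam)) =
  (f * g - u ^+ 2 / (z2 lam * z4 lam)) * (fb * g - kp) * (Pi4 lam).[g].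
Proof.
have [_ [_ z60 _ _]] := coords_neq0 zn0.
have E1 := first_relation; have E2 := second_relation; have E3 := third_relation.
have l00 := l0_neq0.
(* The product of the relations carries a factor [r21]. If it is 0 it cannot be cancelled, but then
   the second and third relations make both sides vanish separately. *)
have [r0|r0] := eqVneq r21 0.
  move: E2 E3; rewrite r0 !mul0r => /esym/eqP; rewrite -mulrA mulf_eq0 (negbTE l00) /= => /eqP E2.
  move=> /esym/eqP; rewrite !mulf_eq0 oppr_eq0 (negbTE l00) (negbTE z60) /= => /eqP E3.
  rewrite E3 !(mulr0, mul0r).
  transitivity ((f * g - 1) * ((fb * g - 1) * ((g - s2) * (g - s4))) *
    ((g - d1 lam * z6 lam) * (g - d2 lam * z6 lam))); first by ring.
  by rewrite E2 !(mulr0, mul0r).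
apply: (mulfI r0); apply: (mulfI l00).
transitivity ((f * g - 1) * (l0 * (fb * g - 1) * ((g - s2) * (g - s4))) *
  (r21 * ((g - d1 lam * z6 lam) * (g - d2 lam * z6 lam)))); first by ring.
rewrite -E2 E3.
transitivity (- (r21 * l0) * (fb * g - kp) * ((f * g - 1) * W.[g] * z6 lam)); first by ring.
by rewrite E1; ring.
Qed.

Let eb := e_f u lamb.
Let kbar := u ^+ 2 / (q * z2 lam * (q * z4 lam)).
Let Vb : {poly C} := (- l0)^-1 *: V0.

Lemma l0V0 : V0 = - l0 *: Vb.
Proof. by rewrite /Vb scalerA mulfV ?scale1r // oppr_eq0 l0_neq0. Qed.

Lemma rowVb : row_eq u eb (Pi_f lamb) bb (fb *: 'X + (- 1)%:P) Vb.
Proof.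
have n0 : - l0 != 0 by rewrite oppr_eq0 l0_neq0.
move=> z z0; have := rowV0 z0.
have E x : row_mx2 (l1 *: 'X + l0%:P) V0 x =
    - l0 *: row_mx2 (fb *: 'X + (- 1)%:P) Vb x.
  by rewrite {1}l0V0 l1E /row_mx2 scale_mx2; horner_simp; congr (mx2 _ _ _ _); ring.
rewrite !E -scalemxAl !scalerA => H; apply: (can_inj (scalerK n0)).
by rewrite !scalerA mulrC H mulrC.
Qed.

Lemma size_Vb : (size Vb <= 4)%N.
Proof. by rewrite (leq_trans (size_scale_leq _ _)) //; exact: size_V0. Qed.

(** The identity [deltaE] for the modified connection at z = 1/fb, where fb z - 1 vanishes; reversal
    keeps it meaningful for fb = 0. *)
Lemma first_relation_bar : (fb * gb - 1) * rev_eval 3 Vb fb * z6 lam =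
  (fb * gb - kbar) * ((1 - fb * z1 lam) * (1 - fb * z3 lam) * (1 - fb * z5 lam) *
    (1 - fb * z6 lam)).
Proof.
have [_ [_ z60 _ _]] := coords_neq0 zn0.
have D := deltaE u0 nrb Hbb bb21E size_Vb sWb rowVb rgb.
have := congr1 (fun p : {poly C} => rev_eval 4 p fb) D.
rewrite rev_evalZ /delta rev_evalD -scaleN1r rev_evalZ !rev_eval_lin ?size_Vb //.
have lin (r : C) : 'X - r%:P = 1 *: 'X + (- r)%:P by rewrite scale1r polyCN.
have sl (r : C) n (p : {poly C}) : (size p <= n.+1)%N ->
    (size ((1 *: 'X + (- r)%:P) * p)%R <= n.+2)%N.
  by move=> sp; rewrite -lin; apply: (@size_polyM_top _ 1 n) => //; rewrite size_XsubC.
rewrite /Pi4 !big_cons big_nil !lin mulr1 -[X in _ * (_ * (_ * X))]mulr1.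
rewrite rev_eval_lin; last by apply: (sl); apply: (sl); apply: (sl); rewrite size_poly1.
rewrite rev_eval_lin; last by apply: (sl); apply: (sl); rewrite size_poly1.
rewrite rev_eval_lin; last by apply: sl; rewrite size_poly1.
rewrite rev_eval_lin ?size_poly1 //.
have -> : rev_eval 0 1 fb = 1.
  by rewrite /rev_eval big_ord_recl big_ord0 coef1 /= expr0 mulr1 addr0.
rewrite /= -/kbar => E.
transitivity ((fb + -1 * fb) * rev_eval 3 Wb fb * z6 lam + (-1 * ((-1 + gb * fb) * rev_eval 3 Vb fb)) * - z6 lam).
  by ring.
rewrite (_ : (fb + -1 * fb) = 0); last by ring.
rewrite (_ : (fb + -1 * fb) = 0) in E; last by ring.
rewrite !mul0r !add0r in E *; rewrite E; by field.
Qed.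

(** [reduced_identity] at z = 1/fb, where the term with [r11] drops out. *)
Lemma second_relation_bar : - r21 * l0 * rev_eval 3 Vb fb =
  kappa / q ^+ 2 * ((fb * g - 1) * (1 - fb * (q * z2 lam)) * (1 - fb * (q * z4 lam))).
Proof.
have := l0V0; move: (Vb) => vb LV.
have := congr1 (fun p : {poly C} => rev_eval 3 p fb) reduced_identity.
have sr11 : (size r11 <= 3)%N by exact: (size_zlift _ _ 1).
rewrite rev_evalD rev_eval_lin // !rev_evalZ LV rev_evalZ l1E.
have zz : - l0 * fb + l0 * fb = 0 by ring.
rewrite zz mul0r add0r.
have lin (r : C) : 'X - r%:P = 1 *: 'X + (- r)%:P by rewrite scale1r polyCN.
rewrite /phi !lin rev_eval_lin; last first.
  by rewrite -!lin; apply: (@size_polyM_top _ 1 1); rewrite size_XsubC.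
rewrite rev_eval_lin; last by rewrite -lin size_XsubC.
rewrite -[1 *: 'X + (- (q * z4 lam))%:P]mulr1 rev_eval_lin ?size_poly1 //.
have -> : rev_eval 0 1 fb = 1.
  by rewrite /rev_eval big_ord_recl big_ord0 coef1 /= expr0 mulr1 addr0.
move=> E; transitivity (r21 * (- l0 * rev_eval 3 vb fb)); first by ring.
by rewrite E; ring.
Qed.

(** Counterpart of [third_relation] for [reduced_identity]: fb times the constant term plus q u^2
    times the coefficient of z^3 eliminates [rho], here the leading coefficient of R_11. *)
Lemma third_relation_bar :
  - r21 * l0 * (u ^+ 2 * q * eb) * ((fb * d1 lamb - eb^-1) * (fb * d2 lamb - eb^-1)) =
  kappa * (z2 lam * z4 lam) * (fb * g - kp).
Proof.
have := l0V0; have := size_Vb; have := rowVb; move: (Vb) => vb rvb svb LV.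
have [[_ z20 _ z40] [_ z60 _ _]] := coords_neq0 zn0.
have eb0 : eb != 0 := e_f_neq0 u0 (nr_coords nrb).
have c3 := congr1 (fun p : {poly C} => p`_3) reduced_identity.
have c0 := congr1 (fun p : {poly C} => p`_0) reduced_identity.
have [p1 p0] := phi_coefs.
have sr11 : (size r11 <= 3)%N by exact: (size_zlift _ _ 1).
have lin (r : C) : 'X - r%:P = 1 *: 'X + (- r)%:P by rewrite scale1r polyCN.
move: c3 c0; rewrite !coefD !coefZ !coef_lin [r11`_3]nth_default // /r11 zlift1_coef zlift1_coef2.
rewrite /phi !lin !coef_lin !coefD !coefZ !coefX !coefC /=.
rewrite LV !coefZ l1E.
have [sf mf] := Pi_f_monic lamb.
have [top3 top0] := row_top u0 Hbb bb21E sf mf svb rvb.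
have [tr dt] := limit_trace_det q0 Hbb.
have bc : (bb 1 0)`_5 = 1 by exact: (coef_b21 bb21E).
move: top3 top0 tr dt; rewrite bc -/eb !mulr1.
move: (bb 0 0)`_6 (bb 0 1)`_8 (bb 1 1)`_6 vb`_3 vb`_0 (R 0 0)`_1 => a bt d v3 v0 rho.
move=> top3 top0 tr dt c3 c0.
have Ev3 : v3 = eb^-1 - fb * a.
  have H : eb * (fb * a + v3) = 1 by apply: oppr_inj; rewrite -mulNr.
  apply: (mulfI eb0); rewrite mulrBr mulfV // -H; ring.
have Ed : d = q * (d1 lamb + d2 lamb - a) by rewrite -tr; field.
have Ebt : bt = a * d - q * (d1 lamb * d2 lamb) by rewrite -dt; ring.
have S : u ^+ 2 * q * eb * ((fb * d1 lamb - eb^-1) * (fb * d2 lamb - eb^-1)) =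
  fb * v0 + q * u ^+ 2 * v3.
  rewrite -top0 Ebt Ed Ev3; by field.
rewrite -mulrA S.
transitivity (fb * (l0 * (rho * u ^+ 2) + r21 * (- l0 * v0)) +
  q * u ^+ 2 * (- l0 * fb * (rho / q) + r21 * (- l0 * v3))); first by field.
move: c3 c0; rewrite !(mulr0, mul0r, addr0, add0r, mulr1, mul1r) => -> ->.
by rewrite /kp; field; rewrite q0 z20 z40.
Qed.

Lemma equation2 :
  (fb * gb - 1) * (fb * g - 1) * (1 - fb * (q * z2 lam)) * (1 - fb * (q * z4 lam)) *
   (u ^+ 2 * eb * z6 lam) * ((fb * d1 lamb - eb^-1) * (fb * d2 lamb - eb^-1)) =
  (fb * gb - kbar) * (fb * g - kp) * (q * (z2 lam * z4 lam)) *
   ((1 - fb * z1 lam) * (1 - fb * z3 lam) * (1 - fb * z5 lam) * (1 - fb * z6 lam)).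
Proof.
have [[_ z20 _ z40] [_ z60 _ _]] := coords_neq0 zn0.
have E1 := first_relation_bar; have E2 := second_relation_bar; have E3 := third_relation_bar.
have l00 := l0_neq0.
have kq : kappa / q ^+ 2 != 0 by rewrite mulf_neq0 ?invr_neq0 ?expf_neq0.
have kz : kappa * (z2 lam * z4 lam) != 0 by rewrite !mulf_neq0.
have [r0|r0] := eqVneq r21 0.
  move: E2 E3; rewrite r0 !(oppr0, mul0r) => /esym/eqP; rewrite mulf_eq0 (negbTE kq) orFb => /eqP E2.
  move=> /esym/eqP; rewrite mulf_eq0 (negbTE kz) orFb => /eqP E3.
  rewrite E3 !(mulr0, mul0r).
  transitivity ((fb * gb - 1) * ((fb * g - 1) * (1 - fb * (q * z2 lam)) * (1 - fb * (q * z4 lam))) *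
   (u ^+ 2 * eb * z6 lam) * ((fb * d1 lamb - eb^-1) * (fb * d2 lamb - eb^-1))); first by move: (eb^-1) (eb) => ei ee; ring.
  by rewrite E2 mulr0 !mul0r.
have n : - r21 * l0 != 0 by rewrite mulf_neq0 // oppr_eq0.
have q2 : q ^+ 2 != 0 by rewrite expf_neq0.
apply: (mulfI n); apply: (mulfI kq).
transitivity ((fb * gb - 1) * z6 lam / q *
  (kappa / q ^+ 2 * ((fb * g - 1) * (1 - fb * (q * z2 lam)) * (1 - fb * (q * z4 lam)))) *
  (- r21 * l0 * (u ^+ 2 * q * eb) * ((fb * d1 lamb - eb^-1) * (fb * d2 lamb - eb^-1)))).
  by move: (eb^-1) => ei; field.
rewrite -E2 E3.
transitivity (- r21 * l0 / q * (kappa * (z2 lam * z4 lam) * (fb * g - kp)) *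
   ((fb * gb - 1) * rev_eval 3 Vb fb * z6 lam)); first by ring.
by rewrite E1; field.
Qed.

End Equations.

(** * The equations for two connections related by a modification *)

Section Painleve.
Variable C : numClosedFieldType.
Variables u q : C.
Hypotheses (u0 : u != 0) (q0 : q != 0) (q1 : forall k, (0 < k)%N -> q ^+ k != 1).
Variable lam : param C.
Hypothesis nr : nonresonant u q lam.
Implicit Types (b : 'M[{poly C}]_2) (z : C).
Let zn0 := nr_coords nr.
Let lamb := lambda_bar q lam.
Let nrb : nonresonant u q lamb := nonresonant_bar q0 nr.

Lemma Ppol_u_neq0 (la : param C) : nonresonant u q la ->
  (Ppol u la).[u] != 0 /\ (Ppol u la).[- u] != 0.
Proof.
move=> nra.
have a k (Hk : (k < 6)%N) := nr_u nra (Ordinal Hk).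
have c k (Hk : (k < 6)%N) := nr_ustar u0 nra (Ordinal Hk).
have [a0 a0'] := a 0 isT; have [a2 a2'] := a 2 isT; have [a4 a4'] := a 4 isT.
have [c1 c1'] := c 1 isT; have [c3 c3'] := c 3 isT; have [c5 c5'] := c 5 isT.
split; rewrite horner_Ppol !mulf_neq0 // subr_eq0 //; by rewrite eq_sym.
Qed.

Lemma step_intertwines (c : chart C) b z : matrix_type u q lam b -> kap u q lam c b != 0 ->
  z != 0 ->
  (Ppol u lamb).[z] *: (evmx (Rmat u q lam c b) (sigma u q (z / q)) *m bmat b z) =
  (Ppol u lam).[z] *: (bmat (step u q lam c b) z *m evmx (Rmat u q lam c b) (sigma u q z)).
Proof.
move=> Hb k0; move: z; apply: (@laurent_mx_eq _ _ _ (D4_points u lam)).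
- apply: laurent_scalemx; first exact: laurent_poly.
  apply: laurent_mulmx; first exact: laurent_evalmx (laurent_sigmaq _ q0).
  by apply: laurent_bmat; [exact: laurent_id | exact: laurent_inv].
- apply: laurent_scalemx; first exact: laurent_poly.
  apply: laurent_mulmx; last exact: laurent_evalmx (laurent_sigma _ q0).
  by apply: laurent_bmat; [exact: laurent_id | exact: laurent_inv].
move=> z /D4_pointsP [z0 D0].
rewrite (bmat_step u0 q0 nr Hb) // -scalemxAl /conj_Rmat -[X in _ = _ *: (_ *: X)]mulmxA.
rewrite adj2_mul mul_mx_scalar !scalerA; congr (_ *: _).
rewrite det_evRmat (Ppol_bar q0 nr) //.
by field; rewrite D0 k0.
Qed.

Lemma gauge_intertwines (la : param C) b b' r11 r22 (r12 : {poly C}) :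
  (forall k, param_coords la k != 0) -> r11 != 0 -> r22 != 0 ->
  (let R x := mx2 r11 r12.[x] 0 r22 in forall z, z != 0 -> (Ppol u la).[z] != 0 ->
     conn u la b' z = R (sigma u q (z / q)) *m conn u la b z *m invmx (R (sigma u q z))) ->
  let G := mx2 r11%:P r12 0 r22%:P : 'M[{poly C}]_2 in
  forall z, z != 0 ->
  evmx G (sigma u q (z / q)) *m bmat b z = bmat b' z *m evmx G (sigma u q z).
Proof.
move=> zna r1 r2 H G; apply: (@laurent_mx_eq _ _ _ (good_points u la)).
- apply: laurent_mulmx; first exact: laurent_evalmx (laurent_sigmaq _ q0).
  by apply: laurent_bmat; [exact: laurent_id | exact: laurent_inv].
- apply: laurent_mulmx; last exact: laurent_evalmx (laurent_sigma _ q0).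
  by apply: laurent_bmat; [exact: laurent_id | exact: laurent_inv].
move=> z /(good_pointsP zna) [z0 P0 _].
have GE x : evmx G x = mx2 r11 r12.[x] 0 r22.
  by rewrite evmxE /G !mx2E !hornerC ?horner0.
have U : evmx G (sigma u q z) \in unitmx.
  by rewrite unitmxE unitfE GE det_mx2 mulr0 subr0 mulf_neq0.
rewrite (bmatE b P0) (bmatE b' P0) H // -!GE -scalemxAr -scalemxAl.
by rewrite mulmxKV.
Qed.

Section TwoConnections.
Variables (b bb : 'M[{poly C}]_2).
Hypotheses (Hb : matrix_type u q lam b) (Hbb : matrix_type u q lamb bb).
Hypothesis b0 : b 1 0 != 0.
Hypothesis bmod : modification u q lam lamb b bb.

(** Undoing the explicit step and then applying the given modification is a modification within type
    lambda-bar, hence a gauge transformation G. The product of G with [Rmat] keeps the degree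
    bounds, the zeros of the determinant and the value at -u. *)
Lemma structured_modification : exists (R : 'M[{poly C}]_2) (kappa : C),
  [/\ [/\ (size (R 0%R 0%R) <= 2)%N, (size (R 0%R 1%R) <= 3)%N,
        (size (R 1%R 0%R) <= 1)%N & (size (R 1%R 1%R) <= 2)%N],
      kappa != 0, forall x, \det (evmx R x) = kappa * dsig u q lam x,
      forall z, z != 0 ->
  (Ppol u lamb).[z] *: (evmx R (sigma u q (z / q)) *m bmat b z) =
  (Ppol u lam).[z] *: (bmat bb z *m evmx R (sigma u q z)) &
   bmat b (- u) = ((Ppol u lam).[- u])%:M -> bmat bb (- u) = ((Ppol u lamb).[- u])%:M].
Proof.
have [c k0] := exists_chart u0 q0 nr Hb b0.
have st := step_type u0 q0 nr Hb k0.
have sm := step_modification u0 q0 nr Hb k0.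
have [r11 [r22 [r12 [r1 r2 sr H]]]] := gauge_of_modification u0 q0 q1 nrb st Hbb
   (modification_trans u0 q0 (modification_sym u0 q0 sm) bmod).
have GI := gauge_intertwines (nr_coords nrb) r1 r2 H.
set G := mx2 _ _ _ _ in GI.
have [s1 s2 s3 s4] := Rmat_size u q lam c b.
exists (G *m Rmat u q lam c b), (r11 * r22 * kap u q lam c b).
have sD (p r : {poly C}) n : (size p <= n)%N -> (size r <= n)%N -> (size (p + r)%R <= n)%N.
  by move=> sp sr'; rewrite (leq_trans (size_polyD _ _)) // geq_max sp sr'.
have sZ (x : C) (p : {poly C}) n : (size p <= n)%N -> (size (x%:P * p)%R <= n)%N.
  by move=> sp; rewrite mul_polyC (leq_trans (size_scale_leq _ _)).
have [g1 g2 g3 g4] : [/\ G 0 0 = r11%:P, G 0 1 = r12, G 1 0 = 0 & G 1 1 = r22%:P].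
  by rewrite /G !mx2E.
split.
- split; rewrite mul_mx2E ?g1 ?g2 ?g3 ?g4 ?mul0r ?add0r.
  + by apply: sD; [exact: sZ | exact: (@size_polyM_top _ 1 0)].
  + by apply: sD; [exact: sZ | exact: (@size_polyM_top _ 1 1)].
  + exact: sZ.
  + exact: sZ.
- by rewrite !mulf_neq0.
- move=> x; rewrite evmxM det_mulmx det_evRmat det_evmx det2E g1 g2 g3 g4.
  by rewrite mulr0 subr0 hornerM !hornerC mulrA.
- move=> z z0; rewrite !evmxM.
  rewrite -mulmxA scalemxAr (step_intertwines Hb k0 z0) -scalemxAr; congr (_ *: _).
  rewrite [LHS]mulmxA; rewrite [X in X *m _](GI z z0). by rewrite -mulmxA.
move=> Bmu; have nu0 : - u != 0 by rewrite oppr_eq0.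
have [_ Dmu] := D4_u u0 nr.
have B0 := bmat_step_one u0 q0 nr Hb k0 (sqrrN u) Dmu Bmu.
have := GI _ nu0; rewrite B0.
have -> : sigma u q (- u / q) = sigma u q (- u).
  by rewrite -(sigma_star' u0 q0 nu0); congr (sigma u q _); field.
have U : evmx G (sigma u q (- u)) \in unitmx.
  rewrite unitmxE unitfE det_evmx det2E g1 g2 g3 g4 mulr0 subr0 hornerM !hornerC.
  by rewrite mulf_neq0.
rewrite mul_mx_scalar -mul_scalar_mx => E.
by apply: (can_inj (mulmxK U)); rewrite -E.
Qed.

Variables (t tb f g fb gb : C).
Let p := (b 0 0).[t] / (Ppol u lam).[t].
Let pb := (bb 0 0).[tb] / (Ppol u lamb).[tb].
Hypothesis Bmu : bmat b (- u) = ((Ppol u lam).[- u])%:M.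
Hypotheses (t0 : t != 0) (tb0 : tb != 0).
Hypothesis b21E : b 1 0 = 'X * ('X^2 - (u ^+ 2)%:P) * ('X - t%:P) * ('X - (u ^+ 2 / t)%:P).
Hypothesis bb21E :
  bb 1 0 = 'X * ('X^2 - (u ^+ 2)%:P) * ('X - tb%:P) * ('X - (u ^+ 2 / tb)%:P).
Hypotheses (Pt : (Ppol u lam).[t] != 0) (Ptb : (Ppol u lamb).[tb] != 0).
Hypotheses (pt : p * u - t != 0) (ptb : pb * u - tb != 0).
Let x := t + u ^+ 2 / t.
Let y := (p * t - u) / (p * u - t).
Let xb := tb + u ^+ 2 / tb.
Let yb := (pb * tb - u) / (pb * u - tb).
Hypotheses (fd : f_den u lam x y != 0) (gd : g_den u lam x y != 0).
Hypotheses (fbd : f_den u lamb xb yb != 0) (gbd : g_den u lamb xb yb != 0).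
Hypotheses (fE : f = f_num u lam x y / f_den u lam x y)
           (gE : g = g_num u lam x y / g_den u lam x y).
Hypotheses (fbE : fb = f_num u lamb xb yb / f_den u lamb xb yb)
           (gbE : gb = g_num u lamb xb yb / g_den u lamb xb yb).

Lemma both_equations :
  (f * g - 1) * (fb * g - 1) * ((g - u ^+ 2 / z2 lam) * (g - u ^+ 2 / z4 lam)) *
    ((g - d1 lam * z6 lam) * (g - d2 lam * z6 lam)) =
  (f * g - u ^+ 2 / (z2 lam * z4 lam)) * (fb * g - u ^+ 2 / (q * z2 lam * z4 lam)) *
    (Pi4 lam).[g] /\
  (fb * gb - 1) * (fb * g - 1) * (1 - fb * (q * z2 lam)) * (1 - fb * (q * z4 lam)) *
   (u ^+ 2 * e_f u lamb * z6 lam) *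
   ((fb * d1 lamb - (e_f u lamb)^-1) * (fb * d2 lamb - (e_f u lamb)^-1)) =
  (fb * gb - u ^+ 2 / (q * z2 lam * (q * z4 lam))) *
   (fb * g - u ^+ 2 / (q * z2 lam * z4 lam)) * (q * (z2 lam * z4 lam)) *
   ((1 - fb * z1 lam) * (1 - fb * z3 lam) * (1 - fb * z5 lam) * (1 - fb * z6 lam)).
Proof.
have [R [kappa [sR k0 detR rel Bbmu']]] := structured_modification.
have Bbmu := Bbmu' Bmu.
have [h1 h2 h3] := g_coordinate t0 pt gd.
have [h4 h5] := f_coordinate t0 pt fd.
have [hb1 hb2 hb3] := g_coordinate tb0 ptb gbd.
have [hb4 hb5] := f_coordinate tb0 ptb fbd.
rewrite -gE in h3; rewrite -fE in h5; rewrite -gbE in hb3; rewrite -fbE in hb5.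
have tnu : t != - u by rewrite -addr_eq0.
have tbnu : tb != - u by rewrite -addr_eq0.
have [W sW rg] := g_row u0 nr Hb Bmu t0 tnu b21E Pt pt h2 h3.
have [V sV rf] := f_row u0 nr Hb Bmu t0 tnu b21E Pt pt h4 h5.
have [Wb sWb rgb] := g_row u0 nrb Hbb Bbmu tb0 tbnu bb21E Ptb ptb hb2 hb3.
have fu := f_row_unique u0 nrb
   tb0 bb21E Ptb hb4 hb5.
split.
  exact: (equation1 u0 q0 q1 nr Hb sR k0 detR rel b21E bb21E sW sV rg rf fu).
exact: (equation2 u0 q0 q1 nr Hb Hbb sR k0 detR rel bb21E sW sWb rg rgb fu).
Qed.

Hypothesis dd : d1 lam * d2 lam =
  (z1 lam * z3 lam * z5 lam) / (q * z2 lam * z4 lam * z6 lam).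

Lemma painleve_equations : qPE7_first u q lam f fb g /\ qPE7_second u q lamb fb gb g.
Proof.
have [[z10 z20 z30 z40] [z50 z60 d10 d20]] := coords_neq0 zn0.
have [E1 E2] := both_equations; split.
  rewrite /qPE7_first /= => dl dr; apply/eqP; rewrite eqr_div //; apply/eqP.
  have kk : kappa1 u lam / kappa2 u lam = u ^+ 2 / (z2 lam * z4 lam).
    by rewrite /kappa1 /kappa2; field; rewrite u0 z20 z40.
  have kq : kappa1 u lam / (q * kappa2 u lam) = u ^+ 2 / (q * z2 lam * z4 lam).
    by rewrite /kappa1 /kappa2; field; rewrite u0 q0 z20 z40.
  have n5 : nu5 u lam / kappa2 u lam = u ^+ 2 / z2 lam.
    by rewrite /nu5 /kappa2; field; rewrite u0 z20 z40.
  have n6 : nu6 u lam / kappa2 u lam = u ^+ 2 / z4 lam.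
    by rewrite /nu6 /kappa2; field; rewrite u0 z40.
  have n7 : nu7 u lam / kappa2 u lam = d1 lam * z6 lam.
    by rewrite /nu7 /kappa2; field; rewrite u0 z40.
  have n8 : nu8 u lam / kappa2 u lam = d2 lam * z6 lam.
    by rewrite /nu8 /kappa2; field; rewrite u0 z40.
  rewrite kk kq n5 n6 n7 n8 /nu1 /nu2 /nu3 /nu4 !div1r !invrK.
  move: E1; rewrite horner_Pi4 => E1.
  transitivity ((f * g - u ^+ 2 / (z2 lam * z4 lam)) * (fb * g - u ^+ 2 / (q * z2 lam * z4 lam)) *
    ((g - z1 lam) * (g - z3 lam) * (g - z5 lam) * (g - z6 lam))); first by ring.
  by rewrite -E1; ring.
rewrite /qPE7_second /= => dl dr; apply/eqP; rewrite eqr_div //; apply/eqP.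
have kk : kappa1 u lamb / kappa2 u lamb = u ^+ 2 / (q * z2 lam * (q * z4 lam)).
  by rewrite /kappa1 /kappa2 /=; field; rewrite u0 q0 z20 z40.
have kq : q * kappa1 u lamb / kappa2 u lamb = u ^+ 2 / (q * z2 lam * z4 lam).
  by rewrite /kappa1 /kappa2 /=; field; rewrite u0 q0 z20 z40.
have n5 : kappa1 u lamb / nu5 u lamb = (q * z4 lam)^-1.
  by rewrite /nu5 /kappa1 /=; field; rewrite u0 q0 z20 z40.
have n6 : kappa1 u lamb / nu6 u lamb = (q * z2 lam)^-1.
  by rewrite /nu6 /kappa1 /=; field; rewrite u0 q0 z20.
have n7 : kappa1 u lamb / nu7 u lamb = (e_f u lamb * d1 lamb)^-1.
  by rewrite /nu7 /kappa1 /e_f /=; field; rewrite u0 q0 z20 z40 z60 d10.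
have n8 : kappa1 u lamb / nu8 u lamb = (e_f u lamb * d2 lamb)^-1.
  by rewrite /nu8 /kappa1 /e_f /=; field; rewrite u0 q0 z20 z40 z60 d20.
rewrite kk kq n5 n6 n7 n8 /nu1 /nu2 /nu3 /nu4.
have e0 : e_f u lamb != 0 := e_f_neq0 u0 (nr_coords nrb).
have d10b : d1 lamb != 0 by rewrite /= mulf_neq0 ?invr_neq0.
have d20b : d2 lamb != 0 by rewrite /= mulf_neq0 ?invr_neq0.
(* Agreement of the constants on the two sides of the second equation; the relation between d1 d2
   and the z_i is used here. *)
have eK : u ^+ 2 * e_f u lamb * (d1 lamb * d2 lamb) * z6 lam * (q ^+ 2 * (z2 lam * z4 lam)) =
   q * (z2 lam * z4 lam) * (z1 lam * z3 lam * z5 lam * z6 lam).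
  rewrite /e_f /= (_ : q^-1 * d1 lam * (q^-1 * d2 lam) = q^-1 ^+ 2 * (d1 lam * d2 lam)); last by ring.
  by rewrite dd; field; rewrite u0 q0 z20 z40 z60.
have K0 : q * (z2 lam * z4 lam) * (z1 lam * z3 lam * z5 lam * z6 lam) != 0.
  by rewrite !mulf_neq0.
apply: (mulfI K0).
transitivity ((fb * gb - u ^+ 2 / (q * z2 lam * (q * z4 lam))) *
   (fb * g - u ^+ 2 / (q * z2 lam * z4 lam)) * (q * (z2 lam * z4 lam)) *
   ((1 - fb * z1 lam) * (1 - fb * z3 lam) * (1 - fb * z5 lam) * (1 - fb * z6 lam))).
  move: (u ^+ 2 / (q * z2 lam * (q * z4 lam))) (u ^+ 2 / (q * z2 lam * z4 lam)) => k k'.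
  by field; rewrite z10 z30 z50 z60.
rewrite -E2 -eK; move: (e_f u lamb) (d1 lamb) (d2 lamb) e0 d10b d20b => e a1 a2 e0 a10 a20.
by field; rewrite q0 z20 z40 e0 a10 a20.
Qed.

End TwoConnections.
End Painleve.

(** * Regularity *)

Section Regular.
Variable C : numClosedFieldType.
Implicit Types (b : 'M[{poly C}]_2) (F G : 'M[{poly C}]_2 -> {poly C})
  (f g : 'M[{poly C}]_2 -> C).

(** The range of coefficient indices recorded by [coefs]: within it b is recovered from its
    coefficients. *)
Definition wide b := forall i j, (size (b i j) <= 9)%N.
Notation spec b := (map_poly (meval (coefs b)) : {poly Defs.coef_poly C} -> {poly C}).

Definition coef_fun f := exists h : Defs.coef_poly C, forall b, wide b -> f b = h.@[coefs b].
Definition coef_polyfun F :=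
  exists H : {poly Defs.coef_poly C}, forall b, wide b -> F b = map_poly (meval (coefs b)) H.

Lemma coef_polyfun_cst p : coef_polyfun (fun=> p).
Proof.
exists (map_poly (@mpolyC #|{: coef_index}| C) p) => b _; apply/polyP => i.
by rewrite !coef_map /= mevalC.
Qed.

Lemma coef_polyfun_add F G : coef_polyfun F -> coef_polyfun G ->
  coef_polyfun (fun b => F b + G b).
Proof. by move=> [H HF] [K HG]; exists (H + K) => b wb; rewrite rmorphD /= HF ?HG. Qed.

Lemma coef_polyfun_opp F : coef_polyfun F -> coef_polyfun (fun b => - F b).
Proof. by move=> [H HF]; exists (- H) => b wb; rewrite rmorphN /= HF. Qed.

Lemma coef_polyfun_mul F G : coef_polyfun F -> coef_polyfun G ->
  coef_polyfun (fun b => F b * G b).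
Proof. by move=> [H HF] [K HG]; exists (H * K) => b wb; rewrite rmorphM /= HF ?HG. Qed.

Lemma coef_polyfun_polyC f : coef_fun f -> coef_polyfun (fun b => (f b)%:P).
Proof. by move=> [h hE]; exists h%:P => b wb; rewrite map_polyC /= hE. Qed.

Lemma coef_polyfun_scale f G : coef_fun f -> coef_polyfun G ->
  coef_polyfun (fun b => f b *: G b).
Proof.
move=> hf hG; have [H HE] := coef_polyfun_mul (coef_polyfun_polyC hf) hG.
by exists H => b wb; rewrite -mul_polyC HE.
Qed.

Lemma coef_polyfun_sum n (Fs : nat -> 'M[{poly C}]_2 -> {poly C}) :
  (forall i, coef_polyfun (Fs i)) -> coef_polyfun (fun b => \sum_(i < n) Fs i b).
Proof.
move=> HF; elim: n => [|n [H IH]].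
  by exists 0 => b _; rewrite big_ord0 raddf0.
have [K HK] := HF n; exists (H + K) => b wb.
by rewrite big_ord_recr /= rmorphD /= -IH // -HK.
Qed.

Lemma coef_fun_coef F i : coef_polyfun F -> coef_fun (fun b => (F b)`_i).
Proof. by move=> [H HF]; exists H`_i => b wb; rewrite HF // coef_map. Qed.

Lemma coef_fun_horner F x : coef_polyfun F -> coef_fun (fun b => (F b).[x]).
Proof.
move=> [H HF]; exists H.[x%:MP] => b wb.
have /= <- := horner_map (meval (coefs b)) H x%:MP.
by rewrite HF //= mevalC.
Qed.

Lemma coef_fun_cst a : coef_fun (fun=> a).
Proof. by exists a%:MP => b _; rewrite mevalC. Qed.

Lemma coef_fun_add f g : coef_fun f -> coef_fun g -> coef_fun (fun b => f b + g b).
Proof. by move=> [h hE] [k kE]; exists (h + k) => b wb; rewrite mevalD hE ?kE. Qed.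

Lemma coef_fun_mul f g : coef_fun f -> coef_fun g -> coef_fun (fun b => f b * g b).
Proof. by move=> [h hE] [k kE]; exists (h * k) => b wb; rewrite mevalM hE ?kE. Qed.

Lemma coef_fun_opp f : coef_fun f -> coef_fun (fun b => - f b).
Proof. by move=> [h hE]; exists (- h) => b wb; rewrite mevalN hE. Qed.

Lemma coef_polyfun_entry i j : coef_polyfun (fun b => b i j).
Proof.
exists (\poly_(k < 9) 'X_(enum_rank ((i, j, inord k) : coef_index))) => b wb.
apply/polyP => k; rewrite coef_map coef_poly /=.
case: ltnP => kn; last by rewrite meval0 nth_default // (leq_trans (wb i j)).
by rewrite mevalXU /coefs enum_rankK inordK.
Qed.

Lemma coef_polyfun_drop n F : coef_polyfun F -> coef_polyfun (fun b => drop_poly n (F b)).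
Proof.
move=> [H HF]; exists (drop_poly n H) => b wb; apply/polyP => i.
by rewrite coef_drop_poly HF // !coef_map coef_drop_poly.
Qed.

Lemma coef_polyfun_zlift a c n F : coef_polyfun F ->
  coef_polyfun (fun b => zlift a c n (F b)).
Proof.
move=> HF; rewrite /zlift; apply: (@coef_polyfun_sum n.+1 (fun i b =>
  (F b)`_i *: ((a *: 'X^2 + c%:P) ^+ i * 'X^(n - i)))) => i.
by apply: coef_polyfun_scale; [exact: coef_fun_coef | exact: coef_polyfun_cst].
Qed.

(** Division by a monic polynomial can be done over the ring of polynomials in the coefficients, and
    it commutes with specialization by uniqueness of quotient and remainder. *)
Lemma coef_polyfun_div F (D : {poly C}) : D \is monic -> coef_polyfun F ->
  coef_polyfun (fun b => F b %/ D).
Proof.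
move=> mD [H HF]; pose D' : {poly Defs.coef_poly C} := map_poly (@mpolyC #|{: coef_index}| C) D.
have mD' : D' \is monic by rewrite monic_map.
have sD' : size D' = size D by rewrite size_map_poly_id0 // (monicP mD) rmorph1 oner_neq0.
exists (Pdiv.CommonRing.rdivp H D') => b wb.
have ED : spec b D' = D by apply/polyP => i; rewrite !coef_map /= mevalC.
have E := Pdiv.RingMonic.rdivp_eq mD' H.
rewrite HF // {1}E rmorphD rmorphM /= ED.
apply/esym; apply: (divpP (r := spec b (Pdiv.CommonRing.rmodp H D'))) => //.
rewrite (leq_ltn_trans (size_poly _ _)) // -sD'.
by rewrite Pdiv.CommonRing.ltn_rmodp monic_neq0.
Qed.


Lemma coef_polyfun_ext F G : (forall b, F b = G b) -> coef_polyfun F -> coef_polyfun G.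
Proof. by move=> E [H HF]; exists H => b wb; rewrite -E HF. Qed.

Section StepRegular.
Variables u q : C.
Variable lam : param C.
Variable c : chart C.

Definition coef_mxfun (M : 'M[{poly C}]_2 -> 'M[{poly C}]_2) :=
  forall i j, coef_polyfun (fun b => M b i j).

Lemma coef_mxfun_mx2 F1 F2 F3 F4 : coef_polyfun F1 -> coef_polyfun F2 ->
  coef_polyfun F3 -> coef_polyfun F4 ->
  coef_mxfun (fun b => mx2 (F1 b) (F2 b) (F3 b) (F4 b)).
Proof.
by move=> H1 H2 H3 H4; apply: ord2P; apply: ord2P;
  [move: H1 | move: H2 | move: H3 | move: H4]; apply: coef_polyfun_ext => b;
  rewrite mx2E.
Qed.

Lemma coef_mxfun_mul M N : coef_mxfun M -> coef_mxfun N ->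
  coef_mxfun (fun b => M b *m N b).
Proof.
move=> HM HN i j.
apply: (coef_polyfun_ext _ (coef_polyfun_add (coef_polyfun_mul (HM i 0) (HN 0 j))
                                   (coef_polyfun_mul (HM i 1) (HN 1 j)))) => b.
by rewrite mul_mx2E.
Qed.

Lemma coef_fun_kvec1 x y s : coef_fun (kvec1 x y s).
Proof.
apply: coef_fun_add; apply: coef_fun_mul; do ?exact: coef_fun_cst.
  apply: coef_fun_mul; last exact: coef_fun_cst.
  exact: coef_fun_horner (coef_polyfun_entry 0 1).
exact: coef_fun_horner (coef_polyfun_entry 1 1).
Qed.

Lemma coef_fun_kvec2 x y s : coef_fun (kvec2 x y s).
Proof.
apply: coef_fun_opp.
apply: coef_fun_add; apply: coef_fun_mul; do ?exact: coef_fun_cst.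
  exact: coef_fun_horner (coef_polyfun_entry 0 0).
exact: coef_fun_horner (coef_polyfun_entry 1 0).
Qed.

Let cf_al2 : coef_fun (al2 lam c) := coef_fun_kvec1 _ _ _.
Let cf_be2 : coef_fun (be2 lam c) := coef_fun_kvec2 _ _ _.
Let cf_al4 : coef_fun (al4 lam c) := coef_fun_kvec1 _ _ _.
Let cf_be4 : coef_fun (be4 lam c) := coef_fun_kvec2 _ _ _.

Ltac coef_fun_tac := repeat first [exact: cf_al2 | exact: cf_be2 | exact: cf_al4
  | exact: cf_be4 | exact: coef_fun_cst | exact: coef_polyfun_cst | apply: coef_fun_add | apply: coef_fun_opp
  | apply: coef_fun_mul | apply: coef_polyfun_add | apply: coef_polyfun_opp
  | apply: coef_polyfun_polyC | apply: coef_polyfun_scale].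

Lemma coef_fun_kap : coef_fun (kap u q lam c).
Proof. rewrite /kap; coef_fun_tac. Qed.

Lemma coef_mxfun_Rmat : coef_mxfun (Rmat u q lam c).
Proof. by apply: coef_mxfun_mx2; coef_fun_tac. Qed.

Lemma coef_mxfun_Nsharp : coef_mxfun (Nsharp u q lam c).
Proof.
have HR := coef_mxfun_Rmat.
apply: coef_mxfun_mul; first apply: coef_mxfun_mul; apply: coef_mxfun_mx2;
  do ?[apply: coef_polyfun_opp]; do ?[by apply: coef_polyfun_zlift; exact: HR].
- exact: coef_polyfun_entry.
- exact: coef_polyfun_entry.
- by apply: coef_polyfun_drop; exact: coef_polyfun_entry.
- exact: coef_polyfun_entry.
Qed.

Definition step_num b : 'M[{poly C}]_2 := mx2
  (Nsharp u q lam c b 0 0 %/ D4 u lam) (Nsharp u q lam c b 0 1 %/ D4 u lam)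
  ('X * (Nsharp u q lam c b 1 0 %/ D4 u lam)) (Nsharp u q lam c b 1 1 %/ D4 u lam).

Lemma coef_mxfun_step_num : coef_mxfun step_num.
Proof.
have mD : D4 u lam \is monic by exact: monic_prod_XsubC.
have H i j := coef_polyfun_div mD (coef_mxfun_Nsharp i j).
apply: coef_mxfun_mx2; do ?exact: H.
by apply: coef_polyfun_mul; [exact: coef_polyfun_cst | exact: H].
Qed.

Lemma coefs_step b k : kap u q lam c b != 0 ->
  kap u q lam c b * coefs (step u q lam c b) k = coefs (step_num b) k.
Proof.
move=> k0; rewrite /coefs; case: (enum_val k) => -[i j] l.
by rewrite /step -/(step_num b) mxE coefCM mulrA mulfV // mul1r.
Qed.

Lemma coef_fun_coefs_step k : coef_fun (fun b => coefs (step_num b) k).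
Proof.
have H i j l : coef_fun (fun b => (step_num b i j)`_l).
  exact: coef_fun_coef (coef_mxfun_step_num i j).
by rewrite /coefs; case: (enum_val k) => -[i j] l; exact: H.
Qed.

(** Membership in the localization at [kap]: the power n clears the denominators that [step]
    introduces. *)
Definition kap_fraction f := exists n (H : Defs.coef_poly C), forall b, wide b ->
  kap u q lam c b != 0 -> f b * kap u q lam c b ^+ n = H.@[coefs b].

Lemma kap_fraction_cst a : kap_fraction (fun=> a).
Proof. by exists 0, a%:MP => b _ _; rewrite mulr1 mevalC. Qed.

Lemma kap_fraction_add f g : kap_fraction f -> kap_fraction g ->
  kap_fraction (fun b => f b + g b).
Proof.
have [K HK] := coef_fun_kap.
move=> [n [H HE]] [n' [H' HE']]; exists (n + n')%N, (H * K ^+ n' + H' * K ^+ n) => b wb k0.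
by rewrite mevalD !mevalM !rmorphXn /= -HK // -HE // -HE' // exprD; ring.
Qed.

Lemma kap_fraction_mul f g : kap_fraction f -> kap_fraction g ->
  kap_fraction (fun b => f b * g b).
Proof.
move=> [n [H HE]] [n' [H' HE']]; exists (n + n')%N, (H * H') => b wb k0.
by rewrite mevalM -HE // -HE' // exprD; ring.
Qed.

Lemma kap_fraction_meval h : kap_fraction (fun b => h.@[coefs (step u q lam c b)]).
Proof.
have Hk k : kap_fraction (fun b => coefs (step u q lam c b) k).
  have [H HE] := coef_fun_coefs_step k; exists 1%N, H => b wb k0.
  by rewrite expr1 mulrC coefs_step // HE.
have Hx k m : kap_fraction (fun b => coefs (step u q lam c b) k ^+ m).
  elim: m => [|m IH]; first exact: kap_fraction_cst.
  have [n [H HE]] := kap_fraction_mul (Hk k) IH.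
  by exists n, H => b wb k0; rewrite exprS HE.
have Hm (m : 'X_{1.. #|{: coef_index}|}) (s : seq 'I_#|{: coef_index}|) :
  kap_fraction (fun b => \prod_(i <- s) coefs (step u q lam c b) i ^+ m i).
  elim: s => [|i s IH].
    by have [n [H HE]] := kap_fraction_cst 1; exists n, H => b wb k0; rewrite big_nil HE.
  have [n [H HE]] := kap_fraction_mul (Hx i (m i)) IH.
  by exists n, H => b wb k0; rewrite big_cons HE.
elim/mpolyind: h => [|a m p _ _ IH].
  by have [n [H HE]] := kap_fraction_cst 0; exists n, H => b wb k0; rewrite meval0 HE.
have [n [H HE]] := kap_fraction_add (kap_fraction_mul (kap_fraction_cst a) (Hm m (index_enum _))) IH.
by exists n, H => b wb k0; rewrite mevalD mevalZ mevalX HE.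
Qed.

End StepRegular.

(** * Regularity of a map given chartwise by the explicit step *)

Section Morphism.
Variables u q : C.
Variables lam lamb : param C.
Variable phi : moduli u q lam -> moduli u q lamb.
Hypothesis wide_moduli : forall (m : moduli u q lam) b, sval m b -> wide b.
Hypothesis chart_moduli : forall (m : moduli u q lam) b, sval m b -> exists c, kap u q lam c b != 0.
Hypothesis phi_step : forall m b c, sval m b -> kap u q lam c b != 0 ->
  sval (phi m) (step u q lam c b).

(** The loci kap != 0 cover the moduli space, and on each of them phi is given by [step], whose
    coefficients are polynomials divided by [kap]. Preimages and pullbacks are computed there after
    clearing powers of [kap]. *)
Lemma regular_morphism_step : regular_morphism phi.
Proof.
move=> V [I VI]; split.
  (* The family is described by what nonvanishing means: the chart is valid and h, taken from I, is
     nonzero after the step. The polynomial [H * K] below realizes this for a given chart and h. *)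
  exists (fun h' : Defs.coef_poly C => exists (c : chart C) h, I h /\ forall (m : moduli u q lam) b, sval m b ->
    (h'.@[coefs b] != 0 <-> kap u q lam c b != 0 /\ h.@[coefs (step u q lam c b)] != 0)).
  move=> m b mb; split; last first.
    move=> [h' [c [h [Ih hE]]] /(hE m b mb) [k0 h0]].
    by apply/(VI _ _ (phi_step mb k0)); exists h.
  have [c k0] := chart_moduli mb.
  move=> /(VI _ _ (phi_step mb k0)) [h Ih h0].
  have [K KE] := coef_fun_kap u q lam c; have [n [H HE]] := kap_fraction_meval u q lam c h.
  have hE (m' : moduli u q lam) b' : sval m' b' -> ((H * K).@[coefs b'] != 0 <->
      kap u q lam c b' != 0 /\ h.@[coefs (step u q lam c b')] != 0).
    move=> mb'; have wb := wide_moduli mb'; rewrite mevalM -(KE _ wb).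
    have {HE KE} := HE b' wb; move: (H.@[_]) (h.@[_]) (kap u q lam c b') => y x k yE.
    have [->|k0'] := eqVneq k 0; first by rewrite mulr0 eqxx; split=> [|[]].
    rewrite -yE // !mulf_eq0 !negb_or k0' expf_neq0 // !andbT.
    by split=> [|[]].
  by exists (H * K); [exists c, h; split | apply/(hE m b mb)].
move=> F reg m b Vm mb.
have [c k0] := chart_moduli mb.
have [num [den [d0 FE]]] := reg _ _ Vm (phi_step mb k0).
have [K KE] := coef_fun_kap u q lam c.
have [n [H HE]] := kap_fraction_meval u q lam c num.
have [n' [H' HE']] := kap_fraction_meval u q lam c den.
(* The powers of [K] clear the two denominators crosswise. The last factor [K] makes a nonzero
   denominator imply that the chart is valid at b' too. *)
exists (H * K ^+ n' * K), (H' * K ^+ n * K).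
have wb := wide_moduli mb; split.
  by rewrite !mevalM rmorphXn /= -!(KE _ wb) -(HE' _ wb k0) mulf_neq0 // mulf_neq0 ?expf_neq0 // mulf_neq0 ?expf_neq0.
move=> m' b' Vm' mb'; have wb' := wide_moduli mb'.
rewrite !mevalM !rmorphXn /= -!(KE _ wb') => D0.
have k0' : kap u q lam c b' != 0 by apply: contraNneq D0 => ->; rewrite mulr0.
rewrite -(HE' _ wb' k0') in D0; rewrite -(HE _ wb' k0') -(HE' _ wb' k0').
have d0' : den.@[coefs (step u q lam c b')] != 0.
  by apply: contraNneq D0 => ->; rewrite !mul0r.
rewrite (FE _ _ Vm' (phi_step mb' k0') d0').
move: (num.@[_]) (den.@[_]) (kap u q lam c b') d0' k0' => x y k d0' k0'.
by field; rewrite k0' d0' !expf_neq0.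
Qed.

End Morphism.
End Regular.

(** * The map between the moduli spaces *)

Section Moduli.
Variable C : numClosedFieldType.
Variables u q : C.
Hypotheses (u0 : u != 0) (q0 : q != 0) (q1 : forall k, (0 < k)%N -> q ^+ k != 1).

(* If b_21 = 0 then b_11 divides P Q up to a constant and has leading coefficient
   d1 or d2, so b_11(u) = P(u) is one of finitely many relations between the
   parameters. *)
Definition irreducible_type lam := forall (e : bool) (m : bitseq),
  (if e then d1 lam else d2 lam) * \prod_(r <- mask m (all_roots u lam)) (u - r)
  != (Ppol u lam).[u].

Variable lam : param C.
Hypotheses (nr : nonresonant u q lam) (irr : irreducible_type lam).
Let zn0 := nr_coords nr.
Let lamb := lambda_bar q lam.
Let nrb : nonresonant u q lamb := nonresonant_bar q0 nr.
Implicit Types (b : 'M[{poly C}]_2).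

Lemma b21_neq0 b : matrix_type u q lam b -> b 1 0 != 0.
Proof.
move=> Hb; apply/negP => /eqP Z.
have PQ : b 0 0 * b 1 1 = Ppol u lam * Qpol u lam.
  apply: (mulfI (negbT (polyX_eq0 C))).
  by have := det_poly Hb; rewrite Z mulr0 subr0.
have [[z10 z20 z30 z40] [z50 z60 _ _]] := coords_neq0 zn0.
have L0 : PQ_lead lam != 0 by rewrite /PQ_lead !mulf_neq0 ?invr_neq0 ?mulf_neq0.
have dv : b 0 0 %| \prod_(r <- all_roots u lam) ('X - r%:P).
  have : b 0 0 %| PQ_lead lam *: \prod_(r <- all_roots u lam) ('X - r%:P).
    by rewrite -PQ_prod -PQ dvdp_mulr.
  by rewrite dvdpZr.
have [m Em] := dvdp_prod_XsubC dv.
have [s1 _ _ s4] := mt_size Hb.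
(* The product b_11 b_22 has degree 12 and both factors have degree at most 6, so b_11 has degree
   exactly 6 and its leading coefficient a is the entry of the limit. *)
have sPQ : size (b 0 0 * b 1 1) = 13%N.
  by rewrite PQ PQ_prod size_scale // size_prod_XsubC.
have nz : b 0 0 * b 1 1 != 0 by rewrite -size_poly_eq0 sPQ.
have [b00 b11] : b 0 0 != 0 /\ b 1 1 != 0.
  by move: nz; rewrite mulf_eq0 negb_or => /andP[].
have s00 : size (b 0 0) = 7%N.
  apply/eqP; rewrite eqn_leq s1 -(leq_add2r 7) /=.
  have -> : (7 + 7 = size (b 0%R 0%R) + size (b 1%R 1%R))%N.
    by move: sPQ; rewrite (size_mul b00 b11); case: addn => // k /= ->.
  by rewrite leq_add2l.
have [tr dt] := limit_trace_det q0 Hb; rewrite Z coef0 mulr0 subr0 in dt.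
set a := (b 0 0)`_6 in tr dt.
have aE : a = lead_coef (b 0 0) by rewrite lead_coefE s00.
(* With b_21 = 0 the limit is triangular, so a is one of its eigenvalues d1, d2. *)
have ad : (a - d1 lam) * (a - d2 lam) = 0.
  have tr' : (b 1 1)`_6 / q = d1 lam + d2 lam - a by rewrite -tr; ring.
  have dt' : a * ((b 1 1)`_6 / q) = d1 lam * d2 lam.
    by apply: (mulfI q0); rewrite -dt; field.
  rewrite [LHS](_ : _ = d1 lam * d2 lam - a * (d1 lam + d2 lam - a)); last by ring.
  by rewrite -tr' dt' subrr.
have bE : b 0 0 = a *: \prod_(r <- mask m (all_roots u lam)) ('X - r%:P).
  have mon : \prod_(r <- mask m (all_roots u lam)) ('X - r%:P) \is monic.
    exact: monic_prod_XsubC.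
  move: Em => /eqp_eq; rewrite (monicP mon) scale1r -aE => ->.
  by [].
have bu : (b 0 0).[u] = (Ppol u lam).[u].
  by have := congr1 (fun A : 'M[C]_2 => A 0 0) (mt_one Hb); rewrite mx2E mxE eqxx mulr1n.
have hu : (b 0 0).[u] = a * \prod_(r <- mask m (all_roots u lam)) (u - r).
  rewrite bE hornerZ horner_prod; congr (_ * _); apply: eq_bigr => r _.
  by rewrite hornerXsubC.
move/eqP: ad; rewrite mulf_eq0 !subr_eq0 => /orP[] /eqP ad.
  by have := irr true m; rewrite -bu hu ad eqxx.
by have := irr false m; rewrite -bu hu ad eqxx.
Qed.

Let typeP (b : 'M[{poly C}]_2) : has_type u q lam b <-> matrix_type u q lam b :=
  has_typeP u0 q0 zn0 (proj1 (Ppol_u_neq0 u0 nr)) b.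
Let typebP (b : 'M[{poly C}]_2) : has_type u q lamb b <-> matrix_type u q lamb b :=
  has_typeP u0 q0 (nr_coords nrb) (proj1 (Ppol_u_neq0 u0 nrb)) b.

Lemma gauge_refl (la : param C) b : gauge_equiv u q la b b.
Proof.
exists 1, 1, 0; split; rewrite ?oner_neq0 ?size_poly0 // => R z _ _.
have RE x : R x = 1%:M by rewrite /R horner0 scalar_mx2.
by rewrite !RE invmx1 mulmx1 mul1mx.
Qed.

Lemma moduli_type (la : param C) (m : moduli u q la) b : sval m b -> has_type u q la b.
Proof. by case: m => m [b0 _ /= ->] []. Qed.

Lemma moduli_modification (la : param C) (m : moduli u q la) b b' :
  sval m b -> sval m b' -> modification u q la la b b'.
Proof.
case: m => m [b0 _ /= ->] [_ g1] [_ g2].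
exact: (modification_trans u0 q0 (modification_sym u0 q0 (gauge_modification g1))
         (gauge_modification g2)).
Qed.

Lemma modification_exists (m : moduli u q lam) : exists m' : moduli u q lamb,
  exists b bb, [/\ sval m b, sval m' bb & modification u q lam lamb b bb].
Proof.
case: (m) => S [b0 tb0 SE].
have Hb := (typeP b0).1 tb0.
have [c k0] := exists_chart u0 q0 nr Hb (b21_neq0 Hb).
have tb := (typebP _).2 (step_type u0 q0 nr Hb k0).
exists (exist _ (gauge_class u q lamb (step u q lam c b0)) (ex_intro2 _ _ _ tb erefl)).
exists b0, (step u q lam c b0); split=> /=.
- by rewrite SE; split=> //; exact: gauge_refl.
- by split=> //; exact: gauge_refl.
- exact: step_modification.
Qed.

(** A modified class is chosen for each class. Modification being symmetric and transitive, every
    representative is related to it; uniqueness up to gauge shows that it is the only class so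
    related. *)
Lemma modification_map_exists : exists phi : moduli u q lam -> moduli u q lamb,
  modification_map phi.
Proof.
have [phi phiP] := choice modification_exists; exists phi => m b b' mb tb'.
have [b1 [bb [mb1 mbb md]]] := phiP m.
have md' : modification u q lam lamb b bb.
  exact: (modification_trans u0 q0 (moduli_modification mb mb1) md).
split=> [mod | mb']; last first.
  exact: (modification_trans u0 q0 md' (moduli_modification mbb mb')).
have [bb0 tbb0 phiE] := svalP (phi m).
have mbb0 : sval (phi m) bb0 by rewrite phiE; split=> //; exact: gauge_refl.
rewrite phiE; split=> //.
apply: (gauge_of_modification u0 q0 q1 nrb ((typebP _).1 tbb0) ((typebP _).1 tb')).
apply: (modification_trans u0 q0 (moduli_modification mbb0 mbb)).
exact: (modification_trans u0 q0 (modification_sym u0 q0 md') mod).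
Qed.

Lemma modification_map_regular (phi : moduli u q lam -> moduli u q lamb) :
  modification_map phi -> regular_morphism phi.
Proof.
move=> mm; apply: (@regular_morphism_step _ u q lam).
- move=> m b /moduli_type /typeP Hb; have [s1 s2 s3 s4] := mt_size Hb.
  by apply: ord2P; apply: ord2P; rewrite // ?(leq_trans s1) ?(leq_trans s3) ?(leq_trans s4).
- by move=> m b /moduli_type /typeP Hb; exact: (exists_chart u0 q0 nr Hb (b21_neq0 Hb)).
move=> m b c mb k0; have /typeP Hb := moduli_type mb.
have tb := (typebP _).2 (step_type u0 q0 nr Hb k0).
by apply/(mm _ _ _ mb tb); exact: step_modification.
Qed.

Hypothesis dd : d1 lam * d2 lam =
  (z1 lam * z3 lam * z5 lam) / (q * z2 lam * z4 lam * z6 lam).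

Lemma modification_map_painleve (phi : moduli u q lam -> moduli u q lamb)
    (m : moduli u q lam) f g fb gb :
  modification_map phi -> identity_at_minus_u m ->
  coordinates m f g -> coordinates (phi m) fb gb ->
  qPE7_first u q lam f fb g /\ qPE7_second u q lamb fb gb g.
Proof.
move=> mm idm [b [t [p [mb [t0 bE] [Pt pE] pt [fd gd fE gE]]]]].
move=> [bb [tb [pb [mbb [tb0 bbE] [Ptb pbE] ptb [fbd gbd fbE gbE]]]]].
subst p pb.
have /typeP Hb := moduli_type mb; have tbb := moduli_type mbb.
have Hbb := (typebP _).1 tbb.
have md := (mm _ _ _ mb tbb).2 mbb.
have [_ Pnu] := Ppol_u_neq0 u0 nr.
have Bmu : bmat b (- u) = ((Ppol u lam).[- u])%:M.
  by rewrite (bmatE b Pnu) idm // scalemx1.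
exact: (painleve_equations u0 q0 q1 nr Hb Hbb (b21_neq0 Hb) md Bmu t0 tb0 bE bbE
   Pt Ptb pt ptb fd gd fbd gbd fE gE fbE gbE dd).
Qed.

End Moduli.

(** * Genericity *)

Section Generic.
Variable C : numClosedFieldType.
Variables u q : C.
Hypotheses (u0 : u != 0) (q0 : q != 0).
Implicit Types lam : param C.

(** A countable type, so that its codes can be enumerated into the sequence of polynomials that
    [generic] asks for. *)
Definition genericity_code :=
  (('I_6 * 'I_6 * int) + ('I_6 * 'I_6 * int) + (int + bool * bitseq))%type.

Let widen6 : 'I_6 -> 'I_8 := widen_ord (isT : (6 <= 8)%N).
Let Z (i : 'I_6) : {mpoly C[8]} := 'X_(widen6 i).
Let D1 : {mpoly C[8]} := 'X_(Ordinal (isT : (6 < 8)%N)).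
Let D2 : {mpoly C[8]} := 'X_(Ordinal (isT : (7 < 8)%N)).
Let Num (c : bool * 'I_6) : {mpoly C[8]} :=
  if c.1 then u%:MP * Z c.2 - (u ^+ 2)%:MP else u%:MP - Z c.2.
Let Den (c : bool * 'I_6) : {mpoly C[8]} := if c.1 then Z c.2 else 1.
Let Pcodes := take 6 root_codes.

(* The conditions of [nonresonant] and [irreducible_type], multiplied by the z_i in
   the denominators. *)
Definition genericity_poly (c : genericity_code) : {mpoly C[8]} :=
  match c with
  | inl (inl (i, j, n)) => if i == j then 1 else Z i - (q ^ n)%:MP * Z j
  | inl (inr (i, j, n)) => Z i * Z j - (q ^ n * u ^+ 2)%:MP
  | inr (inl n) => D1 - (q ^ n)%:MP * D2
  | inr (inr (e, m)) =>
      (if e then D1 else D2) * (\prod_(c <- mask m root_codes) Num c) *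
        (\prod_(c <- Pcodes) Den c) -
      (\prod_(c <- mask m root_codes) Den c) * (\prod_(c <- Pcodes) Num c)
  end.

Lemma meval_Z lam i : (Z i).@[param_coords lam] = zcoord lam i.
Proof. by rewrite mevalXU; case: i => [[|[|[|[|[|[|i]]]]]] Hi]. Qed.

Lemma meval_D1 lam : D1.@[param_coords lam] = d1 lam.
Proof. by rewrite mevalXU. Qed.

Lemma meval_D2 lam : D2.@[param_coords lam] = d2 lam.
Proof. by rewrite mevalXU. Qed.

Lemma meval_Den lam c : (Den c).@[param_coords lam] = if c.1 then zcoord lam c.2 else 1.
Proof. by rewrite /Den; case: c.1; rewrite ?meval1 ?meval_Z. Qed.

Lemma meval_Num lam c : (forall k, param_coords lam k != 0) ->
  (Num c).@[param_coords lam] = (u - star_root u lam c) * (Den c).@[param_coords lam].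
Proof.
move=> zn; rewrite meval_Den /Num /star_root; case: c => -[] i /=.
  by rewrite mevalB mevalM !mevalC meval_Z; field; exact: zcoord_neq0.
by rewrite mevalB mevalC meval_Z mulr1.
Qed.

Lemma genericity_nonresonant lam : parameter_space q lam ->
  (forall c, (genericity_poly c).@[param_coords lam] != 0) ->
  nonresonant u q lam /\ irreducible_type u lam.
Proof.
move=> [zn dd] H; split; first split => //.
- move=> i j n ij; have := H (inl (inl (i, j, n))); rewrite /= (negbTE ij).
  by rewrite mevalB mevalM mevalC !meval_Z subr_eq0.
- move=> i j n; have := H (inl (inr (i, j, n))).
  by rewrite /= mevalB mevalM mevalC !meval_Z subr_eq0.
- move=> n; have := H (inr (inl n)).
  by rewrite /= mevalB mevalM mevalC meval_D1 meval_D2 subr_eq0.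
move=> e m; have := H (inr (inr (e, m))).
rewrite /= mevalB !mevalM !rmorph_prod /= subr_eq0; apply: contra_neq => E.
have NE s : \prod_(c <- s) (Num c).@[param_coords lam] =
  \prod_(c <- s) (u - star_root u lam c) * \prod_(c <- s) (Den c).@[param_coords lam].
  by rewrite -big_split /=; apply: eq_bigr => c _; exact: meval_Num.
have eE : (if e then D1 else D2).@[param_coords lam] = if e then d1 lam else d2 lam.
  by case: e {E}; rewrite ?meval_D1 ?meval_D2.
have PE : \prod_(c <- Pcodes) (u - star_root u lam c) = (Ppol u lam).[u].
  by rewrite horner_Ppol /Pcodes /= !big_cons big_nil /star_root /zcoord /tnth /=; ring.
rewrite !NE eE PE -E /all_roots -map_mask big_map. ring.
Qed.


Lemma exists_avoiding (s : seq C) : exists w, w \notin s.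
Proof.
apply: contrapT => /forallNP H; apply: (negP (oner_neq0 {poly C})); apply/eqP.
by apply: (@poly_cofinite _ _ s) => z zs; case: (H z).
Qed.

Lemma exists_avoiding_square (a : C) : exists w, w != 0 /\ w ^+ 2 != a.
Proof.
have [w] := exists_avoiding [:: 0; sqrtC a; - sqrtC a].
rewrite !inE !negb_or => /and3P[w0 w1 w2]; exists w; split=> //.
by rewrite -[a]sqrtCK eqf_sqr negb_or w1 w2.
Qed.

(** Points of the parameter space with the z_i and d1 = w free; d2 is forced by the relation. *)
Definition sample (z : 'I_6 -> C) (w : C) : param C :=
  let y k := z (inord k) in
  Param (y 0) (y 1) (y 2) (y 3) (y 4) (y 5) w
    ((y 0 * y 2 * y 4) / (q * y 1 * y 3 * y 5) / w).

Lemma sample_space z w : (forall i, z i != 0) -> w != 0 -> parameter_space q (sample z w).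
Proof.
move=> z0 w0; split; last by rewrite /= mulrCA mulfV // mulr1.
by case=> [[|[|[|[|[|[|[|[|k]]]]]]]] Hk] //; rewrite /param_coords /tnth //= ?z0 //
  !mulf_neq0 ?invr_neq0 ?mulf_neq0.
Qed.

Lemma zcoord_sample z w i : zcoord (sample z w) i = z i.
Proof.
by case: i => [[|[|[|[|[|[|i]]]]]] Hi] //; congr (z _); apply/val_inj; rewrite /= inordK.
Qed.

Lemma genericity_poly_witness c : exists2 lam, parameter_space q lam &
  (genericity_poly c).@[param_coords lam] != 0.
Proof.
case: c => [[[[i j] n]|[[i j] n]]|[n|[e m]]] /=.
- have [ij|ij] := eqVneq i j.
    exists (sample (fun=> 1) 1); first by apply: sample_space => *; rewrite oner_neq0.
    by rewrite meval1 oner_neq0.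
  have [w] := exists_avoiding [:: 0; q ^ n].
  rewrite !inE negb_or => /andP[w0 wn].
  exists (sample (fun k => if k == i then w else 1) 1).
    by apply: sample_space => [k|]; [case: ifP|]; rewrite ?oner_neq0.
  rewrite mevalB mevalM mevalC !meval_Z !zcoord_sample eqxx [j == i]eq_sym (negbTE ij) mulr1.
  by rewrite subr_eq0.
- have [w [w0 wn]] := exists_avoiding_square (q ^ n * u ^+ 2).
  exists (sample (fun=> w) 1); first by apply: sample_space; rewrite ?oner_neq0.
  by rewrite mevalB mevalM mevalC !meval_Z !zcoord_sample -expr2 subr_eq0.
(* With all z_i = 1 one has d1 = w and d2 = 1/(q w), so the resonance to avoid is w^2 = q^n / q. *)
- have [w [w0 wn]] := exists_avoiding_square (q ^ n / q).
  exists (sample (fun=> 1) w); first by apply: sample_space => // *; rewrite oner_neq0.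
  rewrite mevalB mevalM mevalC meval_D1 meval_D2 subr_eq0 /=.
  apply: contra_neq wn => E; rewrite expr2 {1}E; field.
  by rewrite q0 w0.
(* All z_i are set to one value v different from 0 and u, which makes the products nonzero and
   independent of w. The polynomial becomes A w - B, and w avoids its root. *)
have [v] := exists_avoiding [:: 0; u].
rewrite !inE negb_or => /andP[v0 vu].
pose ev w := param_coords (sample (fun=> v) w).
have space w : w != 0 -> parameter_space q (sample (fun=> v) w).
  by move=> w0; apply: sample_space.
have NumE c w : (Num c).@[ev w] = if c.1 then u * v - u ^+ 2 else u - v.
  by rewrite /Num; case: c.1; rewrite mevalB ?mevalM !mevalC meval_Z zcoord_sample.
have DenE c w : (Den c).@[ev w] = if c.1 then v else 1.
  by rewrite meval_Den zcoord_sample.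
have N0 s w : \prod_(c <- s) (Num c).@[ev w] != 0.
  rewrite prodf_seq_neq0; apply/allP => c _; rewrite /= NumE.
  case: c.1; last by rewrite subr_eq0 eq_sym.
  by rewrite expr2 -mulrBr mulf_neq0 // subr_eq0.
have D0 s w : \prod_(c <- s) (Den c).@[ev w] != 0.
  by rewrite prodf_seq_neq0; apply/allP => c _; rewrite /= DenE; case: c.1; rewrite ?oner_neq0.
set N := \prod_(c <- mask m root_codes) _; set P := \prod_(c <- Pcodes) Num c.
pose A := \prod_(c <- mask m root_codes) (Num c).@[ev 1] * \prod_(c <- Pcodes) (Den c).@[ev 1].
pose B := \prod_(c <- mask m root_codes) (Den c).@[ev 1] * \prod_(c <- Pcodes) (Num c).@[ev 1].
have A0 : A != 0 by rewrite mulf_neq0.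
have [w] := exists_avoiding [:: 0; B / A].
rewrite !inE negb_or => /andP[w0 wB].
pose K := v * v * v / (q * v * v * v).
have K0 : K != 0 by rewrite !mulf_neq0 ?invr_neq0 ?mulf_neq0.
(* Chosen so that the one of d1, d2 selected by e takes the value w. *)
pose w' := if e then w else K / w.
have w'0 : w' != 0 by rewrite /w'; case: (e) => //; exact: mulf_neq0 K0 (invr_neq0 w0).
exists (sample (fun=> v) w'); first exact: space.
rewrite mevalB !mevalM /N /P !rmorph_prod /= -/(ev w').
have -> : (if e then D1 else D2).@[ev w'] = w.
  rewrite /w'; case: (e); rewrite ?meval_D1 ?meval_D2 //= -/K.
  by rewrite invf_div mulrCA mulfV // mulr1.
have NE s : \prod_(c <- s) (Num c).@[ev w'] = \prod_(c <- s) (Num c).@[ev 1].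
  by apply: eq_bigr => c _; rewrite !NumE.
have DE s : \prod_(c <- s) (Den c).@[ev w'] = \prod_(c <- s) (Den c).@[ev 1].
  by apply: eq_bigr => c _; rewrite !DenE.
rewrite !NE !DE -mulrA -/A -/B subr_eq0.
by apply: contra_neq wB => <-; rewrite mulfK.
Qed.

Lemma generic_nonresonant (G : param C -> Prop) :
  (forall lam, parameter_space q lam -> nonresonant u q lam -> irreducible_type u lam -> G lam) ->
  generic q G.
Proof.
move=> HG.
(* Numbers that encode no condition get the polynomial 1, which excludes no parameter. *)
pose Phi n := if unpickle n is Some c then genericity_poly c else 1.
exists Phi; split=> [n|lam sp H].
  rewrite /Phi; case: unpickle => [c|]; first exact: genericity_poly_witness.
  exists (sample (fun=> 1) 1); first by apply: sample_space => *; rewrite oner_neq0.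
  by rewrite meval1 oner_neq0.
have [] := genericity_nonresonant sp; last exact: HG.
by move=> c; have := H (pickle c); rewrite /Phi pickleK.
Qed.

End Generic.

Local Open Scope complex_scope.

Theorem theorem1p2p5 (R : realType) (u q : R) (hu : 0 < u < 1) (hq : 0 < q < 1) :
  generic (q%:C : R[i]) (fun lam : param R[i] =>
    let lamb := lambda_bar q%:C lam in
    exists phi : moduli u%:C q%:C lam -> moduli u%:C q%:C lamb,
      [/\ modification_map phi,
          regular_morphism phi &
          forall (m : moduli u%:C q%:C lam) (f g fb gb : R[i]),
            identity_at_minus_u m ->
            coordinates m f g -> coordinates (phi m) fb gb ->
            qPE7_first u%:C q%:C lam f fb g /\
            qPE7_second u%:C q%:C lamb fb gb g]).
Proof.
have [/andP[u_gt0 _] /andP[q_gt0 q_lt1]] := (hu, hq).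
have u0 : (u%:C : R[i]) != 0 by rewrite (fmorph_eq0 (real_complex R)) gt_eqF.
have q0 : (q%:C : R[i]) != 0 by rewrite (fmorph_eq0 (real_complex R)) gt_eqF.
(* The bounds on q enter as: q is not a root of unity. *)
have q1 k : (0 < k)%N -> (q%:C : R[i]) ^+ k != 1.
  move=> k0; rewrite -rmorphXn /= -(rmorph1 (real_complex R)).
  rewrite (inj_eq (fmorph_inj _)) lt_eqF //.
  by rewrite exprn_ilt1 ?ltW // -lt0n.
apply: (generic_nonresonant u0 q0) => lam [_ dd] nr irr lamb.
have [phi mm] := modification_map_exists u0 q0 q1 nr irr.
exists phi; split.
- exact: mm.
- exact: (modification_map_regular u0 q0 nr irr mm).
- move=> m f g fb gb; exact: (modification_map_painleve u0 q0 q1 nr irr dd mm).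
Qed.
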